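(* Let $\{a_n\}_{n=0}^\infty$ be i.i.d. standard complex Gaussian random variables and let $\Upsilon_{\mathbb{C}}$ be the point process on $\mathbb{C}\cong\mathbb{R}^2$ whose support is the set of zeros of the random entire function $f(z)=\sum_{n=0}^\infty\frac{a_n}{\sqrt{n!}}z^n$. Then $\Upsilon_{\mathbb{C}}$ is neither insertion-tolerant nor deletion-tolerant.
   Context: A standard complex Gaussian random variable has density $\pi^{-1}\exp(-|z|^2)$ with respect to Lebesgue measure on $\mathbb{C}$. Point processes are always simple and locally finite, i.e. random elements of the space $\mathbb{M}$ of simple locally finite point measures, equipped with the $\sigma$-field generated by the evaluations $\mu\mapsto\mu(A)$, $A$ Borel. The support of $\mu\in\mathbb{M}$ is $[\mu]=\{y:\mu(\{y\})=1\}$. For random variables $X,Y$ with values in the same measurable space, $X\prec Y$ means that $\mathbb{P}(Y\in\mathcal{A})=0$ implies $\mathbb{P}(X\in\mathcal{A})=0$ for all measurable $\mathcal{A}$. $\delta_x$ is the point measure at $x$. A point process $\Pi$ on $\mathbb{C}$ is insertion-tolerant if for every Borel set $S\subseteq\mathbb{C}$ with Lebesgue measure in $(0,\infty)$, if $U$ is uniformly distributed on $S$ and independent of $\Pi$, then $\Pi+\delta_U\prec\Pi$. A $\Pi$-point is a $\mathbb{C}$-valued random variable $Z$ with $Z\in[\Pi]$ almost surely; $\Pi$ is deletion-tolerant if $\Pi-\delta_Z\prec\Pi$ for every $\Pi$-point $Z$. *)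

(* Defs.v *)
From HB Require Import structures.
From mathcomp Require Import all_boot all_order all_algebra finmap.
From mathcomp Require Import all_classical all_reals all_analysis.
From mathcomp Require Import measurable_realfun.
From mathcomp Require Export complex.

Set Implicit Arguments.
Unset Strict Implicit.
Unset Printing Implicit Defensive.

Import Order.TTheory GRing.Theory Num.Theory.
Import numFieldNormedType.Exports.

Local Open Scope classical_set_scope.
Local Open Scope ring_scope.

(* As a measurable space, the complex plane is the product of two real lines
   with their Borel sigma-algebras; [toC] identifies its points with the elements
   of the field [R[i]]. *)

Definition plane (R : realType) := (measurableTypeR R * measurableTypeR R)%type.

Definition toC {R : realType} (z : plane R) : R[i] := Complex (z.1 : R) (z.2 : R).

Definition lebesgue2 (R : realType) : set (plane R) -> \bar R :=
  (@lebesgue_measure R \x @lebesgue_measure R)%E.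

(* A sum of unit masses over a set, rather than over a family, of points gives
   every point mass at most 1: this is simplicity. *)
Definition simple_point_measure (R : realType)
    (mu : {measure set (plane R) -> \bar R}) : Prop :=
  exists X : set (plane R), forall A : set (plane R), measurable A ->
    mu A = \esum_(x in X) (\d_x A)%R.

Definition locally_finite (R : realType)
    (mu : {measure set (plane R) -> \bar R}) : Prop :=
  forall K : set (R * R), compact K -> (mu K < +oo)%E.

Record point_config (R : realType) := PointConfig {
  config_measure :> {measure set (plane R) -> \bar R};
  config_simple : simple_point_measure config_measure;
  config_locally_finite : locally_finite config_measure }.

Section point_config_measurable.
Context (R : realType).
Local Notation M := (point_config R).

Lemma mzero_simple_point_measure :
  simple_point_measure (@mzero _ (plane R) R).
Proof. by exists set0 => A _; rewrite esum_set0. Qed.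

Lemma mzero_locally_finite : locally_finite (@mzero _ (plane R) R).
Proof. by move=> K _; rewrite /mzero ltry. Qed.

HB.instance Definition _ := gen_eqMixin M.
HB.instance Definition _ := gen_choiceMixin M.
HB.instance Definition _ := isPointed.Build M
  (PointConfig mzero_simple_point_measure mzero_locally_finite).

(* the sigma-algebra generated by the evaluations [mu |-> mu A], A Borel *)
Definition config_measurable : set_system M :=
  <<s \bigcup_(A in @measurable _ (plane R))
        preimage_set_system [set: M] (fun mu : M => mu A) measurable >>.

Let config_measurable0 : config_measurable set0.
Proof. exact: sigma_algebra0. Qed.

Let config_measurableC (U : set M) :
  config_measurable U -> config_measurable (~` U).
Proof. exact: sigma_algebraC. Qed.

Let config_measurableU (F : (set M)^nat) :
  (forall i, config_measurable (F i)) -> config_measurable (\bigcup_i F i).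
Proof. exact: sigma_algebra_bigcup. Qed.

Definition config_display : measure_display.
Proof. by constructor. Qed.

HB.instance Definition _ := @isMeasurable.Build config_display M
  config_measurable config_measurable0 config_measurableC config_measurableU.

End point_config_measurable.

Definition config_support (R : realType) (mu : point_config R) : set (plane R) :=
  [set y | mu [set y] = 1%E].

Definition abs_cont_law (R : realType) (d1 d2 d : measure_display)
    (T1 : measurableType d1) (T2 : measurableType d2) (V : measurableType d)
    (P1 : probability T1 R) (X : {RV P1 >-> V})
    (P2 : probability T2 R) (Y : {RV P2 >-> V}) : Prop :=
  forall A : set V, measurable A -> P2 (Y @^-1` A) = 0%E -> P1 (X @^-1` A) = 0%E.
Arguments abs_cont_law {R d1 d2 d T1 T2 V} P1 X P2 Y.

Definition same_law (R : realType) (d1 d2 d : measure_display)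
    (T1 : measurableType d1) (T2 : measurableType d2) (V : measurableType d)
    (P1 : probability T1 R) (X : {RV P1 >-> V})
    (P2 : probability T2 R) (Y : {RV P2 >-> V}) : Prop :=
  forall A : set V, measurable A -> P1 (X @^-1` A) = P2 (Y @^-1` A).
Arguments same_law {R d1 d2 d T1 T2 V} P1 X P2 Y.

Definition independent_pair (R : realType) (d d1 d2 : measure_display)
    (T : measurableType d) (V1 : measurableType d1) (V2 : measurableType d2)
    (P : probability T R) (X : {RV P >-> V1}) (Y : {RV P >-> V2}) : Prop :=
  forall (A : set V1) (B : set V2), measurable A -> measurable B ->
    P (X @^-1` A `&` Y @^-1` B) = (P (X @^-1` A) * P (Y @^-1` B))%E.
Arguments independent_pair {R d d1 d2 T V1 V2} P X Y.

Definition independent_family (R : realType) (d d' : measure_display)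
    (T : measurableType d) (V : measurableType d') (P : probability T R)
    (I : choiceType) (X : I -> {RV P >-> V}) : Prop :=
  forall (J : {fset I}) (A : I -> set V), (forall i, measurable (A i)) ->
    P (\bigcap_(i in [set` J]) (X i @^-1` A i)) =
    (\prod_(i <- J) P (X i @^-1` A i))%E.
Arguments independent_family {R d d' T V} P {I} X.

Definition uniform_on (R : realType) (d : measure_display)
    (T : measurableType d) (P : probability T R)
    (U : {RV P >-> plane R}) (S : set (plane R)) : Prop :=
  forall A : set (plane R), measurable A ->
    P (U @^-1` A) = (lebesgue2 (A `&` S) / lebesgue2 S)%E.
Arguments uniform_on {R d T} P U S.

Definition std_complex_gaussian (R : realType) (d : measure_display)
    (T : measurableType d) (P : probability T R)
    (X : {RV P >-> plane R}) : Prop :=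
  forall A : set (plane R), measurable A ->
    P (X @^-1` A) =
    (\int[@lebesgue2 R]_(z in A)
       (pi^-1 * expR (- ((z.1 : R) ^+ 2 + (z.2 : R) ^+ 2)))%:E)%E.
Arguments std_complex_gaussian {R d T} P X.

(* [U] need not exist on the probability space [(T, P)] carrying [Pi] (which may
   be too small), so [(Pi', U)] ranges over all realizations, on any probability
   space, of an independent pair in which [Pi'] has the law of [Pi].  The sum
   [Pi' + delta_U] is a simple configuration only almost surely; as a random
   element of the configuration space it is any [Y] that agrees with it almost
   surely.  Measures are compared on Borel sets only, their values elsewhere
   being irrelevant. *)
Definition insertion_tolerant (R : realType) (d : measure_display)
    (T : measurableType d) (P : probability T R)
    (Pi : {RV P >-> point_config R}) : Prop :=
  forall S : set (plane R), measurable S ->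
    (0 < lebesgue2 S)%E -> (lebesgue2 S < +oo)%E ->
  forall (d' : measure_display) (T' : measurableType d') (P' : probability T' R)
    (Pi' Y : {RV P' >-> point_config R}) (U : {RV P' >-> plane R}),
    same_law P' Pi' P Pi -> uniform_on P' U S -> independent_pair P' U Pi' ->
    {ae P', forall w, forall B : set (plane R), measurable B ->
       Y w B = (Pi' w B + \d_(U w) B)%E} ->
    abs_cont_law P' Y P Pi.
Arguments insertion_tolerant {R d T} P Pi.

Definition is_point_of (R : realType) (d : measure_display)
    (T : measurableType d) (P : probability T R)
    (Pi : {RV P >-> point_config R}) (Z : {RV P >-> plane R}) : Prop :=
  {ae P, forall w, config_support (Pi w) (Z w)}.
Arguments is_point_of {R d T} P Pi Z.

Definition deletion_tolerant (R : realType) (d : measure_display)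
    (T : measurableType d) (P : probability T R)
    (Pi : {RV P >-> point_config R}) : Prop :=
  forall (Z : {RV P >-> plane R}) (Y : {RV P >-> point_config R}),
    is_point_of P Pi Z ->
    {ae P, forall w, forall B : set (plane R), measurable B ->
       Y w B = (Pi w B - \d_(Z w) B)%E} ->
    abs_cont_law P Y P Pi.
Arguments deletion_tolerant {R d T} P Pi.

(* The limit is taken in the topology of [R[i]] given by the complex modulus. *)
Definition gaf (R : realType) (a : nat -> plane R) (z : R[i]) : R[i] :=
  let C : numClosedFieldType := R[i] in
  limn (series (fun n : nat =>
    (toC (a n) / real_complex R (Num.sqrt (n`!%:R)) * z ^+ n : C))).

(* Main.v *)
(** The Jensen counting function [N_k(mu)], the integral of [max(0, ln(4^k / |z|))]
    against a configuration [mu], grows by [k ln 4 - ln |u|] (for large [k]) when a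
    point [u <> 0] is inserted, whereas for the zeros of [f] it is, almost surely,
    at most [16^k / 2 + O(k)] for all [k] and at least [16^k / 2 - O(k)] for
    infinitely many [k].  So the zeros lie almost surely in the first set of the
    decreasing family [excess_set j], and almost surely outside the 27th one, while
    adding a point leads from [excess_set j] into [excess_set j.+1].  Insertion
    tolerance would carry positive probability from each set to the next one, and
    deletion tolerance would carry it from each complement to the previous one.

    The upper bound only uses that [|a_n|] is at most quadratic in [n]: reflecting
    the zeros in the circle changes the l2 norm of the coefficients by known factors.
    For the lower bound, Jensen's formula is discretised at the roots of
    [X^M - r^M], [M = (m+1)^2], for the partial sums of degree [< m].  Conditionally
    on the other coefficients, [a_n] with [n = 16^k] spreads the value at each node,
    and Markov's inequality applied to the pairs of a node and a level below which
    the value falls shows that the product of the values is rarely small.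
    A multiple zero of [f] would be counted only once by the configuration; there is
    almost surely none, by anticoncentration of [f] on a fine grid, [f] being
    quadratically small near a multiple zero. *)

Require Import Defs.
From HB Require Import structures.
From mathcomp Require Import all_boot all_order all_algebra finmap.
From mathcomp Require Import zify ring lra.
From mathcomp Require Import all_classical all_reals all_analysis.
From mathcomp Require Import measurable_realfun.

Set Implicit Arguments.
Unset Strict Implicit.
Unset Printing Implicit Defensive.

Import Order.TTheory GRing.Theory Num.Theory.
Import numFieldNormedType.Exports.
Import ComplexField.Normc.

Local Open Scope classical_set_scope.
Local Open Scope ring_scope.

(** * Modulus and polynomial norms *)

(** A single point changes the counting function by about ln r only, which is also the order of the
    error terms in both Jensen bounds. So an asymptotic of the form r^2 / 2 (1 + o(1)) would see
    nothing, and one insertion gives no contradiction: tolerance has to be iterated. The radii r =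
    4^k make r^2 = 16^k an integer, the index of the dominant monomial on the circle, and turn O(ln
    r) into O(k). The number of steps comes from the constants: up to additive constants the lower
    bound loses 3k and the upper bound exceeds by 8k, so thresholds rising from -4k to 9k in steps
    of k/2 suffice, which makes 26 steps.

    Jensen's inequalities are proved for polynomials, and [f] enters the deterministic part as the
    locally uniform limit of its partial sums. These do not vanish at the zeros of [f]. For the
    upper bound a small interpolation polynomial is subtracted to make them vanish; for the lower
    bound their roots in the disc are matched with nearby zeros of [f]. The matching must be
    injective, and this is where simplicity of the zeros enters. *)

Section complex_modulus.
Variable R : realType.
Implicit Types z w : R[i].

Lemma sqr_normcE z : normc z ^+ 2 = complex.Re z ^+ 2 + complex.Im z ^+ 2.
Proof. by case: z => a b /=; rewrite sqr_sqrtr // addr_ge0 // sqr_ge0. Qed.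

Lemma normc_ge0 z : 0 <= normc z.
Proof. by case: z => a b; rewrite sqrtr_ge0. Qed.

Lemma normc_eq0 z : (normc z == 0) = (z == 0).
Proof.
by apply/eqP/eqP => [/eq0_normc//|->]; rewrite normc0.
Qed.

Lemma normc_gt0 z : (0 < normc z) = (z != 0).
Proof. by rewrite lt_neqAle normc_ge0 andbT eq_sym normc_eq0. Qed.

Lemma normcBC z w : normc (z - w) = normc (w - z).
Proof. by rewrite -normcN opprB. Qed.

Lemma normcX z n : normc (z ^+ n) = normc z ^+ n.
Proof. by elim: n => [|n IH]; rewrite ?normc1 // !exprS normcM IH. Qed.

Lemma normc_prod (I : Type) (s : seq I) (F : I -> R[i]) :
  normc (\prod_(i <- s) F i) = \prod_(i <- s) normc (F i).
Proof.
by elim: s => [|i s IH]; rewrite ?big_nil ?normc1 // !big_cons normcM IH.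
Qed.

Lemma le_normc_sum (I : Type) (s : seq I) (P : pred I) (F : I -> R[i]) :
  normc (\sum_(i <- s | P i) F i) <= \sum_(i <- s | P i) normc (F i).
Proof.
elim/big_rec2 : _ => [|i y x _ le_xy]; first by rewrite normc0.
by rewrite (le_trans (le_normcD _ _)) // lerD2l.
Qed.

Lemma le_normcB z w : normc (z - w) <= normc z + normc w.
Proof. by rewrite (le_trans (le_normcD _ _)) // normcN. Qed.

Lemma lerB_normc z w : normc z - normc w <= normc (z - w).
Proof. by rewrite lerBlDr; have := le_normcD (z - w) w; rewrite subrK. Qed.

Lemma normc_real (x : R) : normc (real_complex R x) = `|x|.
Proof. by rewrite /= expr0n /= addr0 sqrtr_sqr. Qed.

Lemma normr_complexE z : `|z| = real_complex R (normc z).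
Proof. by case: z => a b; rewrite normc_def. Qed.

Lemma le_normc_abs (x y : R) : normc (Complex x y) <= `|x| + `|y|.
Proof.
rewrite -(ler_pXn2r (_ : (0 < 2)%N)) ?nnegrE ?normc_ge0 ?addr_ge0 //.
rewrite sqr_normcE /= sqrrD !real_normK ?num_real //.
have : 0 <= `|x| * `|y| by rewrite mulr_ge0.
rewrite mulr2n; lra.
Qed.

Lemma abs_le_normc (x y : R) : `|x| <= normc (Complex x y).
Proof.
rewrite -(ler_pXn2r (_ : (0 < 2)%N)) ?nnegrE ?normc_ge0 //.
by rewrite sqr_normcE /= real_normK ?num_real // lerDl sqr_ge0.
Qed.

Lemma abs_le_normc2 (x y : R) : `|y| <= normc (Complex x y).
Proof.
rewrite -(ler_pXn2r (_ : (0 < 2)%N)) ?nnegrE ?normc_ge0 //.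
by rewrite sqr_normcE /= real_normK ?num_real // lerDr sqr_ge0.
Qed.

End complex_modulus.

Section weighted_norms.
Variable R : realType.
Implicit Types (p q h : {poly R[i]}) (z w : R[i]) (r s : R).

(** This norm replaces the supremum over the disc of radius [r]: it dominates it, and division by a
    linear factor is controlled in it by pure algebra. *)
Definition l1norm r p : R := \sum_(i < size p) normc p`_i * r ^+ i.

(** By Parseval, the mean of |p|^2 over the circle of radius [r]. *)
Definition l2sum r p : R := \sum_(i < size p) normc p`_i ^+ 2 * (r ^+ 2) ^+ i.

Lemma l1norm_wide r p n : (size p <= n)%N ->
  l1norm r p = \sum_(i < n) normc p`_i * r ^+ i.
Proof.
move=> pn; rewrite /l1norm (big_ord_widen n (fun i => normc p`_i * r ^+ i)) //.
rewrite big_mkcond; apply: eq_bigr => i _; case: ltnP => // le_pi.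
by rewrite nth_default // normc0 mul0r.
Qed.

Lemma l2sum_wide r p n : (size p <= n)%N ->
  l2sum r p = \sum_(i < n) normc p`_i ^+ 2 * (r ^+ 2) ^+ i.
Proof.
move=> pn; rewrite /l2sum.
rewrite (big_ord_widen n (fun i => normc p`_i ^+ 2 * (r ^+ 2) ^+ i)) //.
rewrite big_mkcond; apply: eq_bigr => i _; case: ltnP => // le_pi.
by rewrite nth_default // normc0 expr0n mul0r.
Qed.

Lemma l1norm_ge0 r p : 0 <= r -> 0 <= l1norm r p.
Proof. by move=> r0; apply: sumr_ge0 => i _; rewrite mulr_ge0 ?normc_ge0 ?exprn_ge0. Qed.

Lemma le_l1normD r p q : 0 <= r -> l1norm r (p + q) <= l1norm r p + l1norm r q.
Proof.
move=> r0; pose n := maxn (size p) (size q).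
rewrite (l1norm_wide _ (size_polyD p q)) (l1norm_wide r (leq_maxl _ _ : (size p <= n)%N)).
rewrite (l1norm_wide r (leq_maxr _ _ : (size q <= n)%N)) -big_split /=.
apply: ler_sum => i _; rewrite -mulrDl ler_wpM2r ?exprn_ge0 //.
by rewrite coefD le_normcD.
Qed.

Lemma l1normN r p : l1norm r (- p) = l1norm r p.
Proof.
rewrite /l1norm size_polyN; apply: eq_bigr => i _.
by rewrite coefN normcN.
Qed.

Lemma l1normZ r z p : l1norm r (z *: p) = normc z * l1norm r p.
Proof.
rewrite (l1norm_wide _ (size_scale_leq z p)) /l1norm mulr_sumr.
by apply: eq_bigr => i _; rewrite coefZ normcM mulrA.
Qed.

Lemma l1normC r z : l1norm r z%:P = normc z.
Proof.
rewrite (@l1norm_wide _ _ 1) ?size_polyC ?leq_b1 // big_ord1.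
by rewrite coefC eqxx expr0 mulr1.
Qed.

Lemma l1normXM r p : l1norm r ('X * p) = r * l1norm r p.
Proof.
rewrite (@l1norm_wide _ _ (size p).+1); last first.
  by rewrite (leq_trans (size_polyMleq _ _)) // size_polyX.
rewrite big_ord_recl /= coefXM eqxx normc0 mul0r add0r /l1norm mulr_sumr.
apply: eq_bigr => i _; rewrite coefXM /= /bump /= add1n exprS; ring.
Qed.

Lemma normc_horner_le r p z : normc z <= r -> normc p.[z] <= l1norm r p.
Proof.
move=> zr; rewrite horner_coef (le_trans (le_normc_sum _ _ _)) //.
apply: ler_sum => i _; rewrite normcM normcX ler_wpM2l ?normc_ge0 //.
by rewrite lerXn2r // ?nnegrE ?normc_ge0 // (le_trans (normc_ge0 z)).
Qed.

(* In the norm [l1norm s], multiplication by ['X] has norm exactly [s], hence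
   division by ['X - z] costs at most [1 / (s - r)]. *)
Lemma l1norm_div_root r s p q z : 0 <= s -> normc z <= r ->
  p = ('X - z%:P) * q -> (s - r) * l1norm s q <= l1norm s p.
Proof.
move=> s0 zr ->; rewrite mulrBl -l1normXM lerBlDr.
have -> : 'X * q = ('X - z%:P) * q + z *: q by rewrite mulrBl mul_polyC subrK.
apply: (le_trans (le_l1normD _ _ s0)); rewrite lerD2l l1normZ.
by rewrite ler_wpM2r // l1norm_ge0.
Qed.

(** The polynomial p - p(w) is divisible by X - w, and at radius r + 1 the quotient has norm at most
    that of the dividend, because (r + 1) - r = 1. *)
Lemma horner_lipschitz r p z w : 0 <= r -> normc z <= r -> normc w <= r ->
  normc (p.[z] - p.[w]) <= 2 * l1norm (r + 1) p * normc (z - w).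
Proof.
move=> r0 zr wr; have /factor_theorem[q pE] : root (p - p.[w]%:P) w.
  by rewrite rootE !hornerE subrr.
have -> : p.[z] - p.[w] = q.[z] * (z - w).
  have -> : p.[z] - p.[w] = (p - p.[w]%:P).[z] by rewrite !hornerE.
  by rewrite pE !hornerE.
rewrite normcM ler_wpM2r ?normc_ge0 //.
have r1 : 0 <= r + 1 by lra.
have := l1norm_div_root r1 wr (etrans pE (mulrC _ _)).
rewrite addrAC subrr add0r mul1r => qle.
have zr1 : normc z <= r + 1 by lra.
have wr1 : normc w <= r + 1 by lra.
apply: (le_trans (normc_horner_le q zr1)); apply: (le_trans qle).
apply: (le_trans (le_l1normD _ _ r1)).
rewrite l1normN l1normC mulr_natl mulr2n lerD2l.
exact: normc_horner_le.
Qed.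

(** Two divisions at radius r + 1, each with constant 1. Two roots close to one point thus force a
    nearly quadratic bound around it, uniformly in the degree. *)
Lemma horner_two_roots r p q z w c : 0 <= r -> normc z <= r -> normc w <= r ->
  normc c <= r + 1 -> p = ('X - z%:P) * (('X - w%:P) * q) ->
  normc p.[c] <= l1norm (r + 1) p * normc (c - z) * normc (c - w).
Proof.
move=> r0 zr wr cr pE.
have r1 : 0 <= r + 1 by lra.
have := l1norm_div_root r1 zr pE; rewrite addrAC subrr add0r mul1r => le1.
have := l1norm_div_root r1 wr (erefl (('X - w%:P) * q)).
rewrite addrAC subrr add0r mul1r => /le_trans /(_ le1) le2; rewrite {1}pE !hornerE !normcM.
rewrite mulrC -[leRHS]mulrA ler_wpM2r ?mulr_ge0 ?normc_ge0 //.
exact: (le_trans (normc_horner_le q cr)).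
Qed.

Lemma l2sum_ge0 r p : 0 <= l2sum r p.
Proof.
by apply: sumr_ge0 => i _; apply: mulr_ge0; apply: exprn_ge0; rewrite ?normc_ge0 ?sqr_ge0.
Qed.

(* Reflecting the root [z] in the circle of radius [r] changes the weighted sum
   of squares of the coefficients only by the factor [r ^+ 2]; this replaces the
   Blaschke factors in the proof of Jensen's inequality. *)
Lemma l2sum_reflect r z h :
  l2sum r ((conjc z *: 'X - (real_complex R (r ^+ 2))%:P) * h) =
  r ^+ 2 * l2sum r (('X - z%:P) * h).
Proof.
set n := (size h).+2.
have n1 : (size (('X - z%:P) * h)%R <= n)%N.
  rewrite (leq_trans (size_polyMleq _ _)) // size_XsubC; exact: leqnSn.
have n2 : (size ((conjc z *: 'X - (real_complex R (r ^+ 2))%:P) * h)%R <= n)%N.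
  rewrite (leq_trans (size_polyMleq _ _)) //.
  have : (size (conjc z *: 'X - (real_complex R (r ^+ 2))%:P)%R <= 2)%N.
    rewrite (leq_trans (size_polyD _ _)) // geq_max size_polyN.
    rewrite (leq_trans (size_scale_leq _ _)) ?size_polyX //.
    by rewrite (leq_trans (size_polyC_leq1 _)).
  by move: (size _) => k k2; rewrite /n -subn1 leq_subLR add1n ltnW // ltnS -add2n leq_add2r.
rewrite (l2sum_wide _ n1) (l2sum_wide _ n2) mulr_sumr; apply/eqP.
rewrite -subr_eq0 -sumrB; apply/eqP.
(* With a = h_(i-1) and b = h_i, the cross terms of |conj(z) a - r^2 b|^2 and r^2 |a - z b|^2
   coincide. What remains is (|z|^2 - r^2)(|a|^2 - r^2 |b|^2), and the sum telescopes. Both ends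
   vanish: [u 0] by definition, the other one because n - 1 exceeds [size h]. *)
pose u i := if i is j.+1 then normc h`_j ^+ 2 * (r ^+ 2) ^+ j.+1 else 0.
rewrite (eq_bigr (fun i : 'I_n =>
  (normc z ^+ 2 - r ^+ 2) * (u i - u i.+1))); last first.
  move=> i _; have -> : (('X - z%:P) * h)`_i =
      (if i == 0%N :> nat then 0 else h`_i.-1) - z * h`_i.
    by rewrite mulrBl coefB coefXM coefCM.
  have -> : ((conjc z *: 'X - (real_complex R (r ^+ 2))%:P) * h)`_i =
      conjc z * (if i == 0%N :> nat then 0 else h`_i.-1) -
      real_complex R (r ^+ 2) * h`_i.
    by rewrite mulrBl coefB -mul_polyC -mulrA !coefCM coefXM.
  case: i => -[|i] ilt; rewrite /u /= !sqr_normcE /=.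
    case: (h`_0) => a b; case: z {n1 n2} => c d /=; ring.
  case: (h`_i.+1) => a b; case: (h`_i) => a' b'; case: z {n1 n2} => c d /=.
  rewrite !exprS; ring.
rewrite -mulr_sumr -(big_mkord xpredT (fun i => u i - u i.+1)).
rewrite (@telescope_sumr_eq _ 0 n (fun i => - u i)) //; last first.
  by move=> i _; rewrite opprK addrC.
by rewrite /n /= nth_default // normc0 expr0n mul0r oppr0 subrr mulr0.
Qed.

Lemma normc_coef0_le_l2sum r p : normc p`_0 ^+ 2 <= l2sum r p.
Proof.
rewrite (@l2sum_wide _ _ (size p).+1) // big_ord_recl expr0 mulr1 lerDl.
apply: sumr_ge0 => i _; apply: mulr_ge0; apply: exprn_ge0; by rewrite ?normc_ge0 ?sqr_ge0.
Qed.

(** Reflecting a root replaces its factor |z|^2 in the squared constant coefficient by r^4 and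
    multiplies [l2sum r] by r^2. Once all the roots are reflected, the squared constant coefficient
    is one of the terms of [l2sum r]. *)
Lemma jensen_upper r (zs : seq R[i]) h :
  normc ((\prod_(z <- zs) ('X - z%:P)) * h)`_0 ^+ 2 * (r ^+ 2) ^+ size zs <=
  (\prod_(z <- zs) normc z ^+ 2) * l2sum r ((\prod_(z <- zs) ('X - z%:P)) * h).
Proof.
elim: zs h => [|z zs IH] h.
  by rewrite !big_nil mul1r expr0 mulr1 mul1r normc_coef0_le_l2sum.
rewrite !big_cons -mulrA; set w := \prod_(_ <- zs) _.
set s := conjc z *: 'X - (real_complex R (r ^+ 2))%:P.
have coefE (q : {poly R[i]}) :
    normc (('X - z%:P) * q)`_0 ^+ 2 = normc z ^+ 2 * normc q`_0 ^+ 2.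
  by rewrite !coef0M coefB coefX coefC /= sub0r normcM normcN exprMn.
have coefE2 (q : {poly R[i]}) :
    normc (s * q)`_0 ^+ 2 = (r ^+ 2) ^+ 2 * normc q`_0 ^+ 2.
  rewrite !coef0M coefB coefZ coefX coefC /= mulr0 sub0r normcM normcN exprMn.
  by rewrite normc_real ger0_norm ?sqr_ge0.
have [->|r0] := eqVneq r 0.
  rewrite expr0n /= expr0n /= mulr0.
  rewrite mulr_ge0 ?l2sum_ge0 // mulr_ge0 ?sqr_ge0 ?prodr_ge0 // => *.
  exact: sqr_ge0.
have := IH (s * h); rewrite mulrCA coefE2 l2sum_reflect => IH'.
have r2 : 0 < r ^+ 2 by rewrite exprn_even_gt0.
have key (A B L Z x : R) n : 0 < x -> 0 <= Z ->
    x ^+ 2 * A * x ^+ n <= B * (x * L) -> Z * A * x ^+ n.+1 <= Z * B * L.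
  move=> x0 Z0 h1; rewrite -!mulrA ler_wpM2l // -(ler_pM2l x0).
  by move: h1; rewrite expr2 exprS; congr (_ <= _); ring.
by rewrite coefE; apply: key r2 (sqr_ge0 _) IH'.
Qed.

Lemma max_pow_sub_le z w r M : normc w = r -> 0 <= r ->
  normc (z ^+ M - w ^+ M) <= 2 * Num.max (normc z) r ^+ M.
Proof.
move=> wr r0; rewrite (le_trans (le_normcB _ _)) // !normcX wr mulr_natl mulr2n.
by rewrite lerD // lerXn2r ?nnegrE ?normc_ge0 ?le_max ?lexx ?orbT ?normc_ge0 ?r0.
Qed.

(* Evaluating [p] at all the roots of ['X^M - (r ^+ M)] multiplies the factors
   [z ^+ M - r ^+ M] over the roots [z] of [p]: a discrete Jensen formula. *)
Lemma jensen_lower r M : 0 <= r -> (0 < M)%N ->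
  exists s : seq R[i], [/\ size s = M, forall w, w \in s -> normc w = r &
  forall c (zs : seq R[i]),
  \prod_(w <- s) normc (c *: \prod_(z <- zs) ('X - z%:P)).[w] <=
  2 ^+ size zs * (normc c * \prod_(z <- zs) Num.max (normc z) r) ^+ M].
Proof.
move=> r0 M0; pose a := real_complex R r ^+ M.
have [s sE] := closed_field_poly_normal ('X^M - a%:P).
move: sE; rewrite lead_coefXnsubC // scale1r => sE.
have sM : size s = M.
  by have := size_XnsubC a M0; rewrite sE size_prod_XsubC => -[].
have rs w : w \in s -> normc w = r.
  move=> ws; have : root ('X^M - a%:P) w by rewrite sE root_prod_XsubC.
  rewrite rootE !hornerE subr_eq0 => /eqP /(congr1 (@normc R)).
  rewrite !normcX normc_real ger0_norm // => /eqP.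
  by rewrite eqrXn2 ?normc_ge0 // => /eqP.
exists s; split => // c zs.
have ev z : \prod_(w <- s) normc (w - z) = normc (z ^+ M - a).
  rewrite -normc_prod.
  have -> : z ^+ M - a = ('X^M - a%:P).[z] by rewrite !hornerE.
  rewrite sE horner_prod !normc_prod.
  by apply: eq_bigr => w _; rewrite !hornerE normcBC.
rewrite (eq_bigr (fun w => normc c * \prod_(z <- zs) normc (w - z))); last first.
  move=> w _; rewrite hornerZ normcM horner_prod normc_prod.
  by congr (_ * _); apply: eq_bigr => z _; rewrite !hornerE.
rewrite big_split /= big_const_seq count_predT sM iter_mulr_1.
rewrite exchange_big /= exprMn mulrCA ler_wpM2l ?exprn_ge0 ?normc_ge0 //.
have -> : 2 ^+ size zs * (\prod_(z <- zs) Num.max (normc z) r) ^+ M =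
    \prod_(z <- zs) (2 * Num.max (normc z) r ^+ M).
  by rewrite big_split /= big_const_seq count_predT iter_mulr_1 prodrXl.
apply: ler_prod => z _; rewrite prodr_ge0 => [|w _]; last exact: normc_ge0.
by rewrite ev /a max_pow_sub_le // normc_real ger0_norm.
Qed.

End weighted_norms.

(** * Interpolation of small data, limits of inequalities, and matching of roots *)

Section interpolation.
Variable R : realType.
Implicit Types (p q h : {poly R[i]}) (z w : R[i]) (r s : R).

(** Newton interpolation: a new node is corrected by a multiple of the product vanishing at the
    earlier ones. The point is that [L] depends on the nodes and on [r] alone, so data tending to 0
    give polynomials tending to 0. *)
Lemma interpolation_bound r (zs : seq R[i]) : uniq zs ->
  (forall z, z \in zs -> normc z <= r) ->
  exists2 L : R, 0 <= L & forall (v : R[i] -> R[i]) (d : R),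
    (forall z, z \in zs -> normc (v z) <= d) -> 0 <= d ->
    exists2 q : {poly R[i]}, (forall z, z \in zs -> q.[z] = v z) &
      l1norm r q <= d * L.
Proof.
elim: zs => [|z zs IH] /=.
  move=> _ _; exists 0 => // v d _ d0; exists 0 => //.
  by rewrite /l1norm size_poly0 big_ord0 mulr0.
move=> /andP[zzs uzs] hr.
have [L L0 HL] := IH uzs (fun x xzs => hr x (mem_behead (s := z :: zs) xzs)).
have zr : normc z <= r by apply: hr; rewrite mem_head.
have r0 : 0 <= r := le_trans (normc_ge0 z) zr.
pose w := \prod_(x <- zs) ('X - x%:P).
have wz : w.[z] != 0.
  by rewrite -[_ == 0]/(root w z) root_prod_XsubC.
exists (L + (1 + L) * (l1norm r w / normc w.[z])).
  rewrite addr_ge0 // mulr_ge0 ?addr_ge0 // divr_ge0 ?normc_ge0 //.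
  exact: l1norm_ge0.
move=> v d vd d0.
have [q qv ql] := HL v d (fun x xzs => vd x (mem_behead (s := z :: zs) xzs)) d0.
exists (q + ((v z - q.[z]) / w.[z]) *: w).
  move=> x; rewrite inE => /orP[/eqP ->|xzs].
    by rewrite !hornerE mulfVK // addrC subrK.
  have /rootP wx : root w x by rewrite root_prod_XsubC.
  by rewrite !hornerE wx mulr0 addr0 qv.
apply: (le_trans (le_l1normD _ _ r0)).
rewrite mulrDr lerD // l1normZ normcM normcV -mulrA [_^-1 * _]mulrC mulrA.
rewrite ler_wpM2r //.
  by rewrite divr_ge0 ?l1norm_ge0 ?normc_ge0.
rewrite (le_trans (le_normcB _ _)) // mulrDr mulr1 lerD //.
  by apply: vd; rewrite mem_head.
exact: le_trans (normc_horner_le q zr) ql.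
Qed.

Lemma l2sum_le_sqr_l1norm r p : 0 <= r -> l2sum r p <= l1norm r p ^+ 2.
Proof.
move=> r0; rewrite /l2sum /l1norm.
have a0 i : 0 <= normc p`_i * r ^+ i by rewrite mulr_ge0 ?normc_ge0 ?exprn_ge0.
elim: (size p) => [|n IH]; first by rewrite !big_ord0 expr0n.
rewrite !big_ord_recr /= sqrrD -addrA lerD //.
have -> : normc p`_n ^+ 2 * r ^+ 2 ^+ n = (normc p`_n * r ^+ n) ^+ 2.
  by rewrite [RHS]exprMn -exprM mulnC exprM.
rewrite lerDr.
by rewrite mulrn_wge0 // mulr_ge0 // sumr_ge0.
Qed.

(** Young's inequality 2ab <= t a^2 + b^2 / t, coefficient by coefficient. The factor of [p] tends
    to 1 with [t], while a [q] of norm at most [t] contributes only O(t). *)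
Lemma le_l2sumD r p q t : 0 < t ->
  l2sum r (p + q) <= (1 + t) * l2sum r p + (1 + t^-1) * l2sum r q.
Proof.
move=> t0; pose n := maxn (size p) (size q).
rewrite (l2sum_wide _ (size_polyD p q)) (l2sum_wide r (leq_maxl _ _ : (size p <= n)%N)).
rewrite (l2sum_wide r (leq_maxr _ _ : (size q <= n)%N)) !mulr_sumr -big_split /=.
apply: ler_sum => i _; rewrite 2![_ * (_ * (_ ^+ i))]mulrA -mulrDl.
apply: ler_wpM2r; first by rewrite exprn_ge0 // sqr_ge0.
rewrite coefD; have := le_normcD p`_i q`_i.
move: (normc_ge0 p`_i) (normc_ge0 q`_i) (normc_ge0 (p`_i + q`_i)).
move: (normc p`_i) (normc q`_i) (normc (p`_i + q`_i)) => a b e a0 b0 e0 eab.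
have e2 : e ^+ 2 <= (a + b) ^+ 2 by rewrite lerXn2r ?nnegrE ?addr_ge0.
apply: (le_trans e2).
have : 0 <= (t * a - b) ^+ 2 / t by rewrite divr_ge0 ?sqr_ge0 // ltW.
have -> : (t * a - b) ^+ 2 / t = t * a ^+ 2 - 2 * a * b + b ^+ 2 / t.
  by field; rewrite gt_eqF.
nra.
Qed.

End interpolation.

Section limit_inequality.
Variable R : realType.

Lemma le_of_small_error (x y K : R) :
  (forall t, 0 < t -> t < 1 -> x <= y + t * K) -> x <= y.
Proof.
move=> H; apply/ler_addgt0Pr => e e0.
have K1 : 0 < `|K| + 1 by rewrite ltr_wpDl.
pose t := Num.min (1 / 2) (e / (`|K| + 1)).
have t0 : 0 < t by rewrite lt_min !divr_gt0.
apply: (le_trans (H t t0 _)); first by rewrite gt_min ltr_pdivrMr // mul1r ltr1n.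
rewrite lerD2l (le_trans (_ : _ <= t * (`|K| + 1))) //.
  by rewrite ler_wpM2l ?ltW // (le_lt_trans (ler_norm K)) // ltrDl.
by rewrite -ler_pdivlMr // ge_min lexx orbT.
Qed.

Lemma bernoulli_ineq (x : R) n : 0 <= 1 + x -> 1 + x *+ n <= (1 + x) ^+ n.
Proof.
move=> x1; elim: n => [|n IH]; first by rewrite mulr0n addr0 expr0.
rewrite exprS; apply: le_trans (ler_wpM2l x1 IH).
rewrite mulrDl mul1r mulrDr mulr1 mulrS -!addrA lerD2l addrCA lerD2l lerDl.
by rewrite mulrnAr mulrn_wge0 // -expr2 sqr_ge0.
Qed.

(* [2 ^ m] is negligible against a power with exponent [(m + 1) ^ 2]. *)
Lemma le_of_pow_square (x y : R) : 0 <= y ->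
  (forall m0, exists2 m, (m0 <= m)%N & x ^+ (m.+1 ^ 2) <= 2 ^+ m * y ^+ (m.+1 ^ 2)) ->
  x <= y.
Proof.
move=> y0 H; rewrite leNgt; apply/negP => yx.
have x0 : 0 < x by exact: le_lt_trans yx.
have [y00|yn0] := eqVneq y 0.
  have [m _] := H 0%N; rewrite y00 expr0n /= mulr0 leNgt.
  by rewrite exprn_gt0.
have yp : 0 < y by rewrite lt_neqAle eq_sym yn0.
have q1 : 1 < x / y by rewrite ltr_pdivlMr // mul1r.
(* By Bernoulli's inequality (x / y)^(m+1) >= 2 once m >= m0; raising this to the power m + 1 beats
   2^m. *)
have [m0 Hm0] : exists m0, 2 <= 1 + (x / y - 1) *+ m0.
  have := archi_boundP (ltW (divr_gt0 ltr01 (_ : 0 < x / y - 1))).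
  rewrite subr_gt0 => /(_ q1) h; exists (Num.bound (1 / (x / y - 1))).
  move: h; rewrite ltr_pdivrMr ?subr_gt0 // mulr_natl => h; lra.
have [m m0m] := H m0; apply/negP; rewrite -ltNge.
rewrite -ltr_pdivlMr ?exprn_gt0 // -exprVn -exprMn.
have ge2 : 2 <= (x / y) ^+ m.+1.
  have -> : x / y = 1 + (x / y - 1) by ring.
  have : 0 <= x / y - 1 by rewrite subr_ge0 ltW.
  move: (x / y - 1) Hm0 => e Hm0 e0; apply: (le_trans Hm0).
  apply: le_trans (_ : 1 + e *+ m.+1 <= _).
    by rewrite lerD2l; apply: ler_wpMn2l => //; exact: ltnW.
  by apply: bernoulli_ineq; rewrite addr_ge0.
rewrite -mulnn exprM (@lt_le_trans _ _ (2 ^+ m.+1)) //.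
  by rewrite exprS ltr_pMl ?exprn_gt0 // ltr1n.
by rewrite lerXn2r ?nnegrE // ?(le_trans _ ge2).
Qed.

End limit_inequality.

Section matching.

(** Induction on [zs]: removing [y] removes with it at most one element of [rs], whose [g] is at
    most [G y]; 1 <= G y covers the case of none. When [zs] is exhausted, no remaining [g] exceeds
    1. *)
Lemma prod_le_matching (R : realType) (T : eqType) (g G : T -> R)
    (close : T -> T -> bool) (rs zs : seq T) :
  (forall z, z \in rs -> 0 <= g z) ->
  (forall z, z \in rs -> 1 < g z -> has (fun y => close y z) zs) ->
  (forall y, y \in zs -> (count (close y) rs <= 1)%N) ->
  (forall y z, y \in zs -> z \in rs -> close y z -> g z <= G y) ->
  (forall y, y \in zs -> 1 <= G y) ->
  \prod_(z <- rs) g z <= \prod_(y <- zs) G y.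
Proof.
elim: zs rs => [|y zs IH] rs g0 g1 cnt gG G1.
  rewrite big_nil big_seq; apply: prodr_ile1 => z zrs; rewrite g0 //=.
  by rewrite leNgt; apply/negP => /(g1 z zrs).
rewrite big_cons (bigID (close y)) /=.
have yin : y \in y :: zs by rewrite mem_head.
apply: ler_pM.
- by rewrite big_seq_cond prodr_ge0 // => z /andP[/g0].
- by rewrite big_seq_cond prodr_ge0 // => z /andP[/g0].
- rewrite -big_filter; move: (cnt y yin); rewrite -size_filter.
  have : {subset seq.filter (close y) rs <= rs} by move=> z; rewrite mem_filter => /andP[].
  have : all (close y) (seq.filter (close y) rs) by exact: filter_all.
  case: (seq.filter _ _) => [|z [|//]] /=; first by rewrite big_nil G1.
  rewrite andbT big_seq1 => cz sub _; apply: gG => //; apply: sub.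
  by rewrite mem_head.
- rewrite -big_filter; apply: IH.
  + by move=> z; rewrite mem_filter => /andP[_ /g0].
  + by move=> z; rewrite mem_filter => /andP[nz zrs] /(g1 z zrs) /=; rewrite (negbTE nz).
  + move=> x xzs; rewrite (leq_trans _ (cnt x _)) ?inE ?xzs ?orbT //.
    by rewrite count_filter; apply: sub_count => z /= /andP[].
  + move=> x z xzs; rewrite mem_filter => /andP[_ zrs].
    by apply: gG => //; rewrite inE xzs orbT.
  + by move=> x xzs; apply: G1; rewrite inE xzs orbT.
Qed.

End matching.

(** * Jensen bounds for power series *)

Section power_series.
Variable R : realType.
Variables (c : nat -> R[i]) (f : R[i] -> R[i]).
Implicit Types (z w : R[i]) (r s : R).

Definition partial_sum m : {poly R[i]} := \poly_(i < m) c i.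

Definition coef_bounded :=
  forall s, 0 <= s -> exists B, forall m, l1norm s (partial_sum m) <= B.

Definition locally_uniform_limit := forall r e, 0 <= r -> 0 < e ->
  exists m0, forall m, (m0 <= m)%N -> forall z, normc z <= r ->
  normc ((partial_sum m).[z] - f z) <= e.

Hypothesis c_bounded : coef_bounded.
Hypothesis f_limit : locally_uniform_limit.

Lemma coef0_partial_sum m : (0 < m)%N -> (partial_sum m)`_0 = c 0%N.
Proof. by move=> m0; rewrite coef_poly m0. Qed.

Lemma uniq_roots_prod_dvd (p : {poly R[i]}) (zs : seq R[i]) : uniq zs ->
  (forall z, z \in zs -> p.[z] = 0) ->
  exists h, p = (\prod_(z <- zs) ('X - z%:P)) * h.
Proof.
move=> uzs pzs.
have : all (root p) zs by apply/allP => z /pzs/rootP.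
move=> /uniq_roots_prod_XsubC.
rewrite uniq_rootsE => /(_ uzs)[h ->]; exists h; exact: mulrC.
Qed.

(** A late partial sum is nearly zero on [zs]. Subtracting a small interpolation polynomial [q]
    makes it vanish there exactly, so that [jensen_upper] applies to the difference; letting the
    error [t] tend to 0 removes [q] again. *)
Lemma zeros_upper_bound (zs : seq R[i]) r S : uniq zs -> 0 < r ->
  (forall z, z \in zs -> f z = 0) ->
  (forall z, z \in zs -> normc z <= r) ->
  (forall m, l2sum r (partial_sum m) <= S) ->
  normc (c 0%N) ^+ 2 * (r ^+ 2) ^+ size zs <= (\prod_(z <- zs) normc z ^+ 2) * S.
Proof.
move=> uzs r0 fzs rzs HS.
have [L L0 HL] := interpolation_bound uzs rzs.
set A := (r ^+ 2) ^+ size zs; set Q := \prod_(z <- zs) _.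
have A0 : 0 <= A by rewrite exprn_ge0 // sqr_ge0.
have Q0 : 0 <= Q by apply: prodr_ge0 => z _; exact: sqr_ge0.
have S0 : 0 <= S := le_trans (l2sum_ge0 r _) (HS 0%N).
pose a := normc (c 0%N).
(* The error constant: the squared constant coefficient drops by at most 2at, and the sum of squares
   grows to at most (1 + t) S + (1 + 1/t) t^2, which is below S + t (S + 2) for t < 1. *)
apply: (@le_of_small_error _ _ _ (2 * a * A + Q * (S + 2))) => t t0 t1.
have d0 : 0 < t / (L + 1) by rewrite divr_gt0 // ltr_wpDl.
have [m0 Hm0] := f_limit (ltW r0) d0.
pose m := maxn m0 1; pose p := partial_sum m.
have pzs z : z \in zs -> normc p.[z] <= t / (L + 1).
  move=> zzs; have := Hm0 m (leq_maxl _ _) z (rzs z zzs).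
  by rewrite fzs // subr0.
have [q qp ql] := HL (horner p) _ pzs (ltW d0).
have qt : l1norm r q <= t.
  apply: (le_trans ql); rewrite mulrAC ler_pdivrMr ?ltr_wpDl //.
  by rewrite ler_wpM2l ?(ltW t0) // lerDl.
have [h pqE] : exists h, p - q = (\prod_(z <- zs) ('X - z%:P)) * h.
  by apply: uniq_roots_prod_dvd => // z zzs; rewrite !hornerE qp // subrr.
have := jensen_upper r zs h; rewrite -pqE -/A -/Q.
rewrite coefB coef0_partial_sum ?leq_maxr //.
have qc : normc q`_0 <= t.
  apply: le_trans qt; have := @normc_horner_le _ r q 0.
  by rewrite horner_coef0 normc0 => /(_ (ltW r0)).
have le1 : a ^+ 2 - 2 * a * t <= normc (c 0%N - q`_0) ^+ 2.
  have := lerB_normc (c 0%N) q`_0; rewrite -/a.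
  move: (normc_ge0 q`_0) (normc_ge0 (c 0%N - q`_0)) qc (normc_ge0 (c 0%N)).
  rewrite -/a; move: (normc q`_0) (normc (c 0%N - q`_0)) a => x y b.
  move=> x0 y0 xt b0 bxy; have [bx|xb] := leP b x.
    by have : 0 <= y ^+ 2; [exact: sqr_ge0|nra].
  have : (b - x) ^+ 2 <= y ^+ 2 by rewrite lerXn2r ?nnegrE ?subr_ge0 // ltW.
  nra.
have le2 : l2sum r (p - q) <= S + t * (S + 2).
  apply: (le_trans (le_l2sumD _ _ _ t0)).
  have -> : l2sum r (- q) = l2sum r q.
    by rewrite /l2sum size_polyN; apply: eq_bigr => i _; rewrite coefN normcN.
  have q2 : l2sum r q <= t ^+ 2.
    apply: (le_trans (l2sum_le_sqr_l1norm q (ltW r0))).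
    by rewrite lerXn2r ?nnegrE ?l1norm_ge0 // ltW.
  have : (1 + t^-1) * l2sum r q <= (1 + t^-1) * t ^+ 2.
    by rewrite ler_wpM2l // addr_ge0 // invr_ge0 ltW.
  have -> : (1 + t^-1) * t ^+ 2 = t ^+ 2 + t by field; rewrite gt_eqF.
  have : (1 + t) * l2sum r p <= (1 + t) * S.
    by rewrite ler_wpM2l ?HS // addr_ge0 // ltW.
  nra.
move=> le3.
have : (a ^+ 2 - 2 * a * t) * A <= Q * (S + t * (S + 2)).
  apply: (le_trans (ler_wpM2r A0 le1)); apply: (le_trans le3).
  exact: ler_wpM2l.
rewrite -/a; lra.
Qed.

Lemma normc_horner_two_limit r z B : 0 <= r ->
  (forall m, l1norm (r + 1) (partial_sum m) <= B) ->
  forall m w, normc z <= r -> normc w <= r ->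
  normc ((partial_sum m).[z] - (partial_sum m).[w]) <= 2 * B * normc (z - w).
Proof.
move=> r0 HB m w zr wr; apply: (le_trans (horner_lipschitz _ r0 zr wr)).
by rewrite ler_wpM2r ?normc_ge0 // ler_pM2l // HB.
Qed.

(** A multiple zero expressed as a quadratic bound with explicit domain and constant. This form is
    what a limit of polynomials with two merging roots satisfies, and integer values of [r] and [B]
    leave countably many events to exclude. *)
Definition nonsimple_zero r B z :=
  forall w, normc w <= r -> normc (f w) <= B * normc (w - z) ^+ 2.

Lemma near_complex (x : R * R) e : 0 < e ->
  \forall y \near x, normc (Complex y.1 y.2 - Complex x.1 x.2) < e.
Proof.
move=> e0; apply/nbhs_ballP; exists (e / 2) => /=; first exact: divr_gt0.
move=> [y1 y2] [] /=; rewrite /ball /= => h1 h2.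
rewrite (le_lt_trans (le_normc_abs _ _)) // [ltRHS]splitr.
by rewrite distrC [ `|y2 - _| ]distrC ltrD.
Qed.

(** One half of Hurwitz's theorem. Near a point where [f] is nonzero the late partial sums stay away
    from 0, being uniformly Lipschitz and convergent there; near a zero, that zero serves.
    Compactness of a square around the disc makes the index uniform. *)
Lemma partial_sum_roots_near_zeros r (zs : seq R[i]) d : 0 <= r -> 0 < d ->
  (forall z, normc z <= r -> f z = 0 -> z \in zs) ->
  exists m0, forall m, (m0 <= m)%N -> forall z, normc z <= r ->
    (partial_sum m).[z] = 0 -> exists2 w, w \in zs & normc (z - w) <= d.
Proof.
move=> r0 d0 fzs.
have r1 : 0 <= r + 1 by rewrite addr_ge0.
have [B HB] := c_bounded (addr_ge0 r1 ler01).
have B0 : 0 <= B by apply: le_trans (HB 0%N); rewrite l1norm_ge0 // addr_ge0.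
pose K := `[-r, r]%classic `*` `[-r, r]%classic : set (R * R).
have cK : compact K by apply: compact_setX; exact: segment_compact.
pose P m (x : R * R) := normc (Complex x.1 x.2) <= r ->
  (partial_sum m).[Complex x.1 x.2] = 0 ->
  exists2 w, w \in zs & normc (Complex x.1 x.2 - w) <= d.
have /compact_near_coveringP/(_ nat \oo P) := cK.
have loc (x : R * R) : K x -> \forall x' \near x & m \near \oo, P m x'.
  move=> _; pose z := Complex x.1 x.2.
  have [rz|zr] := ltP r (normc z).
    near=> x' m => xr; exfalso; move: xr; apply/negP; rewrite -ltNge.
    have : normc (Complex x'.1 x'.2 - z) < normc z - r.
      by near: x'; apply: near_complex; rewrite subr_gt0.
    have := lerB_normc z (Complex x'.1 x'.2); rewrite normcBC; lra.
  have [fz0|fz0] := eqVneq (f z) 0.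
    near=> x' m => _ _; exists z; first exact: fzs.
    by rewrite /=; apply: ltW; near: x'; exact: near_complex.
  have fz1 : 0 < normc (f z) by rewrite normc_gt0.
  have fz2 : 0 < normc (f z) / 2 by rewrite divr_gt0.
  have [m0 Hm0] := f_limit r1 fz2.
  near=> x' m => x'r px'; exfalso.
  have m0m : (m0 <= m)%N by near: m; exact: nbhs_infty_ge.
  have zr1 : normc z <= r + 1 by rewrite (le_trans zr) // lerDl.
  have x'r1 : normc (Complex x'.1 x'.2) <= r + 1 by rewrite (le_trans x'r) // lerDl.
  have h1 := Hm0 m m0m z zr1.
  have := normc_horner_two_limit r1 HB m zr1 x'r1.
  rewrite px' subr0 => h2.
  have h3 : normc (Complex x'.1 x'.2 - z) < normc (f z) / (4 * (B + 1)).
    by near: x'; apply: near_complex; rewrite divr_gt0 // mulr_gt0 // ltr_wpDl.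
  have h4 := lerB_normc (f z) (partial_sum m).[z].
  rewrite normcBC in h4; rewrite normcBC in h3.
  move: h3; rewrite ltr_pdivlMr; last by rewrite mulr_gt0 // ltr_wpDl.
  move: h1 h2 h4 (normc_ge0 (z - Complex x'.1 x'.2)).
  move: (normc (z - _)) (normc (_ - f z)) (normc _.[z]) => N X Y; lra.
move=> /(_ _ loc) [m0 _ H]; exists m0 => m m0m [a b] zr pz.
apply: (H m m0m (a, b)) => //; split; rewrite /= in_itv /= -ler_norml.
  by rewrite (le_trans _ zr) // abs_le_normc.
by rewrite (le_trans _ zr) // abs_le_normc2.
Unshelve. all: by end_near. Qed.

(** If two roots of late partial sums could come arbitrarily close to [z], then [horner_two_roots]
    would give the quadratic bound for [f] in the limit. The conclusion is stated through a
    factorisation, so that a double root v = w is covered too. *)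
Lemma simple_zero_separation r B z : 0 <= r -> normc z <= r ->
  (forall m, l1norm (r + 1) (partial_sum m) <= B) ->
  ~ nonsimple_zero (r + 1) B z ->
  exists2 d, 0 < d & exists m0, forall m, (m0 <= m)%N -> forall v w q,
    normc v <= r -> normc w <= r -> normc (v - z) <= d -> normc (w - z) <= d ->
    partial_sum m <> ('X - v%:P) * (('X - w%:P) * q).
Proof.
move=> r0 zr HB /existsNP[u /not_implyP[ur /negP]]; rewrite -ltNge => fu.
have B0 : 0 <= B by apply: le_trans (HB 0%N); rewrite l1norm_ge0 // addr_ge0.
have r1 : 0 <= r + 1 by rewrite addr_ge0.
pose x := normc (u - z); pose e := normc (f u) - B * x ^+ 2.
have x0 : 0 <= x := normc_ge0 _.
have e0 : 0 < e by rewrite subr_gt0.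
(* Moving the roots by d <= 1 raises B x^2 to at most B (x + d)^2, that is by less than d k <= e /
   2. The partial sum differs from [f] at [u] by at most e / 2, so the gap [e] is not bridged. *)
pose k := B * (2 * x + 1) + 1.
have k0 : 0 < k.
  by rewrite ltr_wpDl // mulr_ge0 // addr_ge0 // mulr_ge0.
pose d := Num.min 1 (e / (2 * k)).
have k2 : 0 < 2 * k by rewrite mulr_gt0.
have d0 : 0 < d by rewrite lt_min ltr01 divr_gt0.
exists d => //.
have [m0 Hm0] := f_limit r1 (divr_gt0 e0 (ltr0Sn R 1)).
exists m0 => m m0m v w q vr wr vd wd pE.
have h1 := Hm0 m m0m u ur; rewrite normcBC in h1.
have h2 := horner_two_roots r0 vr wr ur pE.
have h3 := lerB_normc (f u) (partial_sum m).[u].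
have uv : normc (u - v) <= x + d.
  have -> : u - v = (u - z) - (v - z) by ring.
  by rewrite (le_trans (le_normcB _ _)) // lerD2l.
have uw : normc (u - w) <= x + d.
  have -> : u - w = (u - z) - (w - z) by ring.
  by rewrite (le_trans (le_normcB _ _)) // lerD2l.
have : normc (partial_sum m).[u] <= B * (x + d) ^+ 2.
  apply: (le_trans h2); rewrite -mulrA expr2.
  apply: ler_pM; rewrite ?l1norm_ge0 ?mulr_ge0 ?normc_ge0 //.
  by apply: ler_pM; rewrite ?normc_ge0.
have dk : d * (2 * k) <= e.
  by rewrite -ler_pdivlMr // ge_min lexx orbT.
have d1 : d <= 1 by rewrite ge_min lexx.
have Bd : B * d ^+ 2 <= B * d.
  by rewrite ler_wpM2l // expr2 ler_piMl // ltW.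
move: dk h1 h3; rewrite /k /e.
move: (normc (f u)) (normc (f u - _)) (normc _.[u]) => F N Y.
have -> : (x + d) ^+ 2 = x ^+ 2 + 2 * x * d + d ^+ 2 by ring.
nra.
Qed.

Lemma simple_zeros_separation r B (zs : seq R[i]) : 0 <= r ->
  (forall m, l1norm (r + 1) (partial_sum m) <= B) ->
  (forall z, z \in zs -> normc z <= r /\ ~ nonsimple_zero (r + 1) B z) ->
  exists2 d, 0 < d & exists m0, forall m, (m0 <= m)%N ->
    forall z, z \in zs -> forall v w q,
    normc v <= r -> normc w <= r -> normc (v - z) <= d -> normc (w - z) <= d ->
    partial_sum m <> ('X - v%:P) * (('X - w%:P) * q).
Proof.
move=> r0 HB; elim: zs => [|z zs IH] H; first by exists 1 => //; exists 0%N.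
have [|d d0 [m0 Hd]] := IH; first by move=> y yzs; apply: H; rewrite inE yzs orbT.
have [zr zs'] := H z (mem_head _ _).
have [d' d'0 [m0' Hd']] := simple_zero_separation r0 zr HB zs'.
exists (Num.min d d'); first by rewrite lt_min d0 d'0.
exists (maxn m0 m0') => m; rewrite geq_max => /andP[le1 le2] y.
rewrite inE => /orP[/eqP ->|yzs] v w q vr wr; rewrite !le_min.
  by move=> /andP[_ vd] /andP[_ wd]; apply: (Hd' m le2).
by move=> /andP[vd _] /andP[wd _]; apply: (Hd m le1 y yzs).
Qed.

Lemma limit_at0 : f 0 = c 0%N.
Proof.
apply/eqP; rewrite -subr_eq0 -normc_eq0 eq_le normc_ge0 andbT.
apply/ler_addgt0Pr => e e0; rewrite add0r.
have [m0 /(_ (maxn m0 1) (leq_maxl _ _) 0)] := f_limit (lexx 0) e0.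
by rewrite normc0 lexx horner_coef0 coef0_partial_sum ?leq_maxr // normcBC => ->.
Qed.

(** The product over the nodes is bounded by [jensen_lower]. Since |c_0| is |a| times the product of
    the moduli of the roots, only the factors max(|z|, r) / |z| remain. They are 1 outside the disc;
    inside, they are compared with r / |y| for the zero [y] of [f] close to [z]. *)
Lemma zeros_lower_bound (nodes : nat -> seq R[i]) r B (zs : seq R[i]) tau :
  0 < r -> uniq zs -> c 0%N != 0 -> 0 <= tau ->
  (forall m, l1norm (r + 1) (partial_sum m) <= B) ->
  (forall z, normc z <= r -> f z = 0 -> z \in zs) ->
  (forall z, z \in zs ->
     [/\ normc z <= r, f z = 0 & ~ nonsimple_zero (r + 1) B z]) ->
  (forall m a (rs : seq R[i]),
    \prod_(w <- nodes m) normc (a *: \prod_(z <- rs) ('X - z%:P)).[w] <=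
    2 ^+ size rs * (normc a * \prod_(z <- rs) Num.max (normc z) r) ^+ (m.+1 ^ 2)) ->
  (forall m0, exists2 m, (m0 <= m)%N &
    tau ^+ (m.+1 ^ 2) <= \prod_(w <- nodes m) normc (partial_sum m).[w]) ->
  tau * \prod_(z <- zs) normc z <= normc (c 0%N) * r ^+ size zs.
Proof.
move=> r0 uzs c0 tau0 HB fzs Hzs Hnodes freq.
have rge0 := ltW r0.
have z_neq0 z : z \in zs -> 0 < normc z.
  move=> /Hzs[_ fz _]; rewrite normc_gt0; apply/eqP => z0.
  by move: fz; rewrite z0 limit_at0 => /eqP; rewrite (negbTE c0).
have [mu mu0 Hmu] : exists2 mu, 0 < mu & forall z, z \in zs -> mu <= normc z.
  elim: (zs) z_neq0 => [|z s IH] H; first by exists 1.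
  have [y ys|mu mu0 Hmu] := IH; first by apply: H; rewrite inE ys orbT.
  exists (Num.min mu (normc z)); first by rewrite lt_min mu0 H ?mem_head.
  move=> y; rewrite inE => /orP[/eqP ->|ys]; first by rewrite ge_min lexx orbT.
  by rewrite ge_min Hmu.
have [|d d0 [m1 Hsep]] := @simple_zeros_separation r B zs rge0 HB.
  by move=> z /Hzs[].
set P := \prod_(z <- zs) normc z.
have P0 : 0 <= P by apply: prodr_ge0 => z _; exact: normc_ge0.
apply: (@le_of_small_error _ _ _ (tau * P * (size zs)%:R)) => t t0 tlt1.
(* The distance [d] keeps two roots from sharing a zero, and t mu turns closeness into the relative
   bound (1 - t) |y| <= |z|. *)
pose e := Num.min d (t * mu).
have e0 : 0 < e by rewrite lt_min d0 mulr_gt0.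
have [m2 Hnear] := partial_sum_roots_near_zeros rge0 e0 fzs.
pose G y := r / ((1 - t) * normc y).
suff le1 : tau <= normc (c 0%N) * \prod_(y <- zs) G y.
  have GE : (\prod_(y <- zs) G y) * (P * (1 - t) ^+ size zs) = r ^+ size zs.
    rewrite /P mulrC -mulrA mulrC -mulrA.
    elim: (zs) z_neq0 => [|z s IH] H; first by rewrite !big_nil !expr0 !mulr1.
    rewrite !big_cons /= !exprS -IH; last by move=> y ys; rewrite H // inE ys orbT.
    have z0 : normc z != 0 by rewrite gt_eqF // H // mem_head.
    by rewrite /G; field; rewrite z0 subr_eq0 gt_eqF.
  have bern : 1 - t * (size zs)%:R <= (1 - t) ^+ size zs.
    by rewrite mulr_natr -mulNrn bernoulli_ineq // subr_ge0 ltW.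
  have := ler_wpM2r (mulr_ge0 P0 (exprn_ge0 (size zs) (_ : 0 <= 1 - t))) le1.
  rewrite -!mulrA GE subr_ge0 => /(_ (ltW tlt1)).
  have : tau * P * (1 - t * (size zs)%:R) <= tau * P * (1 - t) ^+ size zs.
    by rewrite ler_wpM2l ?mulr_ge0.
  lra.
apply: le_of_pow_square.
  rewrite mulr_ge0 ?normc_ge0 // big_seq prodr_ge0 // => y /z_neq0 y0.
  by rewrite divr_ge0 // mulr_ge0 ?subr_ge0 // ltW.
move=> m0; have [m] := freq (maxn m0 (maxn 1 (maxn m1 m2))).
rewrite !geq_max => /and4P[m0m m_gt0 m1m m2m] taum; exists m => //.
apply: (le_trans taum).
have [rs rsE] := closed_field_poly_normal (partial_sum m).
set a := lead_coef _ in rsE.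
have pc0 : (partial_sum m)`_0 = c 0%N by rewrite coef0_partial_sum.
have a0 : a != 0.
  rewrite lead_coef_eq0; apply/eqP => p0.
  by move: pc0; rewrite p0 coef0 => /esym/eqP; rewrite (negbTE c0).
have szrs : (size rs <= m)%N.
  have := size_poly m c; rewrite -/(partial_sum m) rsE size_scale //.
  by rewrite size_prod_XsubC; exact: ltnW.
have root_rs z : z \in rs -> (partial_sum m).[z] = 0.
  by move=> zrs; apply/rootP; rewrite rsE rootZ // root_prod_XsubC.
have rs_neq0 z : z \in rs -> 0 < normc z.
  move=> /root_rs pz; rewrite normc_gt0; apply/eqP => z0.
  by move: pz; rewrite z0 horner_coef0 pc0 => /eqP; rewrite (negbTE c0).
have c0E : normc (c 0%N) = normc a * \prod_(z <- rs) normc z.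
  rewrite -pc0 -horner_coef0 rsE hornerZ normcM horner_prod normc_prod.
  by congr (_ * _); apply: eq_bigr => z _; rewrite !hornerE normcN.
rewrite {1}rsE; apply: (le_trans (Hnodes m a rs)).
apply: ler_pM.
- by rewrite exprn_ge0.
- rewrite exprn_ge0 // mulr_ge0 ?normc_ge0 // prodr_ge0 // => z _.
  by rewrite le_max normc_ge0.
- by rewrite ler_weXn2l // ler1n.
rewrite lerXn2r ?nnegrE //.
- rewrite mulr_ge0 ?normc_ge0 // prodr_ge0 // => z _.
  by rewrite le_max normc_ge0.
- rewrite mulr_ge0 ?normc_ge0 // big_seq prodr_ge0 // => y /z_neq0 y0.
  by rewrite divr_ge0 // mulr_ge0 ?subr_ge0 // ltW.
pose g z := Num.max (normc z) r / normc z.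
have -> : \prod_(z <- rs) Num.max (normc z) r =
    (\prod_(z <- rs) normc z) * \prod_(z <- rs) g z.
  rewrite -big_split big_seq [RHS]big_seq; apply: eq_bigr => z /rs_neq0 z0.
  by rewrite /= /g mulrC divfK // gt_eqF.
rewrite mulrA -c0E ler_wpM2l ?normc_ge0 //.
have gin z : z \in rs -> 1 < g z -> normc z <= r.
  move=> /rs_neq0 z0; rewrite /g ltr_pdivlMr // mul1r lt_max ltxx /=.
  exact: ltW.
have closeE y z : y \in zs -> z \in rs -> normc (z - y) <= e ->
    (1 - t) * normc y <= normc z.
  move=> yzs zrs; rewrite le_min => /andP[_ zy].
  have := lerB_normc y z; rewrite normcBC; have := Hmu y yzs; nra.
apply: (@prod_le_matching R _ g G (fun y z => (normc z <= r) && (normc (z - y) <= e))).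
- by move=> z /rs_neq0 z0; rewrite divr_ge0 ?le_max ?(ltW z0).
- move=> z zrs /(gin z zrs) zr; have [w wzs wz] := Hnear m m2m z zr (root_rs z zrs).
  by apply/hasP; exists w => //; rewrite zr wz.
- move=> y yzs; rewrite leqNgt; apply/negP; rewrite -size_filter => cnt.
  pose cl z := (normc z <= r) && (normc (z - y) <= e).
  have : all cl (seq.filter cl rs) by exact: filter_all.
  have : perm_eq rs (seq.filter cl rs ++ seq.filter (predC cl) rs).
    by rewrite perm_sym perm_filterC.
  move: cnt; rewrite -/cl; case: (seq.filter cl rs) => [|v [|w s]] // _ prs.
  move=> /and3P[/andP[vr vy] /andP[wr wy] _].
  apply: (Hsep m m1m y yzs v w
    (a *: \prod_(z <- s ++ seq.filter (predC cl) rs) ('X - z%:P))) => //.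
  + by rewrite (le_trans vy) // ge_min lexx.
  + by rewrite (le_trans wy) // ge_min lexx.
  rewrite {1}rsE (perm_big _ prs) /= !big_cons -!scalerAr; congr (_ *: _).
- move=> y z yzs zrs /andP[zr zy].
  rewrite /g /G (max_idPr zr) ler_pM2l // lef_pV2 ?posrE ?rs_neq0 //.
    exact: closeE.
  by rewrite mulr_gt0 ?subr_gt0 // z_neq0.
- move=> y yzs; have [yr _ _] := Hzs y yzs.
  rewrite ler_pdivlMr ?mulr_gt0 ?subr_gt0 ?z_neq0 // mul1r.
  by rewrite (le_trans _ yr) // ler_piMl ?normc_ge0 // gerBl ltW.
Qed.

End power_series.

(** * Gaussian coefficients *)

Section planar_sets.
Variable R : realType.
Implicit Types (z : plane R) (e t : R).

Definition complex_gaussian_pdf (z : plane R) : R :=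
  pi^-1 * expR (- ((z.1 : R) ^+ 2 + (z.2 : R) ^+ 2)).

Lemma complex_gaussian_pdf_ge0 z : 0 <= complex_gaussian_pdf z.
Proof. by rewrite mulr_ge0 ?invr_ge0 ?pi_ge0 ?expR_ge0. Qed.

Lemma measurable_complex_gaussian_pdf :
  measurable_fun setT (complex_gaussian_pdf : plane R -> R).
Proof.
apply: measurable_funM => //; apply: measurableT_comp => //.
apply: measurableT_comp => //.
by apply: measurable_funD; apply: measurable_funX.
Qed.

Definition square (z : R * R) (e : R) : set (plane R) :=
  `[z.1 - e, z.1 + e]%classic `*` `[z.2 - e, z.2 + e]%classic.

Lemma measurable_square z e : measurable (square z e).
Proof. by apply: measurableX; exact: measurable_itv. Qed.

Lemma lebesgue2_square z e : 0 <= e ->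
  (lebesgue2 (square z e) = ((2 * e) ^+ 2)%:E)%E.
Proof.
move=> e0; have itvE (a : R) :
    lebesgue_measure (`[a - e, a + e]%classic : set R) = (2 * e)%:E.
  rewrite lebesgue_measure_itv /= lte_fin; case: ltP => [_|h].
    by rewrite -EFinB; congr _%:E; ring.
  by have -> : e = 0 by [lra]; rewrite mulr0.
case: z => a b; transitivity (lebesgue_measure (`[(a - e)%R, (a + e)%R]%classic : set R) *
  lebesgue_measure (`[(b - e)%R, (b + e)%R]%classic : set R))%E.
  by rewrite -product_measure1E.
by rewrite !itvE -EFinM expr2.
Qed.

Lemma sqr_normal_pdf01 (x y : R) :
  normal_pdf 0 1 x * normal_pdf 0 1 y =
  (2 * pi)^-1 * expR (- (x ^+ 2 / 2)) * expR (- (y ^+ 2 / 2)).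
Proof.
have pdfE (u : R) : normal_pdf 0 1 u = normal_peak 1 * normal_fun 0 1 u.
  by rewrite normal_pdfE ?oner_neq0.
rewrite !pdfE /normal_fun /normal_peak.
rewrite !subr0 expr1n mul1r -!mulNr.
rewrite [in LHS]mulrACA -invfM -expr2 sqr_sqrtr; last first.
  by rewrite pmulrn_lge0 // pi_ge0.
by rewrite -mulr_natl mulrA.
Qed.

Lemma mul_expR_sqr_le1 (t x : R) : 0 <= t -> t < `|x| ->
  t * expR (- (x ^+ 2 / 2)) <= 1.
Proof.
move=> t0 tx; rewrite expRN ler_pdivrMr ?expR_gt0 // mul1r.
apply: le_trans (expR_ge1Dx _).
rewrite -(real_normK (num_real x)).
have : 0 <= (`|x| - 1) ^+ 2 := sqr_ge0 _.
rewrite sqrrB1 mulr2n; lra.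
Qed.

(** Here [E] and [F] stand for exp(-x^2/2) and exp(-y^2/2): the complex Gaussian density is 2EF
    times that of two independent standard normals, and one of the two factors is at most 1/t. *)
Lemma gaussian_density_product_bound (p t E F : R) : 0 < p -> 0 < t ->
  0 < E <= 1 -> 0 < F <= 1 -> t * E <= 1 \/ t * F <= 1 ->
  p^-1 * (E ^+ 2 * F ^+ 2) <= 2 / t * ((2 * p)^-1 * E * F).
Proof.
move=> p0 t0 /andP[E0 E1] /andP[F0 F1] h.
have -> : 2 / t * ((2 * p)^-1 * E * F) = p^-1 * (t^-1 * (E * F)).
  by field; rewrite (gt_eqF t0) (gt_eqF p0).
rewrite ler_wpM2l ?invr_ge0 ?(ltW p0) // ler_pdivlMl //.
have EF : 0 < E * F by rewrite mulr_gt0.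
rewrite -exprMn (_ : t * _ = (t * (E * F)) * (E * F)); last by ring.
rewrite ler_piMl ?(ltW EF) //; case: h => h; nra.
Qed.

Lemma integral_normal_pdf_prod :
  (\int[@lebesgue2 R]_z (normal_pdf 0 1 z.1 * normal_pdf 0 1 z.2)%:E = 1)%E.
Proof.
have mf : measurable_fun setT (fun z : plane R =>
    (normal_pdf 0 1 (z.1 : R) * normal_pdf 0 1 (z.2 : R))%:E).
  apply/measurable_EFinP; apply: measurable_funM;
    by apply: measurableT_comp => //; exact: measurable_normal_pdf.
rewrite /lebesgue2 fubini_tonelli1 //; last first.
  by move=> z; rewrite lee_fin mulr_ge0 ?normal_pdf_ge0.
rewrite /fubini_F /= -[RHS](integral_normal_pdf 0 1).
apply: eq_integral => x _.
under eq_integral do rewrite EFinM.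
rewrite ge0_integralZl ?integral_normal_pdf ?mule1 ?lee_fin ?normal_pdf_ge0 //.
- by apply/measurable_EFinP; exact: measurable_normal_pdf.
- by move=> y _; rewrite lee_fin normal_pdf_ge0.
Qed.

Definition outside (t : R) : set (plane R) :=
  [set z | ((t < `|z.1 : R|) || (t < `|z.2 : R|))%R].

Lemma measurable_outside t : measurable (outside t).
Proof.
pose B := [set x : R | (t < `|x|)%R].
have mB : measurable (B : set (measurableTypeR R)).
  rewrite -[B]setTI; apply: (measurable_fun_ltr (D := setT) (f := cst t)) => //.
have -> : outside t = (fst @^-1` B) `|` (snd @^-1` B).
  by apply/seteqP; split => z /=; rewrite /outside /B /=; move=> /orP.
by apply: measurableU; rewrite -[X in measurable X]setTI;
  [apply: measurable_fst|apply: measurable_snd].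
Qed.

End planar_sets.

Section gaussian_bounds.
Context (R : realType) (d : measure_display) (T : measurableType d)
  (P : probability T R).
Implicit Type X : {RV P >-> plane R}.

Lemma gaussian_density_bound X A : std_complex_gaussian P X -> measurable A ->
  (P (X @^-1` A) <= (pi^-1)%:E * lebesgue2 A)%E.
Proof.
move=> GX mA; rewrite GX //.
rewrite -/(complex_gaussian_pdf _) /lebesgue2.
rewrite -integral_cst //.
apply: ge0_le_integral => //.
- by move=> z _; rewrite lee_fin complex_gaussian_pdf_ge0.
- apply: measurable_funTS; apply/measurable_EFinP.
  exact: measurable_complex_gaussian_pdf.
- move=> z _; rewrite lee_fin ler_piMr ?invr_ge0 ?pi_ge0 //.
  by rewrite expR_le1 oppr_le0 addr_ge0 // sqr_ge0.
Qed.

Lemma gaussian_square_bound X z e : std_complex_gaussian P X -> 0 <= e ->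
  (P (X @^-1` (square z e)) <= (4 * e ^+ 2)%:E)%E.
Proof.
move=> GX e0; apply: (le_trans (gaussian_density_bound GX (measurable_square z e))).
rewrite lebesgue2_square // -EFinM lee_fin.
have -> : (2 * e) ^+ 2 = 4 * e ^+ 2 by ring.
rewrite ler_piMl ?mulr_ge0 ?sqr_ge0 // invf_le1 ?pi_gt0 //.
by rewrite (le_trans _ (pi_ge2 R)) // ler1n.
Qed.

(** Comparison with the product of two standard normal densities, of total mass 1. The rate 1/t is
    enough for Borel-Cantelli along t = (n + 1)^2. *)
Lemma gaussian_tail_bound X t : std_complex_gaussian P X -> 0 < t ->
  (P (X @^-1` outside t) <= (2 / t)%:E)%E.
Proof.
move=> GX t0; have mA := measurable_outside t.
have mf : measurable_fun setT (fun z : plane R =>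
    (normal_pdf 0 1 (z.1 : R) * normal_pdf 0 1 (z.2 : R))%:E).
  apply/measurable_EFinP; apply: measurable_funM;
    by apply: measurableT_comp => //; exact: measurable_normal_pdf.
rewrite GX // -/(complex_gaussian_pdf _).
rewrite -[leRHS]mule1 -integral_normal_pdf_prod -ge0_integralZl //=; last 2 first.
- by move=> z _; rewrite lee_fin mulr_ge0 ?normal_pdf_ge0.
- by rewrite lee_fin divr_ge0 // ltW.
pose h (z : plane R) :=
  ((2 / t)%:E * (normal_pdf 0 1 (z.1 : R) * normal_pdf 0 1 (z.2 : R))%:E)%E.
have h0 z : (0 <= h z)%E.
  by rewrite /h -EFinM lee_fin mulr_ge0 ?mulr_ge0 ?normal_pdf_ge0 // invr_ge0 ltW.
have mh : measurable_fun setT h by apply: measurable_funeM.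
apply: (@le_trans _ _ (\int[@lebesgue2 R]_(z in outside t) h z)%E); last first.
  exact: ge0_subset_integral.
apply: ge0_le_integral => //.
- by move=> z _; rewrite lee_fin complex_gaussian_pdf_ge0.
- apply: measurable_funTS; apply/measurable_EFinP.
  exact: measurable_complex_gaussian_pdf.
- exact: measurable_funTS.
move=> [x y] /= out.
rewrite /h -EFinM lee_fin sqr_normal_pdf01 /complex_gaussian_pdf /=.
have -> : expR (- (x ^+ 2 + y ^+ 2)) =
    expR (- (x ^+ 2 / 2)) ^+ 2 * expR (- (y ^+ 2 / 2)) ^+ 2.
  by rewrite -!expRM_natl -expRD; congr (expR _); lra.
have e1 : 0 < expR (- (x ^+ 2 / 2)) <= 1 by rewrite expR_gt0 expR_le1; nra.
have e2 : 0 < expR (- (y ^+ 2 / 2)) <= 1 by rewrite expR_gt0 expR_le1; nra.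
apply: gaussian_density_product_bound => //; first exact: pi_gt0.
by case/orP: out => /(mul_expR_sqr_le1 (ltW t0)) ?; [left|right].
Qed.

End gaussian_bounds.

Section measurable_lincomb.
Variable R : realType.

Lemma Re_sum (I : Type) (s : seq I) (p : pred I) (F : I -> R[i]) :
  complex.Re (\sum_(i <- s | p i) F i) = \sum_(i <- s | p i) complex.Re (F i).
Proof.
by elim/big_rec2 : _ => // i y x _ <-; case: (F i) => a b; case: x.
Qed.

Lemma Im_sum (I : Type) (s : seq I) (p : pred I) (F : I -> R[i]) :
  complex.Im (\sum_(i <- s | p i) F i) = \sum_(i <- s | p i) complex.Im (F i).
Proof.
by elim/big_rec2 : _ => // i y x _ <-; case: (F i) => a b; case: x.
Qed.

Context (d : measure_display) (T : measurableType d).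

Lemma measurable_Re_mul (c : R[i]) (X : T -> plane R) : measurable_fun setT X ->
  measurable_fun setT (fun w => complex.Re (c * toC (X w)) : R).
Proof.
case: c => a b mX; have /measurable_fun_pairP[m1 m2] := mX.
apply: (measurable_funB (f := fun w => a * (X w).1) (g := fun w => b * (X w).2));
  exact: measurable_funM.
Qed.

Lemma measurable_Im_mul (c : R[i]) (X : T -> plane R) : measurable_fun setT X ->
  measurable_fun setT (fun w => complex.Im (c * toC (X w)) : R).
Proof.
case: c => a b mX; have /measurable_fun_pairP[m1 m2] := mX.
apply: (measurable_funD (f := fun w => a * (X w).2) (g := fun w => b * (X w).1));
  exact: measurable_funM.
Qed.

Lemma measurable_normc (F : T -> R[i]) :
  measurable_fun setT (fun w => complex.Re (F w) : R) ->
  measurable_fun setT (fun w => complex.Im (F w) : R) ->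
  measurable_fun setT (fun w => normc (F w)).
Proof.
move=> mRe mIm; have -> : (fun w => normc (F w)) = (fun w =>
    Num.sqrt (complex.Re (F w) ^+ 2 + complex.Im (F w) ^+ 2)).
  by apply/funext => w; case: (F w).
apply: measurableT_comp; first by apply: continuous_measurable_fun; exact: sqrt_continuous.
by apply: measurable_funD; apply: measurable_funX.
Qed.

Lemma measurable_le_cst (f : T -> R) (e : R) : measurable_fun setT f ->
  measurable [set w | (f w <= e)%R].
Proof.
move=> mf; rewrite -[X in measurable X]setTI.
by apply: (measurable_fun_ler (f := f) (g := cst e)).
Qed.

Variables (c : nat -> R[i]) (X : nat -> T -> plane R) (p : pred nat) (m : nat).

Definition lincomb (w : T) : R[i] := \sum_(k < m | p k) c k * toC (X k w).

Hypothesis mX : forall k, p k -> measurable_fun setT (X k).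

Lemma measurable_Re_lincomb :
  measurable_fun setT (fun w => complex.Re (lincomb w) : R).
Proof.
rewrite /lincomb; under eq_fun do rewrite Re_sum big_mkcond.
apply: measurable_sum => i.
move: (@mX i); case: (p i) => mXi; last exact: measurable_cst.
by apply: measurable_Re_mul; exact: mXi.
Qed.

Lemma measurable_Im_lincomb :
  measurable_fun setT (fun w => complex.Im (lincomb w) : R).
Proof.
rewrite /lincomb; under eq_fun do rewrite Im_sum big_mkcond.
apply: measurable_sum => i.
move: (@mX i); case: (p i) => mXi; last exact: measurable_cst.
by apply: measurable_Im_mul; exact: mXi.
Qed.

Lemma measurable_lincomb :
  measurable_fun setT (fun w => (complex.Re (lincomb w), complex.Im (lincomb w)) : plane R).
Proof.
by apply: measurable_fun_pair; [exact: measurable_Re_lincomb|exact: measurable_Im_lincomb].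
Qed.

Lemma measurable_normc_lincomb : measurable_fun setT (fun w => normc (lincomb w)).
Proof.
by apply: measurable_normc; [exact: measurable_Re_lincomb|exact: measurable_Im_lincomb].
Qed.

End measurable_lincomb.

(** * Independence of one coefficient from the others, and anticoncentration *)

Section independence.
Context (R : realType) (d d' : measure_display) (T : measurableType d)
  (V : measurableType d') (P : probability T R).
Variable X : nat -> {RV P >-> V}.
Hypothesis indX : independent_family P X.

Definition cylinders_without (n : nat) : set_system T :=
  [set B | exists (J : {fset nat}) (A : nat -> set V),
    [/\ n \notin J, forall i, measurable (A i) &
        B = \bigcap_(i in [set` J]) (X i @^-1` A i)]].

Lemma cylinders_without_measurable n : cylinders_without n `<=` measurable.
Proof.
move=> _ [J [A [_ mA ->]]]; apply: fin_bigcap_measurable => // i _.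
by rewrite -[X in measurable X]setTI; apply: measurable_funPT.
Qed.

Lemma setI_closed_cylinders_without n : setI_closed (cylinders_without n).
Proof.
move=> _ _ [J [A [nJ mA ->]]] [K [B [nK mB ->]]].
exists (J `|` K)%fset, (fun i => (if i \in J then A i else setT) `&`
  (if i \in K then B i else setT)); split.
- by rewrite inE negb_or nJ.
- by move=> i; apply: measurableI; case: ifP.
apply/seteqP; split => w /=.
  move=> [HJ HK] i _; split.
    by case: ifP => // iJ; apply: HJ.
  by case: ifP => // iK; apply: HK.
move=> H; split => i /= iJ; have := H i; rewrite /= inE iJ ?orbT => /(_ isT) [] //.
Qed.

Lemma cylinders_without_setT n : cylinders_without n setT.
Proof.
exists fset0, (fun=> setT); split => //.
by apply/seteqP; split.
Qed.

(** As functions of [B] the two sides are finite measures. They agree on the pi-system of cylinders,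
    by independence for the index set enlarged by [n], hence on the generated sigma-algebra. *)
Lemma independent_of_sigma_without n (A : set V) (B : set T) : measurable A ->
  <<s cylinders_without n >> B ->
  P (X n @^-1` A `&` B) = (P (X n @^-1` A) * P B)%E.
Proof.
move=> mA.
have mXA : measurable (X n @^-1` A).
  by rewrite -[X in measurable X]setTI; apply: measurable_funPT.
have PXfin : P (X n @^-1` A) \is a fin_num by exact: fin_num_measure.
pose r : {nonneg R} := NngNum (fine_ge0 (measure_ge0 P (X n @^-1` A))).
have rE : (r%:num)%:E = P (X n @^-1` A) by rewrite /= fineK.
pose m1 := mrestr P mXA; pose m2 := mscale r P.
move=> sB; suff H : m1 B = m2 B.
  by rewrite setIC -rE; exact: H.
move: B sB; apply: (g_sigma_algebra_measure_unique (cylinders_without n) _ (fun=> setT)).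
- exact: cylinders_without_measurable.
- by move=> _; exact: cylinders_without_setT.
- by apply/seteqP; split => // x _; exists 0%N.
- exact: setI_closed_cylinders_without.
- move=> _ [J [C [nJ mC ->]]].
  set B := \bigcap_(i in _) _.
  change (P (B `&` X n @^-1` A) = (r%:num)%:E * P B)%E; rewrite rE /B {B}.
  pose C' i := if i == n then A else C i.
  have mC' i : measurable (C' i) by rewrite /C'; case: ifP.
  have CE i : i \in J -> C' i = C i.
    by rewrite /C'; case: eqP => // -> nJ'; rewrite nJ' in nJ.
  have := indX (n |` J)%fset mC'.
  rewrite big_fsetU1 //= {2}/C' eqxx.
  have -> : \bigcap_(i in [set` (n |` J)%fset]) (X i @^-1` C' i) =
      (\bigcap_(i in [set` J]) (X i @^-1` C i)) `&` X n @^-1` A.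
    apply/seteqP; split => w /=.
      move=> H; split.
        by move=> i /= iJ; have := H i; rewrite /= !inE iJ orbT CE //; exact.
      by have := H n; rewrite /= !inE eqxx /C' eqxx; exact.
    move=> [H1 H2] i /=; rewrite !inE => /orP[/eqP ->|iJ].
      by rewrite /C' eqxx.
    by rewrite CE //; apply: H1.
  move=> ->; congr (_ * _)%E; rewrite indX //.
  by apply: eq_fbigr => i iJ _; rewrite CE.
- move=> _; change (P (setT `&` X n @^-1` A) < +oo)%E.
  by rewrite setTI ltey_eq PXfin.
Qed.

End independence.

Section anticoncentration.
Context (R : realType) (d : measure_display) (T : measurableType d)
  (P : probability T R).
Variable a : nat -> {RV P >-> plane R}.
Hypothesis inda : independent_family P a.
Hypothesis gaussa : forall n, std_complex_gaussian P (a n).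

(** Given the other variables, the event forces [a n] into a square of half-side [e], of probability
    at most its area (2e)^2. The conditioning takes the form of Fubini for the product law of the
    shift and [a n]. *)
Lemma anticoncentration_shift n (b : nat -> R[i]) m (e : R) : 0 <= e ->
  (P [set w | (normc (toC (a n w) + lincomb b a (fun k => k != n) m w) <= e)%R] <=
   (4 * e ^+ 2)%:E)%E.
Proof.
move=> e0; pose L := lincomb b a (fun k => k != n) m.
pose V w : plane R := (- complex.Re (L w), - complex.Im (L w)).
(* Measurability with respect to the sigma-algebra of the other variables is what makes the shift
   independent of [a n]. *)
have mLs : measurable_fun (setT : set (g_sigma_algebraType (cylinders_without a n)))
    (V : g_sigma_algebraType (cylinders_without a n) -> plane R).
  have mXs k : k != n -> measurable_fun
      (setT : set (g_sigma_algebraType (cylinders_without a n)))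
      (a k : g_sigma_algebraType (cylinders_without a n) -> plane R).
    move=> kn _ B mB; rewrite setTI; apply: sub_sigma_algebra.
    exists [fset k]%fset, (fun=> B); split => //.
      by rewrite inE eq_sym.
    apply/seteqP; split => w /= H.
      by move=> i /=; rewrite inE => /eqP ->.
    by apply: (H k); rewrite /= inE.
  apply: measurable_fun_pair; apply: measurable_funN.
    exact: measurable_Re_lincomb.
  exact: measurable_Im_lincomb.
have mV : measurable_fun setT V.
  apply: measurable_fun_pair; apply: measurable_funN.
    exact: measurable_Re_lincomb.
  exact: measurable_Im_lincomb.
pose Vm : {mfun T >-> plane R} := HB.pack V (isMeasurableFun.Build _ _ _ _ V mV).
pose nu := distribution P Vm; pose mu := distribution P (a n).
have mpair : measurable_fun setT (fun w => (Vm w, a n w)).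
  by apply: measurable_fun_pair.
pose pm := pushforward P (fun w => (Vm w, a n w)).
pose S : set (plane R * plane R) := [set vx | square vx.1 e vx.2].
have mS : measurable S.
  have -> : S = [set vx : plane R * plane R | (`|(vx.2.1 : R) - vx.1.1| <= e)%R] `&`
      [set vx | (`|(vx.2.2 : R) - vx.1.2| <= e)%R].
    apply/seteqP; split => -[v x] /=; rewrite /S /square /= !in_itv /=.
      by rewrite !ler_distl => -[-> ->].
    by rewrite !ler_distl => -[-> ->].
  apply: measurableI; apply: measurable_le_cst;
    (apply: measurableT_comp; first exact: normr_measurable); apply: measurable_funB;
    by do ?[apply: measurableT_comp => //].
have mE : measurable [set w | normc (toC (a n w) + L w) <= e].
  apply: measurable_le_cst; apply: measurable_normc.
    rewrite (_ : (fun _ => _) = fun w => (a n w).1 + complex.Re (L w)); last first.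
      by apply/funext => w; case: (L w).
    by apply: measurable_funD; [exact: measurableT_comp|exact: measurable_Re_lincomb].
  rewrite (_ : (fun _ => _) = fun w => (a n w).2 + complex.Im (L w)); last first.
    by apply/funext => w; case: (L w).
  by apply: measurable_funD; [exact: measurableT_comp|exact: measurable_Im_lincomb].
have pmE A : measurable A -> (nu \x mu)%E A = pm A.
  apply: product_measure_unique => B C mB mC.
  have sVB : <<s cylinders_without a n >> (V @^-1` B).
    by rewrite -[X in <<s _ >> X]setTI; exact: mLs.
  have indB := independent_of_sigma_without inda mC sVB.
  change (P (V @^-1` B `&` a n @^-1` C) = P (V @^-1` B) * P (a n @^-1` C))%E.
  by rewrite setIC indB muleC.
apply: (@le_trans _ _ (pm S)).
  apply: le_measure; rewrite ?inE //.
    by rewrite -[X in measurable X]setTI; exact: mpair.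
  move=> w h; have {}h : normc (toC (a n w) + L w) <= e := h.
  rewrite /= /S /square /V /= !in_itv /= -!ler_distl.
  move: h; case: (L w) => x y; case: (a n w) => u v /= h.
  by rewrite !opprK; split; apply: le_trans h; [exact: abs_le_normc|exact: abs_le_normc2].
rewrite -pmE // /product_measure1.
apply: (@le_trans _ _ (\int[nu]_v (cst (4 * e ^+ 2)%:E v))%E); last first.
  have -> : (\int[nu]_v cst (4 * e ^+ 2)%:E v)%E = ((4 * e ^+ 2)%:E * 1)%E.
    rewrite integral_cst //; congr (_ * _)%E.
    exact: (@probability_setT _ _ _ (distribution P Vm)).
  by rewrite mule1.
apply: ge0_le_integral => //.
  exact: measurable_fun_xsection.
move=> v _; rewrite /=.
have -> : xsection S v = square v e.
  by apply/seteqP; split => x; rewrite /xsection /S /= inE.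
exact: gaussian_square_bound.
Qed.

Lemma anticoncentration n (c : nat -> R[i]) m (e : R) : 0 <= e -> (n < m)%N ->
  c n != 0 ->
  (P [set w | (normc (lincomb c a xpredT m w) <= e * normc (c n))%R] <=
   (4 * e ^+ 2)%:E)%E.
Proof.
move=> e0 nm cn0.
apply: le_trans (anticoncentration_shift n (fun k => c k / c n) m e0).
rewrite le_eqVlt; apply/orP; left; apply/eqP; congr (P _).
have LE w : lincomb c a xpredT m w =
   c n * (toC (a n w) + lincomb (fun k => c k / c n) a (fun k => k != n) m w).
  rewrite /lincomb mulrDr (bigD1 (Ordinal nm)) //= mulr_sumr; congr (_ + _).
  by apply: eq_bigr => i _; rewrite mulrA mulrCA divff ?mulr1.
apply/seteqP; split => w /=; rewrite LE normcM mulrC ler_pM2r ?normc_gt0 //.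
Qed.

End anticoncentration.

(** * Exponential sums, factorials and geometric tails *)

Section real_estimates.
Variable R : realType.
Implicit Types x y : R.

Lemma exp_term_le (x : R) n : 0 <= x -> x ^+ n / n`!%:R <= expR x.
Proof.
move=> x0; case: n => [|n]; first by rewrite expr0 fact0 divr1 -[leLHS](@expR0 R) ler_expR.
by apply: le_trans (expR_ge1Dxn n x0); rewrite lerDr.
Qed.

Lemma exp_partial_sum_le (x : R) m : 0 <= x ->
  \sum_(n < m) x ^+ n / n`!%:R <= expR x.
Proof.
move=> x0; have := @nondecreasing_cvgn_le R (series (exp_coeff x)).
rewrite /series /= => /(_ _ (is_cvg_series_exp_coeff x) m).
by rewrite big_mkord; apply; apply: nondecreasing_series => n _ _; rewrite divr_ge0 // exprn_ge0.
Qed.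

(** Bernoulli's inequality gives n + 1 <= x (1 + 1/x)^n, so the polynomial factor is absorbed by
    passing from x to x (1 + 1/x)^4 <= x + 4 + 6 + 4 + 1. In logarithms the loss is 4 ln x + 15
    only. *)
Lemma poly_growth_exp_sum (x : R) m : 1 <= x ->
  \sum_(n < m) n.+1%:R ^+ 4 * x ^+ n / n`!%:R <= x ^+ 4 * expR (x + 15).
Proof.
move=> x1; have x0 : 0 < x by exact: lt_le_trans x1.
have y0 : 0 <= x + 15 by rewrite addr_ge0 // ltW.
apply: le_trans (_ : \sum_(n < m) x ^+ 4 * ((x + 15) ^+ n / n`!%:R) <= _); last first.
  by rewrite -mulr_sumr ler_wpM2l ?exprn_ge0 ?(ltW x0) ?exp_partial_sum_le.
apply: ler_sum => n _; rewrite mulrA ler_wpM2r ?invr_ge0 //.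
have h1 : n.+1%:R <= x * (1 + x^-1) ^+ n.
  have v0 : 0 <= x^-1 by rewrite invr_ge0 ltW.
  have h := @bernoulli_ineq R x^-1 n (addr_ge0 ler01 v0).
  rewrite mulrC -ler_pdivrMr //; apply: le_trans h.
  by rewrite -natr1 mulrDl mul1r addrC -[x^-1 *+ n]mulr_natl lerD2r invf_le1.
have h4 : n.+1%:R ^+ 4 <= (x * (1 + x^-1) ^+ n) ^+ 4.
  by rewrite lerXn2r ?nnegrE // mulr_ge0 ?exprn_ge0 ?addr_ge0 ?invr_ge0 // ltW.
apply: (le_trans (ler_wpM2r (exprn_ge0 n (ltW x0)) h4)).
rewrite exprMn -mulrA ler_wpM2l ?exprn_ge0 ?(ltW x0) //.
rewrite exprAC -exprMn lerXn2r ?nnegrE //.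
  by rewrite mulr_ge0 ?exprn_ge0 ?addr_ge0 ?invr_ge0 // ltW.
set v := x^-1; have v0 : 0 < v by rewrite invr_gt0.
have vx : v * x = 1 by rewrite mulVf // gt_eqF.
have v1 : v <= 1 by rewrite invf_le1.
have -> : (1 + v) ^+ 4 * x = x + 4 * (v * x) + 6 * v * (v * x) +
   4 * v ^+ 2 * (v * x) + v ^+ 3 * (v * x) by ring.
rewrite vx; have : v ^+ 2 <= 1 by rewrite expr_le1 // ltW.
have : v ^+ 3 <= 1 by rewrite expr_le1 // ltW.
lra.
Qed.

(** From n + 1 <= 2^n, the left side times 2^n is at most (8s)^n / sqrt(n!), whose square is a term
    of the series of exp(64 s^2). *)
Lemma super_geometric (s : R) n : 0 <= s ->
  n.+1%:R ^+ 2 * s ^+ n / Num.sqrt n`!%:R <= expR (64 * s ^+ 2) / 2 ^+ n.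
Proof.
move=> s0.
have f0 : 0 < Num.sqrt n`!%:R :> R by rewrite sqrtr_gt0 ltr0n fact_gt0.
have h2 : n.+1%:R <= 2 ^+ n :> R by rewrite -natrX ler_nat ltn_expl.
rewrite ler_pdivrMr // [leRHS]mulrAC ler_pdivlMr ?exprn_gt0 //.
have h4 : n.+1%:R ^+ 2 * s ^+ n * 2 ^+ n <= (8 * s) ^+ n.
  rewrite mulrAC exprMn ler_wpM2r ?exprn_ge0 //.
  have -> : (8 : R) = 2 * 2 * 2 by ring.
  by rewrite !exprMn ler_wpM2r ?exprn_ge0 // expr2 ler_pM.
apply: (le_trans h4).
rewrite -(ler_pXn2r (_ : (0 < 2)%N)) ?nnegrE ?exprn_ge0 ?mulr_ge0 ?expR_ge0 ?(ltW f0) //.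
rewrite [leRHS]exprMn sqr_sqrtr // -exprM mulnC exprM.
have -> : (8 * s) ^+ 2 = 64 * s ^+ 2 by ring.
have y0 : 0 <= 64 * s ^+ 2 by rewrite mulr_ge0 // sqr_ge0.
have := exp_term_le n y0; rewrite ler_pdivrMr ?ltr0n ?fact_gt0 // => /le_trans; apply.
rewrite ler_wpM2r // expr2 ler_peMl ?expR_ge0 //.
by rewrite -[leLHS](@expR0 R) ler_expR.
Qed.

(** The induction step is e n^(n+1) <= (n+1)^(n+1), from 1 - 1/(n+1) <= exp(-1/(n+1)). An upper
    bound on the factorial serves to bound the dominant monomial from below. *)
Lemma fact_stirling_le n : (0 < n)%N ->
  n`!%:R * expR n%:R <= expR 1 * n%:R * n%:R ^+ n :> R.
Proof.
elim: n => // -[|n] IH _.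
  by rewrite factS fact0 !expr1n !mul1r !mulr1.
have {}IH := IH isT; set N := n.+1 in IH *; set e := expR 1 in IH *.
have e0 : 0 < e :> R := expR_gt0 _.
have N0 : 0 < N%:R :> R by rewrite ltr0n.
have N1 : 0 < N.+1%:R :> R by rewrite ltr0n.
have key : e * N%:R ^+ N.+1 <= N.+1%:R ^+ N.+1.
  have h : N%:R / N.+1%:R <= expR (- (N.+1%:R^-1)) :> R.
    apply: le_trans (expR_ge1Dx _).
    by rewrite ler_pdivrMr // mulrBl mul1r mulVf ?gt_eqF // -natr1 addrK.
  have : (N%:R / N.+1%:R) ^+ N.+1 <= expR (- (N.+1%:R^-1)) ^+ N.+1 :> R.
    by rewrite lerXn2r ?nnegrE ?expR_ge0 // divr_ge0.
  rewrite -expRM_natl mulrN divff ?gt_eqF // expRN expr_div_n.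
  by rewrite ler_pdivrMr ?exprn_gt0 // mulrC ler_pdivlMr // mulrC.
rewrite factS natrM -natr1 addrC expRD -/e.
have -> : N.+1%:R * N`!%:R * (e * expR N%:R) = N.+1%:R * e * (N`!%:R * expR N%:R) :> R by ring.
apply: (le_trans (ler_wpM2l _ IH)); first by rewrite mulr_ge0 // ltW.
have -> : N.+1%:R * e * (e * N%:R * N%:R ^+ N) = e * N.+1%:R * (e * N%:R ^+ N.+1) :> R.
  by rewrite exprS; ring.
by rewrite addrC natr1 ler_wpM2l // mulr_ge0 // ltW.
Qed.

End real_estimates.

Section geometric_series_limits.
Variable R : realType.

Lemma geometric_series_limit (v : nat -> R) (D : R) :
  (forall n, `|v n| <= D / 2 ^+ n) ->
  exists2 l, series v @ \oo --> l &
    forall m, `|series v m - l| <= 2 * D / 2 ^+ m.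
Proof.
move=> vD; have D0 : 0 <= D.
  by have := le_trans (normr_ge0 _) (vD 0%N); rewrite expr0 divr1.
have cv : cvgn (series v).
  apply: normed_cvg; apply: (@series_le_cvg _ _ (geometric D 2^-1)).
  - by move=> n; exact: normr_ge0.
  - by move=> n; rewrite /geometric /= mulr_ge0 // exprn_ge0 // invr_ge0.
  - by move=> n; rewrite /geometric /= exprVn vD.
  - by apply: is_cvg_geometric_series; rewrite ger0_norm ?invr_ge0 // invf_lt1 // ltr1n.
exists (limn (series v)) => // m.
have tail k : `|series v m - series v (m + k)%N| <= 2 * D / 2 ^+ m - 2 * D / 2 ^+ (m + k).
  elim: k => [|k IH]; first by rewrite addn0 !subrr normr0.
  rewrite addnS /series /= big_nat_recr //= opprD addrA.
  apply: (le_trans (ler_normB _ _)).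
  have -> : 2 * D / 2 ^+ m - 2 * D / 2 ^+ (m + k).+1 =
     (2 * D / 2 ^+ m - 2 * D / 2 ^+ (m + k)) + D / 2 ^+ (m + k).
    by rewrite exprS; field; rewrite !expf_neq0.
  exact: lerD.
apply/ler_addgt0Pr => e e0.
have /cvgrPdist_le/(_ e e0)[N _ HN] := cv.
have := HN (m + N)%N (leq_addl _ _); rewrite distrC => h.
have -> : series v m - limn (series v) =
  (series v m - series v (m + N)%N) + (series v (m + N)%N - limn (series v)) by ring.
apply: (le_trans (ler_normD _ _)); rewrite lerD //.
by apply: (le_trans (tail N)); rewrite gerBl divr_ge0 // ?mulr_ge0 // exprn_ge0.
Qed.

Lemma complex_geometric_series_limit (u : nat -> R[i]) (D : R) :
  (forall n, normc (u n) <= D / 2 ^+ n) ->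
  forall m, normc (\sum_(n < m) u n - limn (series (u : nat -> (R[i] : numClosedFieldType)))) <=
    4 * D / 2 ^+ m.
Proof.
have hRe (z : R[i]) : `|complex.Re z| <= normc z by case: z => ? ?; exact: abs_le_normc.
have hIm (z : R[i]) : `|complex.Im z| <= normc z by case: z => ? ?; exact: abs_le_normc2.
move=> uD.
have [x cx Hx] := @geometric_series_limit (fun n => complex.Re (u n)) D
  (fun n => le_trans (hRe (u n)) (uD n)).
have [y cy Hy] := @geometric_series_limit (fun n => complex.Im (u n)) D
  (fun n => le_trans (hIm (u n)) (uD n)).
have dist m : normc (\sum_(n < m) u n - Complex x y) <= 4 * D / 2 ^+ m.
  have -> : \sum_(n < m) u n - Complex x y =
      Complex (series (fun n => complex.Re (u n)) m - x)
              (series (fun n => complex.Im (u n)) m - y).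
    rewrite /series /= !big_mkord -Re_sum -Im_sum.
    by case: (\sum_(n < m) u n).
  apply: (le_trans (le_normc_abs _ _)); apply: (le_trans (lerD (Hx m) (Hy m))).
  by rewrite -mulrDl -mulrDl -natrD.
suff -> : limn (series (u : nat -> (R[i] : numClosedFieldType))) = Complex x y by [].
apply/cvg_lim; first exact: norm_hausdorff.
apply/cvgrPdist_le => e e0.
have [e' e'E] : exists e', e = real_complex R e'.
  by exists (complex.Re e); rewrite RRe_real // gtr0_real.
have e'0 : 0 < e' by move: e0; rewrite e'E ltcR.
have := @cvg_geometric R (4 * D) 2^-1.
rewrite ger0_norm ?invr_ge0 // invf_lt1 // ltr1n => /(_ isT).
move=> /cvgrPdist_le/(_ e' e'0) [N _ HN].
exists N => // m /= /HN; rewrite sub0r normrN /geometric /= exprVn => h.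
rewrite distrC normr_complexE e'E lecR.
rewrite /series /= big_mkord; apply: (le_trans (dist m)).
exact: le_trans (ler_norm _) h.
Qed.

End geometric_series_limits.

(** * The Gaussian series and its almost sure properties *)

Section gaf_series.
Variable R : realType.
Variables (a : nat -> plane R) (K : R).
Hypothesis aK : forall n, normc (toC (a n)) <= K * n.+1%:R ^+ 2.

Definition gaf_coef n : R[i] := toC (a n) / real_complex R (Num.sqrt n`!%:R).

Let K_ge0 : 0 <= K.
Proof. by have := le_trans (normc_ge0 _) (aK 0); rewrite expr1n mulr1. Qed.

Lemma normc_gaf_coef n : normc (gaf_coef n) = normc (toC (a n)) / Num.sqrt n`!%:R.
Proof. by rewrite normcM normcV normc_real ger0_norm // ltW. Qed.

Lemma gaf_coef_geometric s n : 0 <= s ->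
  normc (gaf_coef n) * s ^+ n <= K * expR (64 * s ^+ 2) / 2 ^+ n.
Proof.
move=> s0; rewrite normc_gaf_coef -mulrA.
apply: (le_trans (ler_wpM2r _ (aK n))).
  by rewrite mulr_ge0 ?exprn_ge0 // invr_ge0 ltW.
rewrite -3!mulrA ler_wpM2l //; apply: le_trans (super_geometric n s0).
by rewrite le_eqVlt; apply/orP; left; apply/eqP; ring.
Qed.

Lemma gaf_coef_bounded : coef_bounded gaf_coef.
Proof.
move=> s s0; exists (K * expR (64 * s ^+ 2) * 2) => m.
rewrite (l1norm_wide _ (size_poly m gaf_coef)).
apply: (@le_trans _ _ (\sum_(i < m) K * expR (64 * s ^+ 2) / 2 ^+ i)).
  by apply: ler_sum => i _; rewrite coef_poly ltn_ord gaf_coef_geometric.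
rewrite -mulr_sumr ler_wpM2l ?mulr_ge0 ?expR_ge0 //.
suff : \sum_(i < m) (2 ^+ i)^-1 <= 2 - 2 / 2 ^+ m :> R.
  by move=> /le_trans; apply; rewrite gerBl divr_ge0 // exprn_ge0.
elim: m => [|m IH]; first by rewrite big_ord0 expr0 divr1 subrr.
rewrite big_ord_recr /=; apply: (le_trans (lerD IH (lexx _))).
rewrite le_eqVlt; apply/orP; left; apply/eqP.
by rewrite exprS; field; rewrite expf_neq0.
Qed.

Lemma gaf_locally_uniform_limit : locally_uniform_limit gaf_coef (gaf a).
Proof.
move=> r e r0 e0.
pose D := K * expR (64 * r ^+ 2).
have := @cvg_geometric R (4 * D) 2^-1.
rewrite ger0_norm ?invr_ge0 // invf_lt1 // ltr1n => /(_ isT).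
move=> /cvgrPdist_le/(_ e e0) [N _ HN].
exists N => m /HN; rewrite sub0r normrN /geometric /= exprVn => h z zr.
have uD n : normc (gaf_coef n * z ^+ n) <= D / 2 ^+ n.
  rewrite normcM normcX; apply: le_trans (gaf_coef_geometric n r0).
  by rewrite ler_wpM2l ?normc_ge0 // lerXn2r // ?nnegrE ?normc_ge0.
have := complex_geometric_series_limit uD m.
rewrite horner_poly => /le_trans; apply; exact: le_trans (ler_norm _) h.
Qed.

(** Half the logarithm of the bound is r^2 / 2 + 4 ln r + O(1), the source of the main term and of
    the error term in the upper Jensen bound. *)
Lemma gaf_l2sum_bound r m : 1 <= r ->
  l2sum r (partial_sum gaf_coef m) <=
  K ^+ 2 * ((r ^+ 2) ^+ 4 * expR (r ^+ 2 + 15)).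
Proof.
move=> r1; rewrite (l2sum_wide _ (size_poly m gaf_coef)).
have x1 : 1 <= r ^+ 2 by rewrite expr_ge1 // (le_trans _ r1).
apply: le_trans (ler_wpM2l (sqr_ge0 K) (poly_growth_exp_sum m x1)).
rewrite mulr_sumr; apply: ler_sum => i _; rewrite coef_poly ltn_ord.
have fE : Num.sqrt i`!%:R ^+ 2 = i`!%:R :> R by rewrite sqr_sqrtr.
rewrite normc_gaf_coef expr_div_n fE.
set N := normc _; set x := (r ^+ 2) ^+ i; set v := (i`!%:R)^-1.
have -> : N ^+ 2 * v * x = N ^+ 2 * (x * v) by ring.
have -> : K ^+ 2 * (i.+1%:R ^+ 4 * x * v) = (K * i.+1%:R ^+ 2) ^+ 2 * (x * v) by ring.
rewrite ler_wpM2r ?mulr_ge0 ?invr_ge0 ?exprn_ge0 ?(le_trans ler01 r1) ?(le_trans ler01 x1) //.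
have N0 : 0 <= N := normc_ge0 _.
have KN : 0 <= K * i.+1%:R ^+ 2 := le_trans N0 (aK i).
by rewrite lerXn2r ?nnegrE ?aK.
Qed.

Lemma gaf_partial_sum_lincomb m z :
  (partial_sum gaf_coef m).[z] =
    \sum_(k < m) (z ^+ k / real_complex R (Num.sqrt k`!%:R)) * toC (a k).
Proof.
by rewrite horner_poly; apply: eq_bigr => k _; rewrite /gaf_coef mulrC mulrA mulrAC.
Qed.

End gaf_series.

Section probability_estimates.
Context (R : realType) (d : measure_display) (T : measurableType d)
  (P : probability T R).

Lemma measure_exists_le (I : eqType) (s : seq I) (A : I -> set T) (b : R) :
  (forall i, measurable (A i)) -> (forall i, i \in s -> (P (A i) <= b%:E)%E) ->
  measurable [set w | exists2 i, i \in s & A i w] /\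
  (P [set w | exists2 i, i \in s & A i w] <= (b *+ size s)%:E)%E.
Proof.
move=> mA; elim: s => [|i s IH] bA.
  have -> : [set w | exists2 i, i \in [::] & A i w] = set0.
    by apply/seteqP; split => // w [].
  by rewrite measure0 mulr0n.
have [m1 le1] : measurable [set w | exists2 i, i \in s & A i w] /\
    (P [set w | exists2 i, i \in s & A i w] <= (b *+ size s)%:E)%E.
  by apply: IH => j js; apply: bA; rewrite inE js orbT.
have -> : [set w | exists2 j, j \in i :: s & A j w] =
    A i `|` [set w | exists2 i, i \in s & A i w].
  apply/seteqP; split => w /=.
    by move=> [j]; rewrite inE => /orP[/eqP ->|js] Aj; [left|right; exists j].
  by move=> [Ai|[j js Aj]]; [exists i; rewrite ?mem_head|exists j; rewrite ?inE ?js ?orbT].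
split; first exact: measurableU.
rewrite (le_trans (measureU2 _ _ _)) //= mulrS EFinD leeD //.
by apply: bA; rewrite mem_head.
Qed.

Definition liminf_sets (F : nat -> set T) := \bigcup_n \bigcap_(m >= n) F m.

Lemma measurable_liminf_sets F : (forall m, measurable (F m)) ->
  measurable (liminf_sets F).
Proof.
move=> mF; apply: bigcup_measurable => n _.
by apply: bigcap_measurable => [|m _]; [exists n => /=|exact: mF].
Qed.

Lemma measure_liminf_sets_le F (b : \bar R) n0 : (forall m, measurable (F m)) ->
  (forall m, (n0 <= m)%N -> (P (F m) <= b)%E) -> (P (liminf_sets F) <= b)%E.
Proof.
move=> mF Fb; pose G n := \bigcap_(m >= n) F m.
have mG n : measurable (G n) by apply: bigcap_measurable => [|m _]; [exists n => /=|exact: mF].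
have ndG : nondecreasing_seq G.
  move=> m n mn; apply/subsetPset => w Gw p np; apply: Gw => /=.
  exact: leq_trans mn np.
have cG : (P \o G) x @[x --> \oo] --> P (liminf_sets F).
  exact: (nondecreasing_cvg_mu mG (measurable_liminf_sets mF) ndG).
rewrite -(cvg_lim _ cG) //; apply: lime_le.
  by apply/cvg_ex; exists (P (liminf_sets F)).
apply: nearW => n; apply: (@le_trans _ _ (P (F (maxn n n0)))).
  apply: le_measure; rewrite ?inE //; apply: bigcap_inf; exact: leq_maxl.
by apply: Fb; exact: leq_maxr.
Qed.

Lemma markov_count (I : Type) (s : seq I) (A : I -> set T) (E : set T) (K : nat) :
  measurable E -> (forall i, measurable (A i)) ->
  (forall w, E w -> (K <= count (fun i => w \in A i) s)%N) ->
  (K%:R%:E * P E <= \sum_(i <- s) P (A i))%E.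
Proof.
move=> mE mA EK.
have -> : (\sum_(i <- s) P (A i) = \int[P]_w (\sum_(i <- s) (\1_(A i) w)%:E))%E.
  rewrite ge0_integral_sum //.
    by apply: eq_bigr => i _; rewrite integral_indic // setIT.
  by move=> i; apply/measurable_EFinP.
have -> : (K%:R%:E * P E = \int[P]_w (K%:R%:E * (\1_E w)%:E))%E.
  rewrite ge0_integralZl //; first by rewrite integral_indic // setIT.
  exact/measurable_EFinP.
apply: ge0_le_integral => //.
- by apply: measurable_funeM; apply/measurable_EFinP.
- by apply: emeasurable_sum => i; apply/measurable_EFinP.
move=> w _; rewrite sumEFin -EFinM lee_fin indicE.
have [wE|wE] := boolP (w \in E); last first.
  by rewrite mulr0; apply: sumr_ge0 => i _.
rewrite mulr1; have -> : \sum_(i <- s) \1_(A i) w = (count (fun i => w \in A i) s)%:R :> R.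
  rewrite -sum1_count natr_sum [RHS]big_mkcond.
  by apply: eq_bigr => i _; rewrite indicE; case: ifP.
by rewrite ler_nat EK // -in_setE.
Qed.

Lemma null_of_arbitrarily_small (A : set T) (B : nat -> set T) (C : R) :
  measurable A -> (forall n, measurable (B n)) ->
  (forall n, A `<=` B n) -> (forall n, (P (B n) <= (C / n.+1%:R)%:E)%E) -> P A = 0%E.
Proof.
move=> mA mB AB PB; apply/eqP; rewrite eq_le measure_ge0 andbT.
have PA n : (P A <= (C / n.+1%:R)%:E)%E.
  by apply: le_trans (PB n); apply: le_measure; rewrite ?inE.
apply/lee_addgt0Pr => e e0; rewrite add0e.
pose n := Num.bound (C / e).
apply: (le_trans (PA n)); rewrite lee_fin ler_pdivrMr // mulrC -ler_pdivrMr //.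
have [C0|C0] := leP 0 C; last first.
  by rewrite (@le_trans _ _ 0) // ler_pdivrMr // mul0r ltW.
have := archi_boundP (divr_ge0 C0 (ltW e0)); rewrite -/n => /ltW /le_trans; apply.
by rewrite ler_nat.
Qed.

End probability_estimates.

Section gaussian_family.
Context (R : realType) (d : measure_display) (T : measurableType d)
  (P : probability T R).
Variable a : nat -> {RV P >-> plane R}.
Hypothesis inda : independent_family P a.
Hypothesis gaussa : forall n, std_complex_gaussian P (a n).

Lemma ae_growth : {ae P, forall w,
  exists K, forall n, normc (toC (a n w)) <= K * n.+1%:R ^+ 2}.
Proof.
pose F n := a n @^-1` outside (n.+1%:R ^+ 2).
have mF n : measurable (F n).
  rewrite -[X in measurable X]setTI; apply: measurable_funPT => //.
  exact: measurable_outside.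
exists (lim_sup_set F); split.
- by apply: bigcap_measurable => // n _; apply: bigcup_measurable => m _.
- apply: lim_sup_set_cvg0 => //.
  apply: (@le_lt_trans _ _ 4%:E); last exact: ltry.
  apply: lime_le; first exact: is_cvg_nneseries.
  apply: nearW => n; apply: (@le_trans _ _ (4 - 4 / n.+1%:R)%:E); last first.
    by rewrite lee_fin gerBl divr_ge0.
  elim: n => [|n IH]; first by rewrite big_nil divr1 subrr.
  rewrite big_nat_recr //=; apply: (le_trans (leeD IH (gaussian_tail_bound (gaussa n) _))).
    by rewrite exprn_gt0.
  rewrite -EFinD lee_fin.
  have n0 : 0 < n.+1%:R :> R by [].
  have -> : n.+2%:R = n.+1%:R + 1 :> R by rewrite natr1.
  move: (n.+1%:R) n0 (ler1n R n.+1) => N N0; rewrite ltn0Sn => N1.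
  have -> : 4 - 4 / (N + 1) = 4 - 4 / N + 2 / N ^+ 2 + 2 * (N - 1) / (N ^+ 2 * (N + 1)).
    by field; rewrite (gt_eqF N0) gt_eqF // ltr_wpDr.
  have N1' : 0 <= N - 1 by rewrite subr_ge0.
  rewrite lerDl; apply: divr_ge0; first exact: mulr_ge0.
  by rewrite mulr_ge0 ?exprn_ge0 ?(ltW N0) // addr_ge0 // ltW.
move=> w /= nK; apply: contrapT => /existsNP[N /not_implyP[_ nF]].
(* Beyond [N] each coordinate is at most (n + 1)^2, hence the 2; the sum takes care of the finitely
   many earlier coefficients. *)
apply: nK; exists (2 + \sum_(k < N) normc (toC (a k w))) => n.
have S0 : 0 <= \sum_(k < N) normc (toC (a k w)) by apply: sumr_ge0 => i _; exact: normc_ge0.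
have n1 : 1 <= n.+1%:R ^+ 2 :> R by rewrite expr_ge1 // ler1n.
have [nN|Nn] := ltnP n N.
  apply: (@le_trans _ _ ((2 + \sum_(k < N) normc (toC (a k w))) * 1)); last first.
    by rewrite ler_wpM2l // addr_ge0.
  rewrite mulr1 (bigD1 (Ordinal nN)) //= addrCA lerDl addr_ge0 //.
  by apply: sumr_ge0 => i _; exact: sqrtr_ge0.
have /negP : ~ F n w by move=> Fn; apply: nF; exists n.
rewrite /F /outside /=; case: (a n w) => x y /=; rewrite negb_or -!leNgt => /andP[hx hy].
apply: (le_trans (le_normc_abs _ _)); apply: (le_trans (lerD hx hy)).
have -> : n.+1%:R ^+ 2 + n.+1%:R ^+ 2 = 2 * n.+1%:R ^+ 2 :> R by ring.
by rewrite ler_wpM2r ?exprn_ge0 // lerDl.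
Qed.

Lemma ae_coef0_neq0 : {ae P, forall w, toC (a 0%N w) != 0}.
Proof.
exists (a 0%N @^-1` square 0 0); split.
- rewrite -[X in measurable X]setTI; apply: measurable_funPT => //.
  exact: measurable_square.
- apply/eqP; rewrite eq_le measure_ge0 andbT.
  apply: (le_trans (gaussian_square_bound 0 (gaussa 0) (lexx 0))).
  by rewrite expr0n /= mulr0.
move=> w /= /negP; rewrite negbK => /eqP h.
have [x0 y0] : ((a 0%N w).1 : R) = 0 /\ ((a 0%N w).2 : R) = 0.
  by move: h; rewrite /toC => -[].
by rewrite /square /= !in_itv /= x0 y0 subr0 addr0 lexx.
Qed.

Definition gaf_monomial (z : R[i]) k : R[i] := z ^+ k / real_complex R (Num.sqrt k`!%:R).

Lemma gaf_partial_sumE m z w :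
  (partial_sum (gaf_coef (fun n => a n w)) m).[z] =
  lincomb (gaf_monomial z) a xpredT m w.
Proof. exact: gaf_partial_sum_lincomb. Qed.

Lemma normc_gaf_monomial z k : normc (gaf_monomial z k) = normc z ^+ k / Num.sqrt k`!%:R.
Proof. by rewrite normcM normcX normcV normc_real ger0_norm // sqrtr_ge0. Qed.

Lemma measurable_lincomb_le (c : nat -> R[i]) m e :
  measurable [set w | (normc (lincomb c a xpredT m w) <= e)%R].
Proof. by apply: measurable_le_cst; exact: measurable_normc_lincomb. Qed.

Definition grid (r N : nat) : seq R[i] :=
  [seq Complex (i%:R / N%:R - r%:R) (j%:R / N%:R - r%:R) |
     i <- iota 0 (2 * r * N).+1, j <- iota 0 (2 * r * N).+1].

Lemma grid_approx (r N : nat) z : (0 < N)%N -> normc z <= r%:R ->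
  exists2 c, c \in grid r N & normc (c - z) <= 2 / N%:R.
Proof.
move=> N0 zr; have N0' : 0 < N%:R :> R by rewrite ltr0n.
have approx (x : R) : `|x| <= r%:R -> exists2 i : nat, i \in iota 0 (2 * r * N).+1 &
    `|i%:R / N%:R - r%:R - x| <= 1 / N%:R.
  rewrite ler_norml => /andP[x1 x2].
  have y0 : 0 <= (x + r%:R) * N%:R by rewrite mulr_ge0 // -lerBlDr sub0r.
  have /andP[h1 h2] := truncn_itv y0; exists (Num.truncn ((x + r%:R) * N%:R)).
    rewrite mem_iota /= add0n ltnS -(ler_nat R) (le_trans h1) //.
    by rewrite !natrM ler_wpM2r // mulr2n mulrDl !mul1r lerD2r.
  move: h1 h2; rewrite -natr1; move: (Num.truncn _)%:R => t h1 h2.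
  have -> : t / N%:R - r%:R - x = - (((x + r%:R) * N%:R - t) / N%:R).
    by field; rewrite gt_eqF.
  rewrite normrN ger0_norm; last by rewrite divr_ge0 ?subr_ge0 // ltW.
  by rewrite ler_pM2r ?invr_gt0 //; lra.
case: z zr => x y zr.
have [i iin xi] := approx x (le_trans (abs_le_normc x y) zr).
have [j jin yj] := approx y (le_trans (abs_le_normc2 x y) zr).
exists (Complex (i%:R / N%:R - r%:R) (j%:R / N%:R - r%:R)).
  by apply/allpairsP; exists (i, j).
apply: (le_trans (le_normc_abs _ _)); apply: (le_trans (lerD xi yj)).
by rewrite -mulrDl.
Qed.

(** A multiple zero makes [f] of size N^(-2) at a nearby grid point. By anticoncentration in the
    constant coefficient a given grid point has this property with probability O(N^(-4)), and there
    are O(N^2) of them, so the union has probability tending to 0. *)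
Lemma ae_simple_zeros : {ae P, forall w, forall r B : nat, forall z,
  normc z <= r%:R ->
  ~ nonsimple_zero (gaf (fun n => a n w)) (r%:R + 1) B%:R z}.
Proof.
have [G [mG PG Ggrowth]] := ae_growth.
(* 4B / N^2 is the quadratic bound at distance 2 / N, and 1 / N^2 is left for replacing [f] by a
   partial sum. *)
pose e (B N : nat) : R := (4 * B%:R + 1) / N%:R ^+ 2.
have e0 B N : 0 <= e B N by rewrite divr_ge0 ?exprn_ge0 // addr_ge0 // mulr_ge0.
pose A B N m (z : R[i]) := [set w | (normc (lincomb (gaf_monomial z) a xpredT m w) <= e B N)%R].
have mA B N m z : measurable (A B N m z) by exact: measurable_lincomb_le.
pose F r B N m := [set w | exists2 z, z \in grid r N & A B N m z w].
have PA B N m z : (0 < m)%N -> (P (A B N m z) <= (4 * e B N ^+ 2)%:E)%E.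
  move=> m0; have n1 : normc (gaf_monomial z 0) = 1.
    by rewrite normc_gaf_monomial expr0 fact0 sqrtr1 divr1.
  have g0 : gaf_monomial z 0 != 0 by rewrite -normc_eq0 n1 oner_eq0.
  have := anticoncentration inda gaussa (e0 B N) m0 g0.
  by rewrite n1 mulr1.
have PF r B N m : (0 < m)%N -> measurable (F r B N m) /\
    (P (F r B N m) <= (4 * e B N ^+ 2 *+ size (grid r N))%:E)%E.
  by move=> m0; apply: measure_exists_le => // z _; exact: PA.
(* The events concern partial sums, and how late these must be to approximate [f] depends on the
   path; the lower limit over [m] allows for that. *)
pose E r B N := liminf_sets (fun m => F r B N m.+1).
have mE r B N : measurable (E r B N).
  by apply: measurable_liminf_sets => m; have [] := PF r B N m.+1 isT.
pose C (r B : nat) : R := 4 * (4 * B%:R + 1) ^+ 2 * (2 * r%:R + 1) ^+ 2.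
have PE r B N : (0 < N)%N -> (P (E r B N) <= (C r B / N%:R)%:E)%E.
  move=> N0; apply: (@measure_liminf_sets_le _ _ _ P _ _ 0%N).
    by move=> m; have [] := PF r B N m.+1 isT.
  move=> m _; have [_ /le_trans] := PF r B N m.+1 isT; apply.
  rewrite lee_fin size_allpairs !size_iota -mulr_natr natrM.
  have sz : (2 * r * N).+1%:R <= (2 * r%:R + 1) * N%:R :> R.
    by rewrite -[(2 * r * N).+1%:R]natr1 mulrDl mul1r !natrM lerD2l ler1n.
  have N1 : 1 <= N%:R :> R by rewrite ler1n.
  have N0' : 0 < N%:R :> R by rewrite ltr0n.
  apply: (@le_trans _ _ (4 * e B N ^+ 2 * (((2 * r%:R + 1) * N%:R) * ((2 * r%:R + 1) * N%:R)))).
    rewrite ler_wpM2l ?mulr_ge0 ?sqr_ge0 // ler_pM //.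
  rewrite (_ : _ * _ = C r B / N%:R / N%:R); last first.
    by rewrite /e /C; field; rewrite gt_eqF.
  rewrite ler_pdivrMr // ler_peMr // divr_ge0 // /C.
  by rewrite !mulr_ge0 // ?sqr_ge0.
(* Starting at N = 2 keeps the grid point within distance 1 of the zero, inside the domain of radius
   r + 1 of the quadratic bound. *)
pose Z r B := \bigcap_n E r B n.+2.
have mZ r B : measurable (Z r B) by exact: bigcapT_measurable.
have PZ r B : P (Z r B) = 0%E.
  apply: (@null_of_arbitrarily_small _ _ _ P _ (fun n => E r B n.+2) (C r B)) => //.
    by move=> n; exact: bigcap_inf.
  move=> n; apply: (le_trans (PE r B n.+2 isT)); rewrite lee_fin ler_wpM2l //.
    by rewrite /C !mulr_ge0 // ?sqr_ge0.
  by rewrite lef_pV2 ?posrE // ler_nat.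
suff sub : ~` [set w | forall r B : nat, forall z, normc z <= r%:R ->
    ~ nonsimple_zero (gaf (fun n => a n w)) (r%:R + 1) B%:R z] `<=`
    G `|` \bigcup_r \bigcup_B Z r B.
  apply: (@negligibleS _ _ _ P _ _ sub).
  apply: negligibleU; first by exists G; split.
  apply: negligible_bigcup => r; apply: negligible_bigcup => B.
  by exists (Z r B); split => //; exact: PZ.
move=> w nw; have [Gw|nGw] := pselect (G w); [by left|right].
have [K aK] : exists K, forall n, normc (toC (a n w)) <= K * n.+1%:R ^+ 2.
  by apply: contrapT => h; apply: nGw; apply: Ggrowth.
have [r [B [z [zr nsz]]]] : exists (r B : nat) z, normc z <= r%:R /\
    nonsimple_zero (gaf (fun n => a n w)) (r%:R + 1) B%:R z.
  apply: contrapT => h; apply: nw => r B z zr nsz; apply: h.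
  by exists r, B, z.
exists r => //; exists B => // n _.
set N := n.+2; have N0 : 0 < N%:R :> R by rewrite ltr0n.
have [c cg cz] := @grid_approx r N z isT zr.
have N2 : 2 / N%:R <= 1 :> R by rewrite ler_pdivrMr // mul1r ler_nat.
have cr : normc c <= r%:R + 1.
  have -> : c = z + (c - z) by ring.
  by apply: (le_trans (le_normcD _ _)); rewrite lerD // (le_trans cz).
have fc : normc (gaf (fun n => a n w) c) <= 4 * B%:R / N%:R ^+ 2.
  apply: (le_trans (nsz c cr)).
  have -> : 4 * B%:R / N%:R ^+ 2 = B%:R * (2 / N%:R) ^+ 2 :> R.
    by rewrite expr_div_n; ring.
  by rewrite ler_wpM2l // lerXn2r ?nnegrE ?normc_ge0 // divr_ge0 // ltW.
have N2' : 0 < 1 / N%:R ^+ 2 :> R by rewrite divr_gt0 // exprn_gt0.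
have r1 : 0 <= r%:R + 1 :> R by rewrite addr_ge0.
have [m0 Hm0] := gaf_locally_uniform_limit aK r1 N2'.
exists m0 => // m /= m0m; exists c => //.
rewrite /A /= -gaf_partial_sumE.
have := Hm0 m.+1 (leqW m0m) c cr.
set p := _.[c]; set f := gaf _ c in fc * => pf.
have -> : p = f + (p - f) by ring.
apply: (le_trans (le_normcD _ _)); apply: (le_trans (lerD fc pf)).
by rewrite -mulrDl.
Qed.

(** A number below exactly g < K of the levels q^0, ..., q^(K-1) is at least q^g. Were the total
    count less than K, the product would be at least [q] to that count, hence at least q^K. *)
Lemma count_powers_ge (q : R) (ys : seq R) K : 0 < q -> q <= 1 ->
  (forall y, y \in ys -> 0 <= y) -> \prod_(y <- ys) y < q ^+ K ->
  (K <= \sum_(y <- ys) count (fun i => (y <= q ^+ i)%R) (iota 0 K))%N.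
Proof.
move=> q0 q1 ys0; apply: contraTT; rewrite -ltnNge -leNgt => sumK.
apply: (@le_trans _ _ (\prod_(y <- ys) q ^+ count (fun i => y <= q ^+ i) (iota 0 K))).
  by rewrite prodrXr ler_wiXn2l ?(ltW q0) // ltnW.
rewrite big_seq [leRHS]big_seq; apply: ler_prod => y yys.
rewrite exprn_ge0 ?(ltW q0) //=.
set g := count _ _; have gK : (g < K)%N.
  by apply: leq_ltn_trans sumK; rewrite (big_rem y yys) /= leq_addr.
rewrite leNgt; apply/negP => /ltW yq.
suff : (g.+1 <= g)%N by rewrite ltnn.
rewrite {2}/g -(subnKC gK) iotaD count_cat add0n.
apply: leq_trans (leq_addr _ _).
suff /eqP -> : count (fun i => y <= q ^+ i) (iota 0 g.+1) == size (iota 0 g.+1).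
  by rewrite size_iota.
rewrite -all_count; apply/allP => i; rewrite mem_iota add0n ltnS => /andP[_ ig].
by apply: (le_trans yq); rewrite ler_wiXn2l // ltW.
Qed.

Lemma count_pairs (I : Type) (p : I -> nat -> bool) (s : seq I) (t : seq nat) :
  count (fun ij : I * nat => p ij.1 ij.2) [seq (i, j) | i <- s, j <- t] =
  (\sum_(i <- s) count (p i) t)%N.
Proof.
elim: s => [|i s IH]; first by rewrite big_nil.
by rewrite big_cons /= count_cat IH count_map.
Qed.

(** Values at different nodes are dependent, so the estimate uses first moments: level [i] is
    reached at one node with probability at most 4 e^(-2i) <= 4 / 4^i, which sums to less than 8,
    while a bad product forces k M pairs. Markov's inequality leaves 8M / (kM). *)
Lemma product_lower_bound_prob (nodes : seq R[i]) (n k m : nat) (r : R) :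
  (n < m)%N -> (0 < k)%N -> 0 < r -> (0 < size nodes)%N ->
  (forall z, z \in nodes -> normc z = r) ->
  let bad := [set w |
    (\prod_(z <- nodes) normc (lincomb (gaf_monomial z) a xpredT m w) <
     (r ^+ n / Num.sqrt n`!%:R * expR (- k%:R)) ^+ size nodes)%R] in
  measurable bad /\ (P bad <= (8 / k%:R)%:E)%E.
Proof.
move=> nm k0 r0 M0 nodesr bad.
set M := size nodes in bad M0 *.
pose x := r ^+ n / Num.sqrt n`!%:R.
have x0 : 0 < x by rewrite divr_gt0 ?exprn_gt0 // sqrtr_gt0 ltr0n fact_gt0.
pose q := expR (- 1) : R; have q0 : 0 < q := expR_gt0 _.
have q2 : q <= 1 / 2.
  rewrite /q expRN ler_pdivlMr ?mul1r // mulrC ler_pdivrMr ?expR_gt0 // mul1r.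
  by have := expR_ge1Dx (1 : R); rewrite -natr1.
have q1 : q <= 1 by apply: (le_trans q2); lra.
have mprod : measurable_fun setT
    (fun w => \prod_(z <- nodes) normc (lincomb (gaf_monomial z) a xpredT m w)).
  by apply: measurable_prod => z _; exact: measurable_normc_lincomb.
have mbad : measurable bad.
  by rewrite -[X in measurable X]setTI; apply: (measurable_fun_ltr mprod (measurable_cst _)).
split=> //.
pose A (zi : R[i] * nat) := [set w |
  (normc (lincomb (gaf_monomial zi.1) a xpredT m w) <= q ^+ zi.2 * x)%R].
have PA (zi : R[i] * nat) : zi.1 \in nodes -> (P (A zi) <= (4 * (1 / 4) ^+ zi.2)%:E)%E.
  move=> /nodesr zr; have nx : normc (gaf_monomial zi.1 n) = x.
    by rewrite normc_gaf_monomial zr.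
  have g0 : gaf_monomial zi.1 n != 0 by rewrite -normc_eq0 nx gt_eqF.
  have := anticoncentration inda gaussa (exprn_ge0 zi.2 (ltW q0)) nm g0.
  rewrite nx => /le_trans; apply; rewrite lee_fin ler_wpM2l //.
  rewrite -exprM mulnC exprM lerXn2r ?nnegrE ?sqr_ge0 //.
  by rewrite expr2 (_ : 1 / 4 = 1 / 2 * (1 / 2)) ?ler_pM ?(ltW q0) //; lra.
pose s := [seq (z, i) | z <- nodes, i <- iota 0 (k * M)].
have key : ((k * M)%:R%:E * P bad <= \sum_(zi <- s) P (A zi))%E.
  apply: markov_count => //.
    by move=> zi; exact: measurable_lincomb_le.
  move=> w badw; rewrite (eq_count (a2 := fun zi =>
     normc (lincomb (gaf_monomial zi.1) a xpredT m w) <= q ^+ zi.2 * x)); last first.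
    by move=> zi; rewrite /A mem_setE.
  rewrite /s (count_pairs (fun z i => normc (lincomb (gaf_monomial z) a xpredT m w) <= q ^+ i * x)).
  pose ys := [seq normc (lincomb (gaf_monomial z) a xpredT m w) / x | z <- nodes].
  have -> : (\sum_(z <- nodes) count (fun i =>
        (normc (lincomb (gaf_monomial z) a xpredT m w) <= q ^+ i * x)%R) (iota 0 (k * M)) =
      \sum_(y <- ys) count (fun i => (y <= q ^+ i)%R) (iota 0 (k * M)))%N.
    rewrite big_map; apply: eq_bigr => z _; apply: eq_count => i.
    by rewrite ler_pdivrMr.
  apply: count_powers_ge => //.
    by move=> y /mapP[z _ ->]; rewrite divr_ge0 ?normc_ge0 // ltW.
  rewrite /ys big_map big_split /= big_const_seq count_predT iter_mulr_1 exprVn.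
  rewrite ltr_pdivrMr ?exprn_gt0 //; move: badw; rewrite /bad /= => /lt_le_trans; apply.
  rewrite exprMn -/x mulrC exprM /q -expRM_natr mulN1r.
  done.
have sumP : (\sum_(zi <- s) P (A zi) <= (M%:R * 8)%:E)%E.
  rewrite /s big_allpairs_dep /=.
  apply: (@le_trans _ _ (\sum_(z <- nodes) (8 : R)%:E)%E).
    rewrite big_seq [leRHS]big_seq; apply: lee_sum => z zn.
    apply: (@le_trans _ _ (\sum_(i <- iota 0 (k * M)) (4 * (1 / 4) ^+ i)%:E)%E).
      by apply: lee_sum => i _; exact: PA.
    rewrite sumEFin lee_fin -mulr_sumr -[(k * M)%N]subn0 -/(index_iota 0 _).
    have geo K : \sum_(0 <= i < K) (1 / 4) ^+ i <= 4 / 3 - 4 / 3 * (1 / 4) ^+ K :> R.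
      elim: K => [|K IH]; first by rewrite big_nil expr0; lra.
      rewrite big_nat_recr //= exprS.
      have : 0 <= (1 / 4) ^+ K :> R by rewrite exprn_ge0 //; lra.
      by move: IH; set u := (1 / 4) ^+ K; lra.
    have := geo (k * M)%N; have : 0 <= (1 / 4) ^+ (k * M) :> R by rewrite exprn_ge0 //; lra.
    by lra.
  by rewrite sumEFin lee_fin big_const_seq count_predT iter_addr_0 mulr_natl.
have kM0 : 0 < (k * M)%:R :> R by rewrite ltr0n muln_gt0 k0.
have Pfin : P bad \is a fin_num by exact: fin_num_measure.
move: (le_trans key sumP); rewrite -(fineK Pfin) -EFinM !lee_fin natrM => h.
rewrite ler_pdivlMr ?ltr0n //.
have M0' : 0 < M%:R :> R by rewrite ltr0n.
rewrite -(ler_pM2l M0'); apply: le_trans h.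
by rewrite le_eqVlt; apply/orP; left; apply/eqP; ring.
Qed.

(* On the circle of radius [4 ^ k] the largest monomial [z ^ n / sqrt n!] is the
   one with [n = 16 ^ k]; [node_value k] is its modulus there, up to [exp (- k)]. *)
Definition node_radius (k : nat) : R := 4 ^+ k.

Definition node_value (k : nat) : R :=
  node_radius k ^+ (16 ^ k) / Num.sqrt ((16 ^ k)`!%:R) * expR (- k%:R).

(** For fixed [k] the bound 8/k holds for all large [m], so all late [m] are bad with probability at
    most 8/k. This tends to 0 without being summable: it rules out that all late [k] fail and yields
    infinitely many good [k], as [excess_set] asks. *)
Lemma ae_lower_bound (nodes : nat -> nat -> seq R[i]) :
  (forall k m, size (nodes k m) = (m.+1 ^ 2)%N) ->
  (forall k m z, z \in nodes k m -> normc z = node_radius k) ->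
  {ae P, forall w, forall k0, exists2 k, (k0 <= k)%N &
    forall m0, exists2 m, (m0 <= m)%N &
      node_value k ^+ (m.+1 ^ 2) <=
      \prod_(z <- nodes k m) normc (partial_sum (gaf_coef (fun n => a n w)) m).[z]}.
Proof.
move=> nodes_size nodes_norm.
pose bad k m := [set w |
  (\prod_(z <- nodes k m) normc (lincomb (gaf_monomial z) a xpredT m w) <
   node_value k ^+ (m.+1 ^ 2))%R].
have badP k m : (0 < k)%N -> (16 ^ k < m)%N ->
    measurable (bad k m) /\ (P (bad k m) <= (8 / k%:R)%:E)%E.
  move=> k0 km; rewrite /bad /node_value -(nodes_size k m).
  apply: product_lower_bound_prob => //.
  - by rewrite exprn_gt0.
  - by rewrite nodes_size expn_gt0.
  - exact: nodes_norm.
(* The shift makes the partial sum contain the dominant monomial, of index 16^k. *)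
pose bad' k m := bad k (m + (16 ^ k).+1)%N.
pose E k := liminf_sets (bad' k).
have mE k : measurable (E k.+1).
  apply: measurable_liminf_sets => m; have [] // := badP k.+1 (m + (16 ^ k.+1).+1)%N.
  by rewrite addnS ltnS leq_addl.
have PE k : (P (E k.+1) <= (8 / k.+1%:R)%:E)%E.
  apply: (@measure_liminf_sets_le _ _ _ P _ _ 0%N).
    move=> m; have [] // := badP k.+1 (m + (16 ^ k.+1).+1)%N.
    by rewrite addnS ltnS leq_addl.
  move=> m _; have [] // := badP k.+1 (m + (16 ^ k.+1).+1)%N.
  by rewrite addnS ltnS leq_addl.
pose G n := \bigcap_(k >= n) E k.+1.
have mG n : measurable (G n).
  by apply: bigcap_measurable => [|k _]; [exists n => /=|exact: mE].
have PG n : P (G n) = 0%E.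
  apply: (@null_of_arbitrarily_small _ _ _ P _ (fun k => E (maxn n k).+1) 8) => //.
    by move=> k; apply: bigcap_inf; exact: leq_maxl.
  move=> k; apply: (le_trans (PE _)); rewrite lee_fin ler_wpM2l //.
  by rewrite lef_pV2 ?posrE // ler_nat ltnS leq_maxr.
have negG : P.-negligible (\bigcup_n G n).
  by apply: negligible_bigcup => n; exists (G n); split => //; exact: PG.
apply: negligibleS negG => w nw; apply: contrapT => nG; apply: nw => k0.
have /existsNP[k /not_implyP[/= k0k nE]] : ~ G k0 w by move=> Gw; apply: nG; exists k0.
exists k.+1; first exact: leqW.
move=> m0; have /existsNP[m /not_implyP[/= m0m]] : ~ (\bigcap_(m >= m0) bad' k.+1 m) w.
  by move=> h; apply: nE; exists m0.
rewrite /bad' /bad /= => /negP; rewrite -leNgt => h.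
exists (m + (16 ^ k.+1).+1)%N; first by rewrite (leq_trans m0m) // leq_addr.
apply: (le_trans h); rewrite le_eqVlt; apply/orP; left; apply/eqP.
by apply: eq_bigr => z _; rewrite gaf_partial_sumE.
Qed.

End gaussian_family.

(** * Counting functions of configurations *)

Section configurations.
Variable R : realType.
Implicit Types (mu nu : point_config R) (A : set (plane R)).

Lemma measurable_plane_set1 (y : plane R) : measurable [set y].
Proof.
case: y => a b; have -> : [set (a, b)] = [set a] `*` [set b] :> set (plane R).
  by apply/seteqP; split => -[u v] /= [-> ->].
by apply: measurableX; exact: measurable_set1.
Qed.

(** Testing on singletons identifies the set [X] in the definition of simplicity with the
    support. *)
Lemma config_count mu A : measurable A ->
  mu A = (\esum_(x in config_support mu `&` A) 1)%E.
Proof.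
have [X HX] := config_simple mu.
have countE B : measurable B -> mu B = (\esum_(x in X `&` B) 1)%E.
  move=> mB; rewrite HX // esum_mkcondr; apply: eq_esum => x _.
  by rewrite diracE; case: ifP.
suff <- : X = config_support mu by exact: countE.
apply/seteqP; split => y; rewrite /config_support /= countE; try exact: measurable_plane_set1.
  move=> Xy; have -> : X `&` [set y] = [set y].
    by apply/seteqP; split => [z []|z ->].
  by rewrite esum_set1.
have [//|nXy] := pselect (X y).
have -> : X `&` [set y] = set0.
  by apply/seteqP; split => [z [Xz zy]|//]; apply: nXy; rewrite -zy.
by rewrite esum_set0 => /esym/eqP; rewrite onee_eq0.
Qed.

Lemma config_finite mu (K A : set (plane R)) : compact (K : set (R * R)) ->
  measurable K -> A `<=` K -> finite_set (config_support mu `&` A).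
Proof.
move=> cK mK AK; apply: contrapT => infA.
have := config_locally_finite mu cK.
have ge n : (n%:R%:E <= mu K)%E.
  have [B BA nB] := infinite_set_fset n infA.
  rewrite config_count //; apply: esum_ge; exists [set` B].
    split; first exact: finite_fset.
    by move=> x /BA [Sx Ax]; split => //; exact: AK.
  rewrite fsbig_finite //= set_fsetK sumEFin big_const_seq count_predT iter_addr_0.
  by rewrite lee_fin ler_nat; exact: nB.
case E : (mu K) ge => [x| |] // ge _; last by have := ge 0%N.
have := ge (Num.bound x); rewrite lee_fin leNgt.
by rewrite archi_boundP // -lee_fin; exact: (ge 0%N).
Qed.

Definition disc (r : R) : set (plane R) := [set z | (normc (toC z) <= r)%R].

Lemma measurable_disc r : measurable (disc r).
Proof.
apply: measurable_le_cst; apply: measurable_normc => /=.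
  exact: measurable_fst.
exact: measurable_snd.
Qed.

Lemma compact_square (z : R * R) (e : R) : compact (square z e : set (R * R)).
Proof. by apply: compact_setX; exact: segment_compact. Qed.

Lemma disc_sub_square r : disc r `<=` square (0, 0) r.
Proof.
move=> [x y]; rewrite /disc /square /= => h; rewrite !in_itv /= !sub0r !add0r -!ler_norml.
by split; apply: le_trans h; [exact: abs_le_normc|exact: abs_le_normc2].
Qed.

Lemma config_disc_seq mu r : exists2 s : seq (plane R), uniq s &
  forall z, (z \in s) <-> (config_support mu z /\ disc r z).
Proof.
have fin := config_finite mu (@compact_square (0, 0) r) (measurable_square _ _)
  (@disc_sub_square r).
exists (fset_set (config_support mu `&` disc r)); first exact: fset_uniq.
by move=> z; rewrite in_fset_set // inE.
Qed.

Lemma config_integral mu r (g : plane R -> \bar R) (s : seq (plane R)) :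
  measurable_fun setT g -> (forall z, (0 <= g z)%E) ->
  (forall z, ~ disc r z -> g z = 0%E) -> uniq s ->
  (forall z, (z \in s) <-> (config_support mu z /\ disc r z)) ->
  (\int[mu]_z g z = \sum_(z <- s) g z)%E.
Proof.
move=> mg g0 gD us sP.
have mD := measurable_disc r.
have -> : (\int[mu]_z g z = \int[mu]_(z in disc r) g z)%E.
  rewrite [RHS]integral_mkcond; apply: eq_integral => z _.
  by rewrite patchE; case: ifPn => // /negP; rewrite inE => /gD.
pose m_ n : {measure set (plane R) -> \bar R} := dirac (nth point s n).
rewrite (@eq_measure_integral _ _ _ _ (msum m_ (size s))); last first.
  move=> A mA AD; rewrite config_count // /msum /m_ /=.
  have -> : config_support mu `&` A = [set` [seq z <- s | z \in A]].
    apply/seteqP; split => z /=; rewrite mem_filter.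
      by move=> [Sz Az]; apply/andP; split; [exact: mem_set|apply/sP; split => //; exact: AD].
    by move=> /andP[/set_mem Az /sP[Sz _]].
  rewrite /= /msum esum_fset //; last exact: finite_seq.
  rewrite -fsbig_seq ?filter_uniq // big_filter big_mkcond (big_nth point) big_mkord.
  by apply: eq_bigr => i _; rewrite /= diracE; case: ifP.
rewrite ge0_integral_measure_sum //; last exact: measurable_funTS.
rewrite (big_nth point) big_mkord; apply: eq_bigr => i _.
rewrite /m_ integral_dirac //; last exact: measurable_funTS.
have : nth point s i \in s by rewrite mem_nth.
by move=> /sP [_ D]; rewrite diracE mem_set // mul1e.
Qed.

(* Integrating [log_weight k] against the zeros gives the Jensen counting function
   at radius [4 ^ k]. *)
Definition log_weight (k : nat) (z : plane R) : R :=
  Num.max 0 (ln (4 ^+ k) - ln (normc (toC z))).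

Lemma log_weight_ge0 k z : 0 <= log_weight k z.
Proof. by rewrite /log_weight le_max lexx. Qed.

Lemma measurable_log_weight k : measurable_fun setT (fun z => (log_weight k z)%:E).
Proof.
have mn : measurable_fun setT (fun z : plane R => normc (toC z)).
  by apply: measurable_normc; [exact: measurable_fst|exact: measurable_snd].
apply/measurable_EFinP; apply: measurable_maxr => //.
apply: measurable_funB => //.
by apply: measurableT_comp => //; exact: measurable_ln.
Qed.

Lemma log_weight_disc k z : normc (toC z) != 0 -> disc (4 ^+ k) z ->
  log_weight k z = ln (4 ^+ k) - ln (normc (toC z)).
Proof.
move=> z0 zk; rewrite /log_weight (max_idPr _) // subr_ge0.
by rewrite ler_ln ?posrE ?exprn_gt0 // lt_neqAle eq_sym z0 normc_ge0.
Qed.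

Lemma log_weight_notin_disc k z : ~ disc (4 ^+ k) z -> log_weight k z = 0.
Proof.
move=> /negP; rewrite -ltNge => kz.
have k0 : 0 < 4 ^+ k :> R by rewrite exprn_gt0.
rewrite /log_weight (max_idPl _) // subr_le0 ler_ln ?posrE ?(ltW kz) //.
exact: lt_trans kz.
Qed.

Lemma expR1_bounds : (2 <= expR 1 :> R) && (expR 1 <= 4 :> R).
Proof.
apply/andP; split; first by apply: le_trans (expR_ge1Dx 1); lra.
have h : 1 / 2 <= expR (- (1 / 2)) :> R by apply: le_trans (expR_ge1Dx _); lra.
have h4 : 1 / 4 <= expR (- 1) :> R.
  have -> : - 1 = - (1 / 2) + - (1 / 2) :> R by lra.
  rewrite expRD (_ : 1 / 4 = 1 / 2 * (1 / 2)); last by lra.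
  by apply: ler_pM => //; lra.
by move: h4; rewrite expRN mul1r lef_pV2 ?posrE ?expR_gt0.
Qed.

Lemma ln4_bounds : (1 <= ln 4 :> R) && (ln 4 <= 2 :> R).
Proof.
have /andP[h1 h2] := expR1_bounds.
apply/andP; split; first by rewrite -[leLHS]expRK ler_ln ?posrE ?expR_gt0.
rewrite -[leRHS]expRK ler_ln ?posrE ?expR_gt0 //.
have -> : 2 = 1 + 1 :> R by lra.
by rewrite expRD; nra.
Qed.

Lemma log_weight_ge k u : normc (toC u) != 0 ->
  k%:R - ln (normc (toC u)) <= log_weight k u.
Proof.
move=> u0; rewrite /log_weight le_max; apply/orP; right.
have u0' : 0 < normc (toC u) by rewrite lt_neqAle eq_sym u0 normc_ge0.
rewrite lerD2r lnXn //.
have /andP[h _] := ln4_bounds.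
by rewrite -[leRHS]mulr_natr ler_peMl.
Qed.

Definition log_count (k : nat) (mu : point_config R) : \bar R :=
  (\int[mu]_z (log_weight k z)%:E)%E.

Lemma measurable_config_eval A : measurable A ->
  measurable_fun setT (fun mu : point_config R => mu A).
Proof.
move=> mA _ B mB; rewrite setTI; apply: sub_sigma_algebra.
by exists A => //; exists B => //; rewrite setTI.
Qed.

Lemma measurable_log_count k : measurable_fun setT (log_count k).
Proof.
apply: (@measurable_fun_integral_kernel _ _ _ _ _
  (fun mu : point_config R => (mu : {measure set (plane R) -> \bar R}))).
- exact: measurable_config_eval.
- by move=> z; rewrite lee_fin log_weight_ge0.
- exact: measurable_log_weight.
Qed.

(* Each inserted point adds about [k * ln 4] to [log_count k], hence more than
   the step [k / 2] between the thresholds of consecutive sets. *)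
Definition excess_set (j : nat) : set (point_config R) :=
  \bigcap_n \bigcup_(k >= n)
    [set mu | ((16 ^+ k / 2 + (j%:R / 2 - 4) * k%:R)%:E < log_count k mu)%E].

Lemma measurable_excess_set j : measurable (excess_set j).
Proof.
apply: bigcap_measurable => // n _; apply: bigcup_measurable => k _.
rewrite -[X in measurable X]setTI; apply: emeasurable_fun_o_infty => //.
exact: measurable_log_count.
Qed.

Lemma excess_set_succ j mu nu u : normc (toC u) != 0 ->
  (forall B, measurable B -> nu B = (mu B + \d_u B)%E) ->
  excess_set j mu -> excess_set j.+1 nu.
Proof.
move=> u0 nuE Hmu n _.
have cE k : log_count k nu = (log_count k mu + (log_weight k u)%:E)%E.
  rewrite /log_count (@eq_measure_integral _ _ _ _ (measure_add mu (dirac u))); last first.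
    by move=> B mB _; exact: etrans (nuE B mB) (esym (measure_addE _ _ _)).
  rewrite ge0_integral_measure_add //; last 2 first.
  - by move=> z _; rewrite lee_fin log_weight_ge0.
  - exact: measurable_log_weight.
  rewrite integral_dirac //; last exact: measurable_log_weight.
  by rewrite diracE mem_set // mul1e.
(* For k >= 2 ln|u| the new point contributes at least k - ln|u| >= k / 2, the gap between the
   thresholds for [j] and [j.+1]. *)
pose L := ln (normc (toC u)); pose n0 := Num.bound (2 * `|L|).
have [k /= nk kmu] := Hmu (maxn n n0) I.
exists k => /=; first by rewrite (leq_trans _ nk) // leq_maxl.
have k0 : 2 * L <= k%:R.
  apply: (@le_trans _ _ (2 * `|L|)); first by rewrite ler_wpM2l // ler_norm.
  apply: le_trans (ltW (archi_boundP _)) _; first by rewrite mulr_ge0.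
  by rewrite ler_nat (leq_trans _ nk) // leq_maxr.
have wk := log_weight_ge k u0.
rewrite cE (_ : 16 ^+ k / 2 + _ = (16 ^+ k / 2 + (j%:R / 2 - 4) * k%:R) + k%:R / 2); last first.
  by rewrite -natr1; field.
by rewrite EFinD lte_leD // lee_fin (le_trans _ wk) // -/L; lra.
Qed.

End configurations.

Lemma ln_prod_seq (R : realType) (I : eqType) (s : seq I) (F : I -> R) :
  (forall i, i \in s -> 0 < F i) -> ln (\prod_(i <- s) F i) = \sum_(i <- s) ln (F i).
Proof.
elim: s => [|i s IH] F0; first by rewrite !big_nil ln1.
have h j : j \in s -> 0 < F j by move=> js; apply: F0; rewrite inE js orbT.
rewrite !big_cons lnM ?posrE ?IH //; first by apply: F0; rewrite mem_head.
by rewrite big_seq; apply: prodr_gt0 => j; exact: h.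
Qed.

(** * Jensen bounds along one realisation *)

Section pathwise_bounds.
Variable R : realType.
Variables (a : nat -> plane R) (K : R) (mu : point_config R).
Hypothesis aK : forall n, normc (toC (a n)) <= K * n.+1%:R ^+ 2.
Hypothesis a0 : toC (a 0%N) != 0.
Hypothesis mu_zeros : config_support mu = [set z : plane R | gaf a (toC z) = 0].

Let c := gaf_coef a.
Let f := gaf a.
Let c_bounded : coef_bounded c := gaf_coef_bounded aK.
Let f_limit : locally_uniform_limit c f := gaf_locally_uniform_limit aK.

Lemma toC_inj : injective (@toC R).
Proof. by move=> [x y] [u v] [-> ->]. Qed.

Lemma gaf_coef0 : c 0%N = toC (a 0%N).
Proof. by rewrite /c /gaf_coef fact0 sqrtr1 divr1. Qed.

Lemma gaf_zero_neq0 z : gaf a z = 0 -> z != 0.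
Proof.
move=> fz; apply/eqP => z0; have := limit_at0 f_limit.
rewrite /f -z0 fz gaf_coef0 => /esym/eqP.
by rewrite (negbTE a0).
Qed.

Lemma log_count_sum k : exists zs : seq R[i],
  [/\ uniq zs,
      forall z, (z \in zs) <-> (normc z <= 4 ^+ k /\ gaf a z = 0) &
      log_count k mu = ((size zs)%:R * ln (4 ^+ k) - \sum_(z <- zs) ln (normc z))%:E].
Proof.
have [s us sP] := config_disc_seq mu (4 ^+ k).
exists [seq toC z | z <- s]; split.
- by rewrite map_inj_uniq //; exact: toC_inj.
- move=> z; split.
    by move=> /mapP[x /sP[]]; rewrite mu_zeros => fx xd ->.
  case: z => x y [zk fz]; apply/mapP; exists (x, y) => //.
  by apply/sP; rewrite mu_zeros.
rewrite /log_count (@config_integral _ _ (4 ^+ k) _ s) //; last 3 first.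
- exact: measurable_log_weight.
- by move=> z; rewrite lee_fin log_weight_ge0.
- by move=> z /log_weight_notin_disc ->.
rewrite sumEFin; congr _%:E.
rewrite size_map big_map.
have -> : (size s)%:R * ln (4 ^+ k) = \sum_(i <- s) ln (4 ^+ k) :> R.
  by rewrite big_const_seq count_predT iter_addr_0 mulr_natl.
rewrite -sumrB !big_seq; apply: eq_bigr => z /sP[]; rewrite mu_zeros => fz zk.
by apply: log_weight_disc => //; rewrite normc_eq0; exact: gaf_zero_neq0.
Qed.

Let norm_a0_gt0 : 0 < normc (toC (a 0%N)).
Proof. by rewrite normc_gt0. Qed.

Let K_gt0 : 0 < K.
Proof. by apply: (lt_le_trans norm_a0_gt0); have := aK 0; rewrite expr1n mulr1. Qed.

Let exp4_sqr k : (4 ^+ k) ^+ 2 = 16 ^+ k :> R.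
Proof. by rewrite exprAC (_ : 4 ^+ 2 = 16) // -natrX. Qed.

Let ln16_exp k : ln (16 ^+ k) = 2 * ln (4 ^+ k) :> R.
Proof. by rewrite -exp4_sqr lnXn ?exprn_gt0 // mulr_natl. Qed.

Let ln4_exp k : ln (4 ^+ k) <= 2 * k%:R :> R.
Proof.
have /andP[_ h] := ln4_bounds R.
by rewrite lnXn // -[ln 4 *+ k]mulr_natr ler_wpM2r.
Qed.

Lemma log_count_le : exists C, forall k,
  (log_count k mu <= (16 ^+ k / 2 + 8 * k%:R + C)%:E)%E.
Proof.
(* Half the logarithm of K^2 r^8 exp(r^2 + 15) / |a_0|^2 at r = 4^k; the term 4 ln r is at most 8k
   because ln 4 <= 2. *)
exists (ln K - ln (normc (toC (a 0%N))) + 15 / 2) => k.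
have [zs [uzs zsP ->]] := log_count_sum k; rewrite lee_fin.
have r0 : 0 < 4 ^+ k :> R by rewrite exprn_gt0.
have r1 : 1 <= 4 ^+ k :> R by rewrite exprn_ege1 //; lra.
have x0 : 0 < 16 ^+ k :> R by rewrite exprn_gt0.
have := zeros_upper_bound f_limit uzs r0
  (fun z h => proj2 (proj1 (zsP z) h)) (fun z h => proj1 (proj1 (zsP z) h))
  (fun m => gaf_l2sum_bound aK m r1).
have z0 z : z \in zs -> 0 < normc z.
  by move=> /zsP[_ /gaf_zero_neq0]; rewrite normc_gt0.
have Q0 : 0 < \prod_(z <- zs) normc z ^+ 2.
  by rewrite big_seq; apply: prodr_gt0 => z /z0 ?; rewrite exprn_gt0.
rewrite -/c gaf_coef0 exp4_sqr -ler_ln ?posrE; last 2 first.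
- by rewrite !mulr_gt0 ?exprn_gt0.
- by rewrite !mulr_gt0 ?exprn_gt0 ?expR_gt0.
rewrite !lnM ?posrE ?mulr_gt0 ?exprn_gt0 ?expR_gt0 //.
rewrite ln_prod_seq; last by move=> z /z0 ?; rewrite exprn_gt0.
rewrite (@lnXn _ _ _ x0) ln16_exp expRK.
have -> : \sum_(z <- zs) ln (normc z ^+ 2) = 2 * \sum_(z <- zs) ln (normc z).
  rewrite mulr_sumr !big_seq; apply: eq_bigr => z /z0 h.
  by rewrite lnXn // mulr_natl.
have := ln4_exp k.
rewrite -[_ *+ size zs]mulr_natl.
set n := (size zs)%:R; set l := ln (4 ^+ k).
nra.
Qed.

(** The threshold has slope 26/2 - 4 = 9, one more than the 8 of the upper bound, and for large [k]
    the surplus k absorbs the additive constant. *)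
Lemma not_excess_set26 : ~ excess_set 26 mu.
Proof.
have [C HC] := log_count_le => H.
have [k /= Ck] := H (Num.bound `|C|) I.
rewrite ltNge => /negP; apply; apply: (le_trans (HC k)); rewrite lee_fin.
have : C <= k%:R.
  apply: le_trans (ler_norm _) (le_trans (ltW (archi_boundP _)) _) => //.
  by rewrite ler_nat.
by lra.
Qed.

Hypothesis simple_zeros : forall (r B : nat) z, normc z <= r%:R ->
  ~ nonsimple_zero (gaf a) (r%:R + 1) B%:R z.
Variable nodes : nat -> nat -> seq R[i].
Hypothesis nodes_jensen : forall k m b (rs : seq R[i]),
  \prod_(w <- nodes k m) normc (b *: \prod_(z <- rs) ('X - z%:P)).[w] <=
  2 ^+ size rs * (normc b * \prod_(z <- rs) Num.max (normc z) (node_radius R k)) ^+ (m.+1 ^ 2).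
Hypothesis nodes_large : forall k0, exists2 k, (k0 <= k)%N &
  forall m0, exists2 m, (m0 <= m)%N &
    node_value R k ^+ (m.+1 ^ 2) <= \prod_(z <- nodes k m) normc (partial_sum c m).[z].

Let node_value_gt0 k : 0 < node_value R k.
Proof.
by rewrite mulr_gt0 ?expR_gt0 // divr_gt0 ?exprn_gt0 // sqrtr_gt0 ltr0n fact_gt0.
Qed.

(** Stirling with N = r^2 = 16^k: in N ln r - ln(N!) / 2 - k the terms N ln r cancel, leaving at
    least N/2 - ln r - k - 1/2, and ln r <= 2k. *)
Let ln_node_value_ge k : 16 ^+ k / 2 - 3 * k%:R - 1 / 2 <= ln (node_value R k).
Proof.
have N0 : (0 < 16 ^ k)%N by rewrite expn_gt0.
have F0 : 0 < (16 ^ k)`!%:R :> R by rewrite ltr0n fact_gt0.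
have lnF : ln ((16 ^ k)`!%:R) + 16 ^+ k <= 1 + ln (16 ^+ k) + 16 ^+ k * ln (16 ^+ k) :> R.
  have := fact_stirling_le R N0; rewrite -ler_ln ?posrE; last 2 first.
  - by rewrite mulr_gt0 ?expR_gt0.
  - by rewrite !mulr_gt0 ?expR_gt0 ?exprn_gt0 ?ltr0n.
  rewrite !lnM ?posrE ?mulr_gt0 ?expR_gt0 ?exprn_gt0 ?ltr0n ?fact_gt0 // !expRK lnXn ?ltr0n //.
  by rewrite -[ln _ *+ _]mulr_natl natrX.
have lnsqrt : ln (Num.sqrt ((16 ^ k)`!%:R)) = ln ((16 ^ k)`!%:R) / 2 :> R.
  rewrite -[X in _ = ln X / 2](sqr_sqrtr (ltW F0)) lnXn ?sqrtr_gt0 //.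
  by rewrite -[X in _ = X / 2]mulr_natr mulfK.
rewrite /node_value lnM ?posrE ?divr_gt0 ?exprn_gt0 ?sqrtr_gt0 ?expR_gt0 //.
rewrite expRK ln_div ?posrE ?exprn_gt0 ?sqrtr_gt0 // lnXn ?exprn_gt0 // lnsqrt.
have := ln4_exp k; move: lnF; rewrite ln16_exp -[_ *+ 16 ^ k]mulr_natl natrX /node_radius.
set l := ln (4 ^+ k); nra.
Qed.

Lemma log_count_ge k0 : exists2 k, (k0 <= k)%N &
  ((16 ^+ k / 2 - 3 * k%:R - 1 / 2 - ln (normc (toC (a 0%N))))%:E <= log_count k mu)%E.
Proof.
have [k kk0 Hk] := nodes_large k0; exists k => //.
have [zs [uzs zsP ->]] := log_count_sum k; rewrite lee_fin.
have r0 : 0 < 4 ^+ k :> R by rewrite exprn_gt0.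
have [B0 HB0] := c_bounded (ltW (addr_gt0 r0 ltr01)).
(* Rounded up to an integer, because simplicity of the zeros is available for integer radii and
   constants. *)
pose B : nat := Num.bound `|B0|.
have HB m : l1norm (4 ^+ k + 1) (partial_sum c m) <= B%:R.
  by apply: (le_trans (HB0 m)); apply: le_trans (ler_norm _) (ltW (archi_boundP _)).
have z0 z : z \in zs -> 0 < normc z.
  by move=> /zsP[_ /gaf_zero_neq0]; rewrite normc_gt0.
have Q0 : 0 < \prod_(z <- zs) normc z by rewrite big_seq; apply: prodr_gt0.
have := @zeros_lower_bound _ c f c_bounded f_limit (nodes k) (4 ^+ k) B%:R zs (node_value R k)
  r0 uzs _ (ltW (node_value_gt0 k)) HB _ _ (nodes_jensen k) Hk.
rewrite gaf_coef0 => /(_ a0) H.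
have {}H : node_value R k * \prod_(z <- zs) normc z <= normc (toC (a 0%N)) * (4 ^+ k) ^+ size zs.
  apply: H.
    by move=> z zr fz; apply/zsP.
  move=> z /zsP[zr fz]; split => //.
  have h : normc z <= (4 ^ k)%:R by rewrite natrX.
  by have := @simple_zeros _ B _ h; rewrite natrX.
move: H; rewrite -ler_ln ?posrE ?mulr_gt0 ?exprn_gt0 //.
rewrite (lnM (node_value_gt0 k) Q0) (lnM norm_a0_gt0 (exprn_gt0 _ r0)) (lnXn _ r0) ln_prod_seq //.
have := ln_node_value_ge k; rewrite -[ln (4 ^+ k) *+ _]mulr_natl; lra.
Qed.

(** The term -4k of the threshold lies below the -3k of the lower bound by k, which exceeds the
    additive constant for large [k]. *)
Lemma excess_set0 : excess_set 0 mu.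
Proof.
move=> n _; pose L : R := 1 / 2 + ln (normc (toC (a 0%N))).
have [k nk Hk] := log_count_ge (maxn n (Num.bound `|L|)).
exists k => /=; first by rewrite (leq_trans _ nk) // leq_maxl.
apply: lt_le_trans Hk; rewrite lte_fin.
have : L < k%:R.
  apply: le_lt_trans (ler_norm _) (lt_le_trans (archi_boundP _) _) => //.
  by rewrite ler_nat (leq_trans _ nk) // leq_maxr.
by rewrite /L; lra.
Qed.

End pathwise_bounds.

(** * Adding and removing a point measurably *)

Section rational_cells.
Variable R : realType.
Implicit Types (mu : point_config R) (u z : plane R).

(** An enumeration of small closed squares with rational centres, through which statements about the
    points of a configuration become countable unions. *)
Definition cell (j : nat) : set (plane R) :=
  if @choice.unpickle (rat * rat * nat)%type j is Some (p, n)
  then square (ratr p.1, ratr p.2) n.+1%:R^-1 else set0.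

Lemma measurable_cell j : measurable (cell j).
Proof. by rewrite /cell; case: choice.unpickle => [[p n]|]; [exact: measurable_square|]. Qed.

Lemma cell_basis u e : 0 < e -> exists2 j, cell j u & cell j `<=` square u e.
Proof.
move=> e0; pose n := Num.bound (2 / e); pose h : R := n.+1%:R^-1.
have h0 : 0 < h by rewrite invr_gt0 ltr0n.
have he : 2 * h <= e.
  rewrite ler_pdivrMr ?ltr0n // mulrC -ler_pdivrMr //.
  apply: le_trans (ltW (archi_boundP _)) _; first by rewrite divr_ge0 // ltW.
  by rewrite ler_nat.
have [p /andP[p1 p2]] : exists p : rat, (u.1 : R) - h < ratr p < u.1 + h.
  by have [p] := @rat_in_itvoo R (u.1 - h) (u.1 + h) ltac:(lra); rewrite in_itv /=; exists p.
have [q /andP[q1 q2]] : exists q : rat, (u.2 : R) - h < ratr q < u.2 + h.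
  by have [q] := @rat_in_itvoo R (u.2 - h) (u.2 + h) ltac:(lra); rewrite in_itv /=; exists q.
exists (choice.pickle ((p, q), n)); rewrite /cell choice.pickleK /square /= -/h.
  by rewrite /= !in_itv /=; split; apply/andP; split; lra.
move=> [x y]; rewrite /= !in_itv /= => -[/andP[x1 x2] /andP[y1 y2]].
by split; apply/andP; split; lra.
Qed.

(** A square around [u] contains finitely many points of [mu] and is shrunk past each of them other
    than [u]. Both cases, [u] in the support or not, are used. *)
Lemma config_isolated mu u :
  exists2 j, cell j u & forall z, config_support mu z -> cell j z -> z = u.
Proof.
have /finite_seqP[s sP] := config_finite mu (@compact_square _ u 1)
  (measurable_square _ _) (@subset_refl _ _).
have [e [e0 e1] He] : exists2 e : R, 0 < e /\ e <= 1 &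
    forall z, z \in s -> square u e z -> z = u.
  elim: s {sP} => [|x s [e [e0 e1] IH]]; first by exists 1.
  have [xu|xu] := eqVneq x u.
    exists e => // z; rewrite inE => /orP[/eqP -> //|]; exact: IH.
  pose d : R := Num.max `|(x.1 : R) - u.1| `|(x.2 : R) - u.2|.
  have d0 : 0 < d.
    rewrite lt_max !normr_gt0 !subr_eq0 -negb_and; apply: contra xu => /andP[/eqP h1 /eqP h2].
    by apply/eqP; rewrite [x]surjective_pairing [u]surjective_pairing h1 h2.
  exists (Num.min e (d / 2)).
    by split; [rewrite lt_min e0 divr_gt0|rewrite ge_min e1].
  move=> z; rewrite inE => /orP[/eqP ->|zs] hz.
    suff dd : d <= d / 2 :> R by exfalso; lra.
    move: hz; rewrite /square /= !in_itv /= -!ler_distl => -[h1 h2].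
    rewrite {1}/d ge_max; apply/andP; split.
      by rewrite (le_trans h1) // ge_min lexx orbT.
    by rewrite (le_trans h2) // ge_min lexx orbT.
  apply: IH zs _; move: hz; rewrite /square /= !in_itv /= -!ler_distl => -[h1 h2].
  by rewrite (le_trans h1) ?(le_trans h2) // ge_min lexx.
have [j ju jsub] := cell_basis u e0.
exists j => // z zmu /jsub ze; apply: He => //.
suff : [set` s] z by [].
rewrite -sP; split => //; move: ze; rewrite /square /= !in_itv /= -!ler_distl => -[h1 h2].
by rewrite (le_trans h1) // (le_trans h2).
Qed.

(** The sigma-algebra of [plane] is a product one, so an open set has to be written as a countable
    union of cells. This serves the local finiteness of restrictions, which is tested on compact
    sets. *)
Lemma closed_measurable (K : set (R * R)) : closed K -> measurable (K : set (plane R)).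
Proof.
move=> cK; rewrite -[X in measurable X]setCK; apply: measurableC.
have -> : ~` K = \bigcup_j (if `[< cell j `<=` ~` K >] then cell j else set0) :> set (plane R).
  apply/seteqP; split => [u nKu|u [j _]]; last by case: asboolP => // h /h.
  have oK : open (~` K) by exact: closed_openC.
  have /nbhs_ballP[e /= e0 eK] : nbhs u (~` K) by apply: open_nbhs_nbhs; split.
  have [j ju jsub] := @cell_basis u (e / 2) ltac:(by rewrite divr_gt0).
  exists j => //; case: asboolP => // -[] z /jsub.
  rewrite /square /= !in_itv /= -!ler_distl => -[h1 h2]; apply: eK.
  by split; rewrite /ball /= distrC; [apply: le_lt_trans h1 _|apply: le_lt_trans h2 _]; lra.
by apply: bigcupT_measurable => j; case: ifP => // _; exact: measurable_cell.
Qed.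

Lemma compact_measurable (K : set (R * R)) : compact K -> measurable (K : set (plane R)).
Proof. by move=> cK; apply: closed_measurable; exact: compact_closed cK. Qed.

Definition config_restr_measure mu (A : set (plane R)) (mA : measurable A) :
  {measure set (plane R) -> \bar R} := mrestr mu mA.

Lemma config_restr_simple mu A (mA : measurable A) :
  simple_point_measure (config_restr_measure mu mA).
Proof.
exists (config_support mu `&` A) => B mB.
rewrite /config_restr_measure /= /mrestr config_count; last exact: measurableI.
rewrite (setIC B) setIA esum_mkcondr; apply: eq_esum => x _.
by rewrite diracE; case: ifP.
Qed.

Lemma config_restr_locally_finite mu A (mA : measurable A) :
  locally_finite (config_restr_measure mu mA).
Proof.
move=> K cK; apply: le_lt_trans (config_locally_finite mu cK).
have mK := compact_measurable cK.
by apply: le_measure; [rewrite inE; exact: measurableI|rewrite inE|exact: subIsetl].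
Qed.

Definition config_restr mu A (mA : measurable A) : point_config R :=
  PointConfig (config_restr_simple mu mA) (config_restr_locally_finite mu mA).

Let add_measureE mu u B : measure_add mu (dirac u) B = (mu B + \d_u B)%E.
Proof. exact: measure_addE. Qed.

Lemma config_add_simple mu u : ~ config_support mu u ->
  simple_point_measure (measure_add mu (dirac u)).
Proof.
move=> nu; exists (u |` config_support mu) => B mB.
apply: etrans (add_measureE _ _ _) _; rewrite config_count //.
rewrite [RHS](esumID [set u]); last by move=> i _; rewrite diracE.
have -> : (u |` config_support mu) `&` [set u] = [set u].
  by apply/seteqP; split => [z []//|z ->]; split => //; left.
rewrite esum_set1; last by rewrite diracE.
rewrite [RHS]addeC; congr (_ + _)%E.
have -> : (u |` config_support mu) `&` ~` [set u] = config_support mu.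
  apply/seteqP; split => [z [[->|//]]|z zm]; first by move=> /(_ erefl).
  by split; [right|move=> zu; apply: nu; rewrite -zu].
by rewrite esum_mkcondr; apply: eq_esum => x _; rewrite diracE; case: ifP.
Qed.

Lemma config_add_locally_finite mu u : locally_finite (measure_add mu (dirac u)).
Proof.
move=> K cK; apply: (eq_ind_r (fun x => x < +oo)%E _ (add_measureE mu u K)).
rewrite lte_add_pinfty //; first exact: config_locally_finite.
by rewrite diracE ltry.
Qed.

(** A second unit mass at a point of [mu] would destroy simplicity, so [mu] is left unchanged there;
    an independent uniform point falls there with probability 0. *)
Definition config_add mu u : point_config R :=
  if pselect (config_support mu u) is right nu
  then PointConfig (config_add_simple nu) (@config_add_locally_finite mu u) else mu.

Lemma config_addE mu u B : ~ config_support mu u ->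
  config_add mu u B = (mu B + \d_u B)%E.
Proof. by rewrite /config_add; case: pselect => // nu _; exact: add_measureE. Qed.

Lemma config_add_id mu u : config_support mu u -> config_add mu u = mu.
Proof. by rewrite /config_add; case: pselect. Qed.

Lemma measurable_into_config d (T : measurableType d) (Y : T -> point_config R) :
  (forall A, measurable A -> measurable_fun setT (fun w => Y w A)) -> measurable_fun setT Y.
Proof.
move=> mY; apply: (@measurability _ _ _ _ _ _ (\bigcup_(A in @measurable _ (plane R))
  preimage_set_system [set: point_config R] (fun mu => mu A) measurable)) => //.
move=> _ [_ [A mA [B mB <-]] <-]; rewrite !setTI.
by have := mY A mA measurableT B mB; rewrite setTI.
Qed.

(** A point is off the support exactly when some cell contains it and has mass 0, so the complement
    is a countable union of measurable rectangles. *)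
Lemma measurable_support_pair d (T : measurableType d) (Pi : T -> point_config R) :
  measurable_fun setT Pi ->
  measurable [set wu : T * plane R | config_support (Pi wu.1) wu.2].
Proof.
move=> mPi; rewrite -[X in measurable X]setCK; apply: measurableC.
have -> : ~` [set wu : T * plane R | config_support (Pi wu.1) wu.2] =
    \bigcup_j ((Pi @^-1` [set mu | mu (cell j) = 0%E]) `*` cell j).
  apply/seteqP; split => [[w u] /= nwu|[w u] [j _ [/= w0 ju] wu]].
    have [j ju jsub] := config_isolated (Pi w) u.
    exists j => //; split => //=; rewrite config_count; last exact: measurable_cell.
    have -> : config_support (Pi w) `&` cell j = set0.
      by apply/seteqP; split => // z [zm /(jsub _ zm) zu]; apply: nwu; rewrite -zu.
    by rewrite esum_set0.
  have : (Pi w [set u] <= Pi w (cell j))%E.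
    apply: le_measure; rewrite ?inE; [exact: measurable_plane_set1|exact: measurable_cell|].
    by move=> _ ->.
  by rewrite w0 wu; apply/negP; rewrite -ltNge lte01.
apply: bigcupT_measurable => j; apply: measurableX; last exact: measurable_cell.
rewrite -[X in measurable X]setTI; apply: mPi => //.
rewrite -[X in measurable X]setTI.
exact: (measurable_config_eval (measurable_cell j) measurableT (emeasurable_set1 0%E)).
Qed.

Lemma measurable_config_add d (T : measurableType d) (Pi : T -> point_config R) :
  measurable_fun setT Pi ->
  measurable_fun setT (fun wu : T * plane R => config_add (Pi wu.1) wu.2).
Proof.
move=> mPi; apply: measurable_into_config => A mA.
have mS := measurable_support_pair mPi.
have mPiA : measurable_fun setT (fun wu : T * plane R => Pi wu.1 A).
  apply: (measurableT_comp (measurable_config_eval mA)).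
  exact: (measurableT_comp mPi).
rewrite (_ : (fun _ => _) = (fun wu : T * plane R =>
    if wu \in [set wu : T * plane R | config_support (Pi wu.1) wu.2] then Pi wu.1 A
    else (Pi wu.1 A + \d_(wu.2) A)%E)); last first.
  apply/funext => -[w u] /=; case: ifPn => /=.
    by rewrite inE /= => h; rewrite config_add_id.
  by move=> /negP; rewrite inE /= => h; rewrite config_addE.
apply: measurable_fun_ifT => //.
  by apply: (@measurable_fun_bool _ _ _ _ true); rewrite setTI;
    rewrite (_ : _ @^-1` _ = [set wu : T * plane R | config_support (Pi wu.1) wu.2]) //;
    apply/seteqP; split => x /=; [move=> /set_mem|move=> /mem_set].
apply: emeasurable_funD => //.
rewrite (_ : (fun x : T * plane R => \d_(x.2) A) =
   (fun x : T * plane R => (\1_(snd @^-1` A) x)%:E)); last first.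
  by apply/funext => x; rewrite diracE indicE.
apply/measurable_EFinP; apply: measurable_indic.
by rewrite -[X in measurable X]setTI; apply: measurable_snd.
Qed.

End rational_cells.

Section selection.
Variables (d d' : measure_display) (T : measurableType d) (V : measurableType d').

Lemma measurable_fun_select (J : T -> nat) (F : nat -> T -> V) :
  (forall j, measurable (J @^-1` [set j])) -> (forall j, measurable_fun setT (F j)) ->
  measurable_fun setT (fun w => F (J w) w).
Proof.
move=> mJ mF _ A mA; rewrite setTI.
have -> : (fun w => F (J w) w) @^-1` A = \bigcup_j (J @^-1` [set j] `&` F j @^-1` A).
  by apply/seteqP; split => [w Aw|w [j _ [/= <-]]//]; exists (J w).
apply: bigcupT_measurable => j; apply: measurableI => //.
by rewrite -[X in measurable X]setTI; exact: mF.
Qed.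

Definition first_index (D : nat -> set T) (w : T) : nat :=
  if pselect (exists j, `[< D j w >]) is left ex then ex_minn ex else 0.

Lemma first_indexP (D : nat -> set T) w : (exists j, D j w) -> D (first_index D w) w.
Proof.
move=> [j Dj]; rewrite /first_index; case: pselect => [ex|[]]; last by exists j; apply/asboolP.
by case: ex_minnP => m /asboolP.
Qed.

Lemma measurable_first_index (D : nat -> set T) j : (forall i, measurable (D i)) ->
  measurable (first_index D @^-1` [set j]).
Proof.
move=> mD.
have -> : first_index D @^-1` [set j] =
   (D j `&` \bigcap_(i < j) ~` D i) `|` (if j == 0 then \bigcap_i ~` D i else set0).
  apply/seteqP; split => w /=; rewrite /first_index; case: pselect => [ex|nex].
  - case: ex_minnP => m /asboolP Dm minm <-; left; split => // i /= im Di.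
    by have := minm i (asboolT Di); rewrite leqNgt im.
  - move=> j0; right; rewrite -j0 /= => i _ Di; apply: nex; exists i; exact/asboolP.
  - case: ex_minnP => m /asboolP Dm minm [[Dj nD]|].
      apply/eqP; rewrite eqn_leq (minm j) ?andTb; last exact/asboolP.
      by rewrite leqNgt; apply/negP => /nD; apply.
    by case: ifP => // _ h; have := h m I Dm.
  - case=> [[Dj _]|]; first by case: nex; exists j; apply/asboolP.
    by case: eqP => [->|].
apply: measurableU.
  by apply: measurableI => //; apply: bigcap_measurableType => // i _; exact: measurableC.
by case: ifP => // _; apply: bigcap_measurable => // i _; exact: measurableC.
Qed.

End selection.

Section uniform_square.
Variable R : realType.

Let leb : {measure set (plane R) -> \bar R} := (@lebesgue_measure R \x @lebesgue_measure R)%E.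

Lemma lebesgue2_finite_set (A : set (plane R)) : finite_set A -> lebesgue2 A = 0%E.
Proof.
move=> /finite_seqP[s ->].
suff : measurable ([set` s] : set (plane R)) /\ lebesgue2 ([set` s] : set (plane R)) = 0%E by case.
elim: s => [|x s [ms IH]].
  by rewrite set_nil; split => //; exact: (measure0 leb).
have -> : [set` x :: s] = x |` [set` s].
  by apply/seteqP; split => z /=; rewrite inE => /predU1P.
have mx := measurable_plane_set1 x.
split; first exact: measurableU.
apply/eqP; rewrite eq_le; apply/andP; split; last exact: (measure_ge0 leb).
have h : (leb (x |` [set` s]) <= leb [set x] + leb [set` s])%E by exact: measureU2.
apply: (le_trans h); rewrite (IH : leb [set` s] = 0%E) adde0.
have h0 : leb (square x 0) = 0%E.
  by apply: etrans (lebesgue2_square x (lexx 0)) _; rewrite mulr0 expr0n.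
rewrite -h0; apply: (le_measure leb); rewrite ?inE //; first exact: measurable_square.
by move=> _ ->; rewrite /square /= !in_itv /= !subr0 !addr0 !lexx.
Qed.

(** The square [1,3]^2, of area 4, avoids the origin, which [excess_set_succ] excludes. *)
Definition unit_square : set (plane R) := square (2, 2) 1.

Let mS : measurable unit_square := measurable_square _ _.

Definition uniform_square : probability (plane R) R :=
  mnormalize (mrestr leb mS) (dirac point).

Lemma lebesgue2_unit_square : lebesgue2 unit_square = 4%:E.
Proof. by rewrite lebesgue2_square //; congr _%:E; ring. Qed.

Lemma uniform_squareE A : uniform_square A = (lebesgue2 (A `&` unit_square) * 4^-1%:E)%E.
Proof.
have E : mrestr leb mS setT = 4%:E.
  by rewrite /mrestr setTI -lebesgue2_unit_square.
rewrite -[LHS]/(mnormalize (mrestr leb mS) (dirac point) A) /mnormalize.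
case: ifPn => [/orP[/eqP h|/eqP h]|_].
- by move: (etrans (esym E) h) => [] /eqP; rewrite pnatr_eq0.
- by move: (etrans (esym E) h).
- by congr (_ * _)%E; rewrite [X in fine X](_ : _ = 4%:E).
Qed.

Lemma unit_square_neq0 u : unit_square u -> normc (toC u) != 0.
Proof.
rewrite normc_eq0; case: u => x y; rewrite /unit_square /square /= !in_itv /= => -[/andP[h _] _].
by apply/eqP => -[x0 _]; move: h; rewrite x0; lra.
Qed.

End uniform_square.

(** The thresholds 16^k / 2 - 4k are nonnegative for every [k], so the empty configuration exceeds
    none of them. This provides a point to delete. *)
Lemma excess_set0_support (R : realType) (mu : point_config R) :
  excess_set 0 mu -> exists z, config_support mu z.
Proof.
move=> H; apply: contrapT => ne; have [k _] := H 0 I.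
rewrite /= /log_count (@eq_measure_integral _ _ _ _ mzero); last first.
  move=> A mA _; rewrite config_count // (_ : config_support mu `&` A = set0) ?esum_set0 //.
  by apply/seteqP; split => // z [zm _]; apply: ne; exists z.
rewrite integral_measure_zero lte_fin ltNge => /negP; apply.
have two n : 1 + n%:R <= 2 ^+ n :> R.
  by elim: n => [|n IH]; rewrite ?expr0 ?addr0 // exprS -natr1; move: (ler0n R n); lra.
have : 8 * k%:R <= 16 ^+ k :> R.
  case: k => [|k]; first by rewrite mulr0 expr0.
  have : 2 ^+ k <= 16 ^+ k :> R by apply: lerXn2r; rewrite ?nnegrE; lra.
  by rewrite exprS -natr1; move: (two k) (ler0n R k); lra.
by lra.
Qed.

Section single_point.
Variable R : realType.
Implicit Types (mu : point_config R) (A B : set (plane R)).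

Lemma config_singleton mu A : measurable A -> mu A = 1%E ->
  exists z, config_support mu `&` A = [set z].
Proof.
move=> mA mu1.
have [z zA] : exists z, (config_support mu `&` A) z.
  apply: contrapT => ne; move: mu1; rewrite config_count // (_ : _ `&` _ = set0) ?esum_set0.
    by move=> /esym/eqP; rewrite onee_eq0.
  by apply/seteqP; split => // z zA; apply: ne; exists z.
exists z; apply/seteqP; split => [y [ym yA]|_ -> //]; apply: contrapT => yz.
case: zA => zm zA; have my := measurable_plane_set1 y; have mz := measurable_plane_set1 z.
have : (mu ([set y] `|` [set z]) <= mu A)%E.
  apply: le_measure; rewrite ?inE //; first exact: measurableU.
  by move=> _ [->|->].
have -> : (mu ([set y] `|` [set z]) = mu [set y] + mu [set z])%E.
  by apply: measureU => //; apply/seteqP; split => // x [-> /yz].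
by rewrite mu1 (ym : mu [set y] = 1%E) (zm : mu [set z] = 1%E) -EFinD lee_fin; lra.
Qed.

Lemma config_dirac mu A B z : measurable A -> measurable B ->
  config_support mu `&` A = [set z] -> mu (B `&` A) = (\d_z B)%R.
Proof.
move=> mA mB zE; rewrite config_count; last exact: measurableI.
rewrite (setIC B) setIA zE esum_mkcondr esum_set1; last by case: ifP.
by rewrite diracE; case: ifP.
Qed.

End single_point.

(** * Refutation of both kinds of tolerance *)

Section tolerance.
Variables (R : realType) (d : measure_display) (T : measurableType d) (P : probability T R).
Variable Pi : {RV P >-> point_config R}.
Hypothesis ae0 : {ae P, forall w, excess_set 0 (Pi w)}.
Hypothesis ae26 : {ae P, forall w, ~ excess_set 26 (Pi w)}.

Let measurable_excess j : measurable (Pi @^-1` excess_set j).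
Proof.
by rewrite -[X in measurable X]setTI; apply: measurable_funPT => //; exact: measurable_excess_set.
Qed.

(** Tolerance says that if [excess_set j.+1] is null for [Pi], it is null for Pi + delta_U, and
    inserting U leads from [excess_set j] into it. Nullity thus descends from index 26 to index 0,
    where the event has probability 1. *)
Lemma not_insertion_tolerant : ~ insertion_tolerant P Pi.
Proof.
move=> tol.
pose Q := uniform_square R; pose P' : probability (T * plane R)%type R := (P \x Q)%E.
have mPi : measurable_fun setT Pi by [].
pose S := @unit_square R; have mS : measurable S by exact: measurable_square.
have mPi' : measurable_fun setT (fun wu : T * plane R => Pi wu.1) by exact: measurableT_comp.
pose Pi' : {mfun (T * plane R)%type >-> point_config R} :=
  HB.pack (fun wu : T * plane R => Pi wu.1) (isMeasurableFun.Build _ _ _ _ _ mPi').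
pose Y : {mfun (T * plane R)%type >-> point_config R} :=
  HB.pack (fun wu : T * plane R => config_add (Pi wu.1) wu.2)
    (isMeasurableFun.Build _ _ _ _ _ (measurable_config_add mPi)).
pose U : {mfun (T * plane R)%type >-> plane R} :=
  HB.pack (fun wu : T * plane R => wu.2) (isMeasurableFun.Build _ _ _ _ _ measurable_snd).
have PE A B : measurable A -> measurable B -> P' (A `*` B) = (P A * Q B)%E.
  by move=> mA mB; exact: product_measure1E.
have mPiA A : measurable A -> measurable (Pi @^-1` A).
  by move=> mA; rewrite -[X in measurable X]setTI; exact: measurable_funPT.
have PiE A : measurable A -> P' (Pi' @^-1` A) = P (Pi @^-1` A).
  move=> mA; have -> : Pi' @^-1` A = (Pi @^-1` A) `*` setT.
    by apply/seteqP; split => [[w u]|[w u] []].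
  by rewrite PE //; [rewrite probability_setT mule1|exact: mPiA].
have UE B : measurable B -> P' (U @^-1` B) = Q B.
  move=> mB; have -> : U @^-1` B = setT `*` B.
    by apply/seteqP; split => [[w u]|[w u] []].
  by rewrite PE // probability_setT mul1e.
have QS : Q (~` S) = 0%E.
  by rewrite /Q uniform_squareE setICl /lebesgue2 measure0 mul0e.
pose N := [set wu : T * plane R | config_support (Pi wu.1) wu.2].
have mN : measurable N by exact: measurable_support_pair.
(* By Fubini: for each configuration the square contains finitely many points, a set of measure
   0. *)
have PN : P' N = 0%E.
  apply: integral0_eq => w _; rewrite /= /Q uniform_squareE.
  rewrite lebesgue2_finite_set ?mul0e //.
  have -> : xsection N w = config_support (Pi w).
    by apply/seteqP; split => u; rewrite /xsection /= inE.
  apply: config_finite (@subset_refl _ S); first exact: compact_square.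
  exact: mS.
have law : same_law P' Pi' P Pi by exact: PiE.
have unif : uniform_on P' U S.
  move=> A mA; rewrite UE // /Q uniform_squareE lebesgue2_unit_square.
  by rewrite inver; case: eqP => // /eqP; rewrite pnatr_eq0.
have indep : independent_pair P' U Pi'.
  move=> A B mA mB; rewrite UE // PiE //.
  have -> : U @^-1` A `&` Pi' @^-1` B = (Pi @^-1` B) `*` A.
    by apply/seteqP; split => [[w u] []|[w u] []].
  by rewrite PE 1?muleC //; exact: mPiA.
have aeY : {ae P', forall w, forall B : set (plane R), measurable B ->
    Y w B = (Pi' w B + \d_(U w) B)%E}.
  exists N; split => // wu nwu; apply: contrapT => h; apply: nwu => B mB.
  exact: config_addE.
have S0 : (0 < lebesgue2 S)%E by rewrite lebesgue2_unit_square lte_fin.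
have Soo : (lebesgue2 S < +oo)%E by rewrite lebesgue2_unit_square ltry.
have ac := tol S mS S0 Soo _ _ _ _ _ _ law unif indep aeY.
have step j : P (Pi @^-1` excess_set j.+1) = 0%E -> P (Pi @^-1` excess_set j) = 0%E.
  move=> P0; have Y0 := ac _ (measurable_excess_set _) P0.
  rewrite -PiE; last exact: measurable_excess_set.
  have mY : measurable (Y @^-1` excess_set j.+1).
    rewrite -[X in measurable X]setTI; apply: measurable_funPT => //.
    exact: measurable_excess_set.
  have mUS : measurable (U @^-1` ~` S).
    rewrite -[X in measurable X]setTI; apply: measurable_funPT => //.
    exact: measurableC.
  suff : P'.-negligible (Pi' @^-1` excess_set j).
    move=> /negligibleP; apply.
    rewrite -[X in measurable X]setTI; apply: measurable_funPT => //.
    exact: measurable_excess_set.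
  apply: (@negligibleS _ _ _ _ (Y @^-1` excess_set j.+1 `|` (N `|` U @^-1` ~` S))).
    move=> [w u] wj; have [wN|wN] := pselect (N (w, u)); first by right; left.
    have [uS|uS] := pselect (S u); last by right; right.
    left; apply: (excess_set_succ (unit_square_neq0 uS) _ wj) => B mB.
    exact: config_addE.
  apply: negligibleU; first exact: (proj2 (negligibleP _ mY) Y0).
  apply: negligibleU; first exact: (proj2 (negligibleP _ mN) PN).
  by apply: (proj2 (negligibleP _ mUS)); rewrite -QS; apply: UE; exact: measurableC.
have all0 n : (n <= 26)%N -> P (Pi @^-1` excess_set (26 - n)) = 0%E.
  elim: n => [|n IH] n26.
    rewrite subn0; apply/negligibleP => //; apply: negligibleS ae26.
    by move=> w /= wA; apply.
  apply: step; rewrite -subSn // subSS; apply: IH; exact: ltnW.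
have n0 := proj2 (negligibleP _ (measurable_excess 0)) (all0 26%N (leqnn _)).
have : P.-negligible setT.
  apply: negligibleS (negligibleU ae0 n0) => w _ /=.
  by have [h|h] := pselect (excess_set 0 (Pi w)); [right|left].
move=> /(proj1 (negligibleP P measurableT)) PT.
by move: (probability_setT P); rewrite PT => /esym/eqP; rewrite onee_eq0.
Qed.

Hypothesis ae_neq0 : {ae P, forall w, forall z, config_support (Pi w) z -> normc (toC z) != 0}.

(** The point to delete must be chosen measurably on the given space: the first cell carrying
    exactly one point provides it, and restriction to the complement of that cell deletes it. Then
    Pi = Y + delta_Z almost surely, and nullity of the complement ascends from index 0 to index
    26. *)
Lemma not_deletion_tolerant : ~ deletion_tolerant P Pi.
Proof.
move=> tol.
have mPi : measurable_fun setT Pi by [].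
have mcell j := @measurable_cell R j.
pose D j := [set w | Pi w (cell j) = 1%E].
have mPiA A c : measurable A -> measurable [set w | Pi w A = c].
  move=> mA; have := mPi measurableT _ (measurable_config_eval mA measurableT (emeasurable_set1 c)).
  by rewrite !setTI.
have mD j : measurable (D j) by exact: mPiA.
pose J := first_index D.
have mJ j : measurable (J @^-1` [set j]) by exact: measurable_first_index.
pose pt j w := xget 0 (config_support (Pi w) `&` cell j).
have cell1 j w : D j w -> config_support (Pi w) `&` cell j = [set pt j w].
  move=> /(config_singleton (mcell j)) [z zE].
  have : [set z] (pt j w) by rewrite -zE; apply: xgetPex; exists z; rewrite zE.
  by move=> ->.
(* The default 0 off [D j] keeps [F j] measurable; on [D j] the point lies in a set A exactly when
   the part of the cell inside A has mass 1. *)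
pose F j w : plane R := if w \in D j then pt j w else 0.
have mF j : measurable_fun setT (F j).
  move=> _ A mA; rewrite setTI.
  have -> : F j @^-1` A = (D j `&` [set w | Pi w (cell j `&` A) = 1%E]) `|`
      (~` D j `&` [set w | A 0]).
    apply/seteqP; split => w /=; rewrite /F; case: ifPn => /=; rewrite ?inE ?notin_setE => Dw.
    - move=> Ap; left; split => //; rewrite setIC (config_dirac (mcell j) _ (cell1 _ _ Dw)) //.
      by rewrite diracE mem_set.
    - by right.
    - case=> [[_]|[]//]; rewrite setIC (config_dirac (mcell j) _ (cell1 _ _ Dw)) // diracE.
      by case: (boolP (_ \in A)) => [/set_mem //|_ /eqP]; rewrite eqe (eq_sym 0) oner_eq0.
    - by case=> [[]|[]].
  apply: measurableU; apply: measurableI => //; first exact/mPiA/measurableI.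
    exact: measurableC.
  have [A0|A0] := pselect (A 0).
    by rewrite (_ : [set _ | _] = setT) //; apply/seteqP; split.
  by rewrite (_ : [set _ | _] = set0) //; apply/seteqP; split.
have mcellC j : measurable (~` cell j) := measurableC (mcell j).
pose G j w := config_restr (Pi w) (mcellC j).
have mG j : measurable_fun setT (G j).
  apply: measurable_into_config => A mA.
  exact: (measurableT_comp (measurable_config_eval (measurableI _ _ mA (mcellC j))) mPi).
pose Z : {mfun T >-> plane R} := HB.pack (fun w => F (J w) w)
  (isMeasurableFun.Build _ _ _ _ _ (measurable_fun_select mJ mF)).
pose Y : {mfun T >-> point_config R} := HB.pack (fun w => G (J w) w)
  (isMeasurableFun.Build _ _ _ _ _ (measurable_fun_select mJ mG)).
have good w : excess_set 0 (Pi w) -> D (J w) w.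
  move=> /excess_set0_support[z zm]; apply: first_indexP.
  have [j jz jsub] := config_isolated (Pi w) z; exists j.
  rewrite /D /= config_count // (_ : _ `&` _ = [set z]) ?esum_set1 //.
  by apply/seteqP; split => [y [ym yj]|_ ->]; [exact: jsub|split].
have ZE w : D (J w) w -> config_support (Pi w) `&` cell (J w) = [set Z w].
  by move=> h; rewrite (cell1 _ _ h) /Z /= /F ifT // inE.
have decomp w B : D (J w) w -> measurable B -> Pi w B = (Y w B + \d_(Z w) B)%E.
  move=> h mB; have -> : Y w B = Pi w (B `\` cell (J w)) by rewrite setDE.
  have -> : Pi w B = (Pi w (B `\` cell (J w)) + Pi w (B `&` cell (J w)))%E by exact: measureDI.
  congr (_ + _)%E.
  by apply: config_dirac => //; exact: ZE.
have pointZ : is_point_of P Pi Z.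
  apply: negligibleS ae0 => w /= nw h; apply: nw.
  by have : [set Z w] (Z w) by []; rewrite -(ZE _ (good _ h)) => -[].
have aeY : {ae P, forall w, forall B : set (plane R), measurable B ->
    Y w B = (Pi w B - \d_(Z w) B)%E}.
  apply: negligibleS ae0 => w /= nw h; apply: nw => B mB.
  by rewrite (decomp _ _ (good _ h) mB) addeK // diracE.
have ac := tol Z Y pointZ aeY.
have step j : P (Pi @^-1` ~` excess_set j) = 0%E -> P (Pi @^-1` ~` excess_set j.+1) = 0%E.
  move=> P0; have Y0 := ac _ (measurableC (measurable_excess_set _)) P0.
  apply: (proj1 (negligibleP _ (measurableC (measurable_excess j.+1)))).
  have mY : measurable (Y @^-1` ~` excess_set j).
    rewrite -[X in measurable X]setTI; apply: measurable_funPT => //.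
    exact: measurableC (measurable_excess_set _).
  apply: negligibleS (negligibleU (negligibleU ae0 ae_neq0) (proj2 (negligibleP _ mY) Y0)).
  move=> w /= wj; apply: contrapT; rewrite not_orP => -[]; rewrite not_orP /=.
  move=> -[/contrapT h0 /contrapT hz] /contrapT Yj.
  apply: wj; apply: (excess_set_succ _ _ Yj); last by move=> B; exact: (decomp _ _ (good _ h0)).
  apply: hz; have : [set Z w] (Z w) by [].
  by rewrite -(ZE _ (good _ h0)) => -[].
have all0 n : P (Pi @^-1` ~` excess_set n) = 0%E.
  elim: n => [|n]; last exact: step.
  exact: (proj1 (negligibleP _ (measurableC (measurable_excess 0))) ae0).
have n0 := proj2 (negligibleP _ (measurableC (measurable_excess 26))) (all0 26%N).
have : P.-negligible setT.
  apply: negligibleS (negligibleU ae26 n0) => w _ /=.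
  by have [h|h] := pselect (excess_set 26 (Pi w)); [left; apply|right].
move=> /(proj1 (negligibleP P measurableT)) PT.
by move: (probability_setT P); rewrite PT => /esym/eqP; rewrite onee_eq0.
Qed.

End tolerance.

Theorem proposition12 (R : realType) (d : measure_display)
    (T : measurableType d) (P : probability T R)
    (a : nat -> {RV P >-> plane R}) (Upsilon : {RV P >-> point_config R}) :
  independent_family P a ->
  (forall n : nat, std_complex_gaussian P (a n)) ->
  {ae P, forall w,
     config_support (Upsilon w) =
     [set z : plane R | gaf (fun n => a n w) (toC z) = 0]} ->
  ~ insertion_tolerant P Upsilon /\ ~ deletion_tolerant P Upsilon.
Proof.
move=> inda gaussa support_eq.
(* The nodes depend on [k] and [m] but not on the path, so the almost sure bound and the pathwise
   inequality speak of the same ones. *)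
have [nodes nodesP] : exists nodes : nat -> nat -> seq R[i], forall k m,
    [/\ size (nodes k m) = (m.+1 ^ 2)%N,
        forall w, w \in nodes k m -> normc w = node_radius R k &
        forall b (rs : seq R[i]),
          \prod_(w <- nodes k m) normc (b *: \prod_(z <- rs) ('X - z%:P)).[w] <=
          2 ^+ size rs *
            (normc b * \prod_(z <- rs) Num.max (normc z) (node_radius R k)) ^+ (m.+1 ^ 2)].
  have ex k m := @jensen_lower R (node_radius R k) (m.+1 ^ 2)
    (exprn_ge0 _ (ler0n _ _)) (expn_gt0 _ _).
  exists (fun k m => projT1 (cid (ex k m))) => k m.
  exact: projT2 (cid (ex k m)).
have ae_good := negligibleU support_eq (negligibleU (ae_growth gaussa)
  (negligibleU (ae_coef0_neq0 gaussa) (negligibleU (ae_simple_zeros inda gaussa)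
  (ae_lower_bound inda gaussa (fun k m => let: And3 h _ _ := nodesP k m in h)
     (fun k m => let: And3 _ h _ := nodesP k m in h))))).
pose good w := [/\ config_support (Upsilon w) = [set z | gaf (fun n => a n w) (toC z) = 0],
  exists K, forall n, normc (toC (a n w)) <= K * n.+1%:R ^+ 2,
  toC (a 0%N w) != 0, excess_set 0 (Upsilon w) & ~ excess_set 26 (Upsilon w)].
have {ae_good} ae_good : {ae P, forall w, good w}.
  apply: negligibleS ae_good => w; apply: contraPP; rewrite !not_orP /=.
  move=> [] /contrapT supp [] /contrapT [K aK] [] /contrapT a0 [] /contrapT simple
    /contrapT large; apply; split => //.
  - by exists K.
  - exact: (excess_set0 aK a0 supp simple
      (fun k m => let: And3 _ _ h := nodesP k m in h) large).
  - exact: (not_excess_set26 aK a0 supp).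
have ae_sub (Q : T -> Prop) : (forall w, good w -> Q w) -> {ae P, forall w, Q w}.
  by move=> h; apply: negligibleS ae_good => w /= nQ /h.
split.
  by apply: not_insertion_tolerant; apply: ae_sub => w [].
apply: not_deletion_tolerant; try by apply: ae_sub => w [].
apply: ae_sub => w [supp [K aK] a0 _ _] z.
by rewrite supp => /(gaf_zero_neq0 aK a0); rewrite normc_eq0.
Qed.
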